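(* Let $S\subset\mathbb{R}^d$ be compact, and let $(Y,N)$ be the Poisson-Gaussian Mixture Process (POGAMP) specified hierarchically by a Poisson process $N$ on $S$ with intensity $\lambda$, a class of distributions $f$, and a base Gaussian measure $\mathcal{G}_Y$ (see context). Consider the measurable space $(\mathcal{Y}\times\mathcal{N},\ \sigma(\mathcal{B}(\mathcal{Y})\times\mathcal{B}(\mathcal{N})))$, where $\mathcal{Y}$ is the Banach space of continuous real-valued functions on $S$, $\mathcal{B}(\mathcal{Y})$ is the Borel $\sigma$-algebra generated by the open sets of $\mathcal{Y}$ in the strong (norm) topology, $\mathcal{N}$ is the space of all finite subsets of $S$, and $\mathcal{B}(\mathcal{N})$ is the smallest $\sigma$-algebra that makes all counting functionals measurable. Then the hierarchical specification (i)-(iii) of $(Y,N)$ defines a probability measure $\mathcal{P}$ on $(\mathcal{Y}\times\mathcal{N},\ \sigma(\mathcal{B}(\mathcal{Y})\times\mathcal{B}(\mathcal{N})))$; that is, there is a probability measure $\mathcal{P}$ on this space under which $(Y,N)$ satisfies (i), (ii) and (iii). In particular, $Y$ under $\mathcal{P}$ is a valid stochastic process.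
   Context: Setting. $S\subset\mathbb{R}^d$ ($d\in\mathbb{N}$) is compact. For a finite set of locations $N\subset S$, $|N|$ denotes its cardinality and $S_N=(S_{N,1},\dots,S_{N,|N|})$ its locations. Counting functionals are the maps $N\mapsto |N\cap B|$ for Borel $B\subset S$. Base Gaussian process. $\mathcal{G}_Y$ is the law of a Gaussian process on $S$ with mean function $\mu$ and covariance function $\Sigma$, whose covariance matrix at any finite collection of distinct locations is positive definite; it is regarded as a probability measure on $(\mathcal{Y},\mathcal{B}(\mathcal{Y}))$, i.e. it has continuous paths. The class $f$. $f$ is a class of distributions that, for any finite set of locations $S_N$ in $S$, specifies a continuous multivariate distribution (for the vector of values at these locations) with Lebesgue density $f_N$, support $\mathcal{X}^{|N|}$ ($\mathcal{X}\subset\mathbb{R}$), and a positive definite covariance matrix. It is assumed that $f_N(y)$ is continuous in $(S_N,y)\in S^{|N|}\times\mathcal{X}^{|N|}$ for every $|N|\in\mathbb{N}$, and that it is uniformly integrable with respect to the $|N|$-dimensional Lebesgue measure. POGAMP. $(Y,N)$, with $Y=\{Y(s):s\in S\}$, is defined by: (i) $N$ is a Poisson process on $S$ with intensity function $\lambda=\{\lambda(s):s\in S\}$ (with $\Lambda_S=\int_S\lambda(s)\,ds<\infty$), with events $S_N$; (ii) conditional on $N$, the vector $Y_N:=(Y(S_{N,1}),\dots,Y(S_{N,|N|}))$ has density $f_N$; (iii) conditional on $(N,Y_N)$, $\{Y(s):s\in S\setminus N\}$ follows the conditional Gaussian measure induced by $\mathcal{G}_Y$ (the conditional law under $\mathcal{G}_Y$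 given the values $Y_N$ at $S_N$). *)

(* Defs.v *)
From HB Require Import structures.
From mathcomp Require Import all_boot all_order all_algebra finmap.
From mathcomp Require Import all_classical all_reals all_analysis measurable_realfun.
Set Implicit Arguments.
Unset Strict Implicit.
Unset Printing Implicit Defensive.
Import Order.TTheory GRing.Theory Num.Theory.
Import numFieldNormedType.Exports.
Local Open Scope classical_set_scope.
Local Open Scope ring_scope.

(* Matrices, in particular R^n = 'rV[R]_n, carry the Borel sigma-algebra. *)
HB.instance Definition _ (R : realType) (m n : nat) :=
  @isMeasurable.Build (sigma_display (@open 'M[R]_(m, n))) 'M[R]_(m, n)
    <<s open >> (@sigma_algebra0 _ setT open) (@sigma_algebraC _ open)
    (@sigma_algebra_bigcup _ setT open).

Section borel_matrix.
Variables (R : realType) (m n : nat).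

Lemma measurable_mx_coord (i : 'I_m) (j : 'I_n) :
  measurable_fun setT (fun M : 'M[R]_(m, n) => M i j).
Proof.
apply: (measurability _ (RGenOpens.measurableE R)).
move=> _ [_ [a [b ->]] <-]; rewrite setTI; apply: sub_sigma_algebra.
have /continuousP := @coord_continuous R m n i j.
by apply; exact: interval_open.
Qed.

Let box (M : 'M[rat]_(m, n)) (k : nat) : set 'M[R]_(m, n) :=
  [set N | forall i j, ball (ratr (M i j) : R) k.+1%:R^-1 (N i j)].

Lemma measurable_mxP d (T : measurableType d) (f : T -> 'M[R]_(m, n)) :
  (forall i j, measurable_fun setT (fun x => f x i j)) ->
  measurable_fun setT f.
Proof.
move=> mf; apply: (@measurability _ _ _ _ setT f open) => //.
move=> _ [U oU <-]; rewrite setTI.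
have mbox M k : measurable (f @^-1` box M k).
  rewrite [X in measurable X](_ : _ = \bigcap_(p in [set: 'I_m * 'I_n])
       (fun x => f x p.1 p.2) @^-1` ball (ratr (M p.1 p.2) : R) (k.+1%:R^-1 : R)).
    apply: fin_bigcap_measurable; first exact: finite_finset.
    move=> -[i j] _ /=.
    rewrite -[X in measurable X]setTI; apply: mf => //.
    exact: measurable_ball.
  apply/seteqP; split => x /=.
    by move=> h [i j] _; exact: h.
  by move=> h i j; exact: (h (i, j)).
rewrite [X in measurable X](_ : _ = \bigcup_(p in [set: 'M[rat]_(m, n) * nat])
    (if `[< box p.1 p.2 `<=` U >] then f @^-1` box p.1 p.2 else set0)).
  apply: countable_bigcupT_measurable => // p.
  by case: ifPn => // _; exact: measurable0.
apply/seteqP; split => x /=; last first.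
  by move=> [p _]; case: ifPn => // /asboolP pU /pU.
move=> Ux; have /nbhs_ballP[e /= e0 eU] : nbhs (f x) U by exact: open_nbhs_nbhs.
pose k := Num.trunc (2 / e).
have k0 : 0 < k.+1%:R^-1 :> R by rewrite invr_gt0.
have ke : k.+1%:R^-1 + k.+1%:R^-1 < e :> R.
  have -> : k.+1%:R^-1 + k.+1%:R^-1 = 2 / k.+1%:R :> R.
    by rewrite -[RHS]mulrC mulr_natr mulr2n.
  rewrite ltr_pdivrMr// mulrC -ltr_pdivrMr//.
  by rewrite /k truncnS_gt.
have /choice[M hM] : forall ij : 'I_m * 'I_n, exists q : rat,
    ball (ratr q : R) k.+1%:R^-1 (f x ij.1 ij.2).
  move=> ij; set z := f x ij.1 ij.2.
  have [q] : exists q, ratr q \in `]z - k.+1%:R^-1, z + k.+1%:R^-1[.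
    by apply: rat_in_itvoo; rewrite ltrD2l gt0_cp.
  by rewrite in_itv/= -ltr_distl => h; exists q.
exists (\matrix_(i, j) M (i, j), k) => //=; case: asboolP => [_ i j|]; first by rewrite mxE; exact: (hM (i, j)).
case=> N hN; apply: eU; split => // i j.
have h1 : ball (f x i j) k.+1%:R^-1 (ratr (M (i, j)) : R).
  exact/ball_sym/(hM (i, j)).
have h2 : ball (ratr (M (i, j)) : R) k.+1%:R^-1 (N i j).
  by have := hN i j; rewrite mxE.
exact: le_ball (ltW ke) _ (ball_triangle h1 h2).
Qed.
End borel_matrix.

(* Lebesgue measure on R^n, as the n-fold product of the one on R. *)
Section lebesgue.
Variable R : realType.

Definition cons_rV n (p : R * 'rV[R]_n) : 'rV[R]_n.+1 :=
  row_mx (const_mx p.1 : 'rV_1) p.2.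

Lemma measurable_cons_rV n : measurable_fun setT (@cons_rV n).
Proof.
apply: measurable_mxP => i j; rewrite /cons_rV.
case: (@split_ordP 1 n j) => l ->.
  rewrite (_ : (fun _ => _) = fst); first exact: measurable_fst.
  by apply/funext => -[x v]; rewrite [LHS]row_mxEl mxE.
rewrite (_ : (fun _ => _) = (fun p : R * 'rV[R]_n => p.2 i l)); last first.
  by apply/funext => -[x v]; rewrite [LHS]row_mxEr.
apply: (measurableT_comp (measurable_mx_coord i l)); exact: measurable_snd.
Qed.

Lemma measurable_uncons_rV n : measurable_fun setT
  (fun v : 'rV[R]_n.+1 => (v 0 0, rsubmx (v : 'rV_(1 + n)))).
Proof.
apply: measurable_fun_pair; first exact: measurable_mx_coord.
apply: measurable_mxP => i j.
under eq_fun do rewrite mxE.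
exact: measurable_mx_coord.
Qed.

Lemma uncons_rVK n : cancel (@cons_rV n)
  (fun v : 'rV[R]_n.+1 => (v 0 0, rsubmx (v : 'rV_(1 + n)))).
Proof.
move=> [x v]; rewrite /cons_rV row_mxKr; congr pair.
rewrite (_ : 0 = lshift n (0 : 'I_1)); last exact/val_inj.
by rewrite [LHS]row_mxEl mxE.
Qed.

Section step.
Variables (n : nat) (mu : {sigma_finite_measure set 'rV[R]_n -> \bar R}).

Definition lebesgue_cons : set 'rV[R]_n.+1 -> \bar R :=
  pushforward (@lebesgue_measure R \x mu)%E (@cons_rV n).

Let lebesgue_cons0 : lebesgue_cons set0 = 0%E.
Proof. by rewrite /lebesgue_cons /pushforward preimage_set0 measure0. Qed.

Let lebesgue_cons_ge0 A : (0 <= lebesgue_cons A)%E.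
Proof. by rewrite /lebesgue_cons /pushforward; exact: measure_ge0. Qed.

Let lebesgue_cons_sigma_additive : semi_sigma_additive lebesgue_cons.
Proof.
apply: measure_semi_sigma_additive; exact: measurable_cons_rV.
Qed.

HB.instance Definition _ := isMeasure.Build _ _ _ lebesgue_cons
  lebesgue_cons0 lebesgue_cons_ge0 lebesgue_cons_sigma_additive.

Let lebesgue_cons_sigma_finite : sigma_finite setT lebesgue_cons.
Proof.
have [F TF mF] : sigma_finite setT (@lebesgue_measure R \x mu)%E.
  have /sigma_finiteP[F [TF ndF Foo]] := sigma_finiteT (@lebesgue_measure R).
  have /sigma_finiteP[G [TG ndG Goo]] := sigma_finiteT mu.
  exists (fun k => F k `*` G k).
    rewrite -setXTT TF TG predeqE => -[x y]; split.
      move=> [/= [k _ Fkx] [l _ Gly]]; exists (maxn k l) => //; split.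
      - by move: x Fkx; exact/subsetPset/ndF/leq_maxl.
      - by move: y Gly; exact/subsetPset/ndG/leq_maxr.
    by move=> [k _ []/= ? ?]; split; exists k.
  move=> k; have [? ?] := Foo k; have [? ?] := Goo k.
  split; first exact: measurableX.
  by rewrite product_measure1E// lte_mul_pinfty// ge0_fin_numE.
have mU := @measurable_uncons_rV n.
exists (fun k => (fun v : 'rV[R]_n.+1 => (v 0 0, rsubmx (v : 'rV_(1 + n))))
                 @^-1` F k).
  by rewrite -preimage_bigcup -TF preimage_setT.
move=> k; have [mFk Fk] := mF k; split.
  by rewrite -[X in measurable X]setTI; exact: mU.
rewrite /lebesgue_cons /pushforward -comp_preimage.
by rewrite (_ : _ \o _ = id) ?preimage_id//; apply/funext => p; exact: uncons_rVK.
Qed.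

HB.instance Definition _ := Measure_isSigmaFinite.Build _ _ _ lebesgue_cons
  lebesgue_cons_sigma_finite.
End step.

Fixpoint lebesgue_rV n : {sigma_finite_measure set 'rV[R]_n -> \bar R} :=
  if n is n'.+1 then lebesgue_cons (lebesgue_rV n') else \d_(0 : 'rV[R]_0).
End lebesgue.

Section multivariate.
Context {R : realType}.
Local Open Scope ereal_scope.

(* Topological support: the points all of whose neighbourhoods are charged. *)
Definition msupport n (mu : set 'rV[R]_n -> \bar R) : set 'rV[R]_n :=
  [set y | forall U, open U -> U y -> 0 < mu U].

Definition has_density n (mu : set 'rV[R]_n -> \bar R) (g : 'rV[R]_n -> R) :=
  [/\ measurable_fun setT g, forall y, (0 <= g y)%R &
      forall A, measurable A ->
        mu A = \int[lebesgue_rV R n]_(y in A) (g y)%:E].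

Definition posdef n (A : 'M[R]_n) : Prop :=
  A^T = A /\ forall v : 'rV[R]_n, v != 0%R -> (0 < (v *m A *m v^T) 0 0)%R.

Definition covariance_mx n (P : probability 'rV[R]_n R) : 'M[R]_n :=
  \matrix_(i, j) fine (covariance P (fun y => y 0%R i) (fun y => y 0%R j)).

Definition mvnormal_pdf n (m : 'rV[R]_n) (C : 'M[R]_n) (y : 'rV[R]_n) : R :=
  ((Num.sqrt ((pi *+ 2) ^+ n * \det C))^-1 *
   expR (- ((y - m) *m invmx C *m (y - m)^T) 0 0 / 2))%R.
End multivariate.

(* For S a subset of R^d, [set_type S] (to which S coerces) is the subspace S;
   hence 'rV[S]_n is S^n with its product topology. *)
Section spaces.
Context {R : realType} {d : nat}.
Variable S : set 'rV[R]_d.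

Definition path_space : Type := continuousType S R.

HB.instance Definition _ := Choice.on path_space.

Let cst0_continuous : continuous (cst 0 : S -> R).
Proof. exact: cst_continuous. Qed.

HB.instance Definition _ := isPointed.Build path_space (mkcts cst0_continuous).

(* Uniform convergence on S, i.e. the sup-norm topology when S is compact. *)
HB.instance Definition _ := Topological.copy path_space
  (@initial_topology path_space {uniform S -> R}
    (fun f : continuousType S R => f)).

HB.instance Definition _ :=
  @isMeasurable.Build (sigma_display (@open path_space)) path_space
    <<s open >> (@sigma_algebra0 _ setT open) (@sigma_algebraC _ open)
    (@sigma_algebra_bigcup _ setT open).

Definition path_eval (Y : path_space) : S -> R := (Y : continuousType S R).
Coercion path_eval : path_space >-> Funclass.

Definition conf_space : Type := {fset S}.

HB.instance Definition _ := Choice.on conf_space.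
HB.instance Definition _ := isPointed.Build conf_space fset0.

Definition card_in (B : set 'rV[R]_d) (N : conf_space) : nat :=
  #|` [fset s in N | \val s \in B]%fset|.

Definition counting_sets : set (set conf_space) :=
  [set A | exists B k,
    [/\ measurable B, B `<=` S & A = card_in B @^-1` [set k]]].

HB.instance Definition _ :=
  @isMeasurable.Build (sigma_display counting_sets) conf_space
    <<s counting_sets >> (@sigma_algebra0 _ setT _) (@sigma_algebraC _ _)
    (@sigma_algebra_bigcup _ setT _).

Definition lex_le (s t : S) : bool :=
  (([seq \val s 0 i | i <- enum 'I_d] : seqlexi R) <=
   [seq \val t 0 i | i <- enum 'I_d])%O.

(* The labelling S_N = (S_{N,1}, ..., S_{N,|N|}) of the points of N: they are
   listed in lexicographic order of their coordinates. *)
Definition locs (N : conf_space) : 'rV[S]_(#|` N|) :=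
  \row_i tnth [tuple of sort lex_le (in_tuple (enum_fset N))] i.

Definition distinct n (s : 'rV[S]_n) : Prop := injective (s 0).

Definition values (Y : path_space) n (s : 'rV[S]_n) : 'rV[R]_n :=
  \row_i Y (s 0 i).
End spaces.

Section pogamp.
Context {R : realType} {d : nat}.
Variable S : set 'rV[R]_d.
Local Open Scope ereal_scope.

(* Normal laws are given by their density: covariance matrices at distinct
   locations are positive definite. *)
Definition gaussian_process (m : S -> R) (Sigma : S -> S -> R)
    (G : probability (path_space S) R) : Prop :=
  forall n (s : 'rV[S]_n), distinct s ->
    let C := (\matrix_(i, j) Sigma (s 0 i) (s 0 j))%R in
    posdef C /\
    has_density (fun A => G [set Y | A (values Y s)])
      (mvnormal_pdf (\row_i m (s 0 i))%R C).

Definition power_set n (X : set R) : set 'rV[R]_n :=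
  [set y | forall i, X (y 0%R i)].
Arguments power_set : clear implicits.

(* [f n s] is the distribution of the vector of values at the locations [s] and
   [dens n s] its density; only pairwise distinct locations matter. The density
   vanishes off X^n and the topological support is the closure of X^n, so that
   X need not be closed: R, ]0, +oo[ and [0, +oo[ are all covered. *)
Record distribution_class (X : set R)
    (f : forall n, 'rV[S]_n -> probability 'rV[R]_n R)
    (dens : forall n, 'rV[S]_n -> 'rV[R]_n -> R) : Prop := {
  class_measurable : measurable X ;
  class_density : forall n (s : 'rV[S]_n), distinct s ->
    has_density (f n s) (dens n s) ;
  class_density0 : forall n (s : 'rV[S]_n) y, distinct s ->
    ~ power_set n X y -> dens n s y = 0%R ;
  class_support : forall n (s : 'rV[S]_n), distinct s ->
    msupport (f n s) = closure (power_set n X) ;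
  class_moments : forall n (s : 'rV[S]_n) i, distinct s ->
    (fun y : 'rV[R]_n => y 0%R i) \in Lfun (f n s) 2%:E ;
  class_covariance : forall n (s : 'rV[S]_n), distinct s ->
    posdef (covariance_mx (f n s)) ;
  class_continuous : forall n,
    {within [set p : 'rV[S]_n * 'rV[R]_n | distinct p.1 /\ power_set n X p.2],
      continuous (fun p => dens n p.1 p.2)} ;
  class_uniformly_integrable : forall n (e : R), (0 < e)%R ->
    exists M : R, forall s : 'rV[S]_n, distinct s ->
      \int[lebesgue_rV R n]_(y in [set y | (M < dens n s y)%R])
        (dens n s y)%:E <= e%:E
}.

Record intensity (lam : 'rV[R]_d -> R) : Prop := {
  intensity_measurable : measurable_fun S lam ;
  intensity_ge0 : forall s, S s -> (0 <= lam s)%R ;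
  intensity_finite : \int[lebesgue_rV R d]_(s in S) (lam s)%:E < +oo
}.

Definition mean_measure (lam : 'rV[R]_d -> R) (B : set 'rV[R]_d) : R :=
  fine (\int[lebesgue_rV R d]_(s in B) (lam s)%:E).

Notation omega := (path_space S * conf_space S)%type.

(* The second argument of [poisson_prob] is not used in its definition. *)
Record poisson_process (lam : 'rV[R]_d -> R) (P : probability omega R) : Prop := {
  poisson_counts : forall B, measurable B -> B `<=` S -> forall A : set nat,
    P [set w | A (card_in B w.2)] = poisson_prob (mean_measure lam B) 0%N A ;
  poisson_independent : forall k (B : 'I_k -> set 'rV[R]_d),
    (forall i, measurable (B i)) -> (forall i, B i `<=` S) ->
    trivIset setT B ->
    forall A : 'I_k -> set nat,
      P [set w | forall i, A i (card_in (B i) w.2)] =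
      \prod_(i < k) P [set w | A i (card_in (B i) w.2)]
}.

Definition obs (w : omega) : 'rV[R]_(#|` w.2|) := values w.1 (locs w.2).

(* As Y_N is a vector of random length |N|, events on it are given by families
   of Borel sets of R^n indexed by n. *)
Definition values_given_locations
    (dens : forall n, 'rV[S]_n -> 'rV[R]_n -> R) (P : probability omega R) :=
  forall (C : set (conf_space S)) (B : forall n, set 'rV[R]_n),
    measurable C -> (forall n, measurable (B n)) ->
    P [set w | C w.2 /\ B _ (obs w)] =
    \int[P]_(w in [set w | C w.2])
      \int[lebesgue_rV R _]_(y in B #|` w.2|) (dens _ (locs w.2) y)%:E.

(* K (N, .) is a regular conditional distribution under G of the path given its
   values at the points of N, jointly measurable in N and the values. *)
Definition gaussian_conditional (G : probability (path_space S) R)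
    (K : forall n, R.-pker (conf_space S * 'rV[R]_n) ~> path_space S) : Prop :=
  forall (N : conf_space S) (A : set (path_space S)) (B : set 'rV[R]_(#|` N|)),
    measurable A -> measurable B ->
    G [set Y | A Y /\ B (values Y (locs N))] =
    \int[G]_(Y in [set Y | B (values Y (locs N))])
      K _ (N, values Y (locs N)) A.

Definition path_given_values
    (K : forall n, R.-pker (conf_space S * 'rV[R]_n) ~> path_space S)
    (P : probability omega R) : Prop :=
  forall (A : set (path_space S)) (D : forall n, set (conf_space S * 'rV[R]_n)),
    measurable A -> (forall n, measurable (D n)) ->
    P [set w | A w.1 /\ D _ (w.2, obs w)] =
    \int[P]_(w in [set w | D _ (w.2, obs w)]) K _ (w.2, obs w) A.

(* [values_given_locations] already determines the law of Y_N given N up to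
   Lebesgue-null sets, hence up to null sets of the Gaussian marginals: the
   choice of the version K does not affect P. *)
Definition pogamp (lam : 'rV[R]_d -> R)
    (dens : forall n, 'rV[S]_n -> 'rV[R]_n -> R)
    (G : probability (path_space S) R) (P : probability omega R) : Prop :=
  [/\ poisson_process lam P,
      values_given_locations dens P &
      exists K, gaussian_conditional G K /\ path_given_values K P].
End pogamp.

(* Main.v *)
(** The Gaussian conditional law is made explicit by kriging: [krige s y Y] adds to
   the path [Y] the regression of [y - Y(s)] on the locations [s]. Under [G] the
   residual path [krige s 0 Y] is independent of [Y(s)], so that [krige s y Y],
   with [Y] drawn from [G], has the conditional law of the path given that its
   values at [s] are [y]. This path is continuous because [Sigma] is: [Sigma] is
   determined by the variances of [Y(s) + Y(t)], hence by quantiles of these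
   variables, and quantiles vary continuously with [(s, t)] since paths do.

   The Poisson process is a Poisson mixture of configurations obtained from the
   empty one by adding [n] independent points, one at a time; its counts on the
   cells of a finite partition are multinomial given [n], so Poisson and
   independent after mixing.

   [P] draws [N], then [y] from [f (locs N)], then [Y] from [G], and returns the
   pair [(krige (locs N) y Y, N)]. The lexicographic labelling of [N] is measurable
   because the rank of a point counts the points of [N] before it, and joint
   measurability in [(N, y, Y)] is checked on each cardinality of [N]. *)
From HB Require Import structures.
Require Import Defs.
From mathcomp Require Import all_boot all_order all_algebra.
From mathcomp Require Import finmap all_classical all_reals all_analysis measurable_realfun.
From mathcomp Require Import ring lra.
Set Implicit Arguments.
Unset Strict Implicit.
Unset Printing Implicit Defensive.
Import Order.TTheory GRing.Theory Num.Theory.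
Import numFieldNormedType.Exports.
Local Open Scope classical_set_scope.
Local Open Scope ring_scope.

(** * The Borel structure of the path space *)

(** Two obstacles shape the proof. Gaussianity is known only through densities at pairwise distinct
    locations, so independence of residuals is obtained by factoring a density along a Schur
    complement. It passes from finitely many locations to whole paths because, [S] being compact,
    the evaluations generate the Borel sets of the path space. The other obstacle is measurability
    in [N]. The law [f (locs N)] depends measurably on [N] because the density is continuous in
    locations and values, on a space with a countable base in which [(locs N, y)] moves measurably.
    Positive dimension makes the intensity free of atoms; with an atom, an added point could
    coincide with an old one and leave the counts unchanged. *)

(** The sets [b i] may fail to be open: an open set is still the countable union of those it
    contains, which is how preimages are shown measurable. The boxes of paths below are given by
    non-strict inequalities. *)
Definition countable_base (E : topologicalType) (I : countType)
    (b : I -> set E) : Prop :=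
  forall x U, nbhs x U -> exists i, b i x /\ b i `<=` U.

Section countable_base.

Lemma countable_base_prod (E F : topologicalType) (I J : countType)
    (b : I -> set E) (c : J -> set F) :
  countable_base b -> countable_base c ->
  countable_base (fun p : I * J => b p.1 `*` c p.2).
Proof.
move=> hb hc -[x y] U [[A B]/= [Ax By] ABU].
have [i [bx bA]] := hb _ _ Ax; have [j [cy cB]] := hc _ _ By.
exists (i, j); split => //= -[u v] [/= bu cv]; apply: ABU.
by split => /=; [exact: bA|exact: cB].
Qed.

Lemma countable_base_rV (E : topologicalType) (I : countType)
    (b : I -> set E) n :
  countable_base b ->
  countable_base (fun p : {ffun 'I_n -> I} =>
    [set s : 'rV[E]_n | forall i, b (p i) (s 0 i)]).
Proof.
move=> hb s U [P /= Ps PU].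
have /choice[p hp] : forall j, exists i, b i (s 0 j) /\ b i `<=` P 0 j.
  by move=> j; exact: hb.
exists [ffun j => p j]; split => [j|t ht]; first by rewrite ffunE; case: (hp j).
apply: PU => i j; rewrite ord1; case: (hp j) => _; apply.
by have := ht j; rewrite ffunE.
Qed.

Variables (E : topologicalType) (I : countType) (b : I -> set E).
Hypothesis hb : countable_base b.
Variables (d : measure_display) (T : measurableType d) (f : T -> E).
Hypothesis mf : forall i, measurable (f @^-1` b i).

Lemma measurable_preimage_open (U : set E) : open U -> measurable (f @^-1` U).
Proof.
move=> oU; rewrite [X in measurable X](_ : _ = \bigcup_(i : I)
    (if `[< b i `<=` U >] then f @^-1` b i else set0)).
  by apply: countable_bigcupT_measurable => // i; case: ifPn.
apply/seteqP; split => x /=.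
  move=> Ux; have [i [bi biU]] := hb (open_nbhs_nbhs (conj oU Ux)).
  by exists i => //; case: asboolP.
by move=> [i _]; case: asboolP => // + bx; apply.
Qed.

(** Meant for the density, which is continuous only on distinct locations and values in [X]:
    relatively open sets are traces of open ones. *)
Lemma measurable_comp_within (R : realType) (D : set E) (g : E -> R) :
  measurable (f @^-1` D) -> {within D, continuous g} ->
  measurable_fun (f @^-1` D) (g \o f).
Proof.
move=> mD cg; apply: (measurability _ (RGenOpens.measurableE R)).
move=> _ [_ [x [y ->]] <-].
have oxy : open (`]x, y[%classic : set R) by exact: interval_open.
have [V oV VD] :=
  (open_subspaceP _ _).1 ((continuousP _).1 cg _ oxy).
rewrite [X in measurable X](_ : _ = f @^-1` D `&` f @^-1` V).
  by apply: measurableI => //; exact: measurable_preimage_open.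
apply/seteqP; split => t /= [Dt].
  move=> h; split => //.
  suff : (V `&` D) (f t) by case.
  by rewrite VD.
move=> Vt; split => //.
suff : ((fun x => g x) @^-1` `]x, y[%classic `&` D) (f t) by case.
by rewrite -VD.
Qed.

End countable_base.

Lemma measurable_comp_continuous (E : topologicalType) (I : countType)
    (b : I -> set E) (d : measure_display) (T : measurableType d) (f : T -> E)
    (R : realType) (g : E -> R) :
  countable_base b -> (forall i, measurable (f @^-1` b i)) ->
  continuous g -> measurable_fun setT (g \o f).
Proof.
move=> hb mf cg; have := @measurable_comp_within _ _ _ hb _ _ _ mf R setT g.
by rewrite preimage_setT; apply => //; exact: continuous_subspaceT.
Qed.

Section rational_box.
Variable R : realType.

Definition rat_box n (p : 'rV[rat]_n * nat) : set 'rV[R]_n :=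
  [set x | forall i, ball (ratr (p.1 0 i) : R) p.2.+1%:R^-1 (x 0 i)].

Lemma rat_approx (x e : R) : 0 < e -> exists q : rat, ball x e (ratr q).
Proof.
move=> e0; have [q] : exists q, ratr q \in `]x - e, x + e[.
  by apply: rat_in_itvoo; rewrite ltrD2l gt0_cp.
by rewrite in_itv/= -ltr_distl => h; exists q; rewrite /ball/= distrC.
Qed.

Lemma natSV_lt (e : R) : 0 < e -> exists k : nat, k.+1%:R^-1 < e.
Proof.
move=> e0; exists (Num.trunc e^-1).
by rewrite invf_plt ?posrE// truncnS_gt.
Qed.

Lemma countable_base_rat_box n : countable_base (@rat_box n).
Proof.
move=> x U /nbhs_ballP[e /= e0 eU].
have [k ke] : exists k : nat, k.+1%:R^-1 < e / 2 :> R.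
  by apply: natSV_lt; rewrite divr_gt0.
have k0 : 0 < k.+1%:R^-1 :> R by rewrite invr_gt0.
have /choice[q hq] : forall i : 'I_n, exists q : rat,
    ball (x 0 i) k.+1%:R^-1 (ratr q : R) by move=> i; exact: rat_approx.
exists (\row_i q i, k); split => [i /=|y hy].
  by rewrite mxE; exact/ball_sym.
apply: eU; split => // i j; rewrite !ord1.
have := hy j; rewrite /= mxE => h.
apply: (@le_ball _ _ _ (k.+1%:R^-1 + k.+1%:R^-1)).
  by rewrite (splitr e) lerD// ltW.
exact: ball_triangle (hq j) h.
Qed.

Lemma open_rat_box n p : open (@rat_box n p).
Proof.
rewrite openE => x px; exists (fun i j => ball (ratr (p.1 0 j) : R) p.2.+1%:R^-1).
  move=> i j; rewrite !ord1 /=; apply: open_nbhs_nbhs; split => //.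
  exact: ball_open.
by move=> y hy i; exact: hy.
Qed.

Lemma measurable_rat_box n p : measurable (@rat_box n p).
Proof. by apply: sub_sigma_algebra; exact: open_rat_box. Qed.

Variables (d : nat) (S : set 'rV[R]_d).

Definition sub_box (p : 'rV[rat]_d * nat) : set S := [set s | rat_box p (\val s)].

Lemma countable_base_sub_box : countable_base sub_box.
Proof.
move=> s U /nbhs_ballP[e e0 eU].
have [p [ps pU]] := countable_base_rat_box (nbhsx_ballx (\val s) _ e0).
by exists p; split => // t pt; apply: eU; rewrite -initial_ballE; exact: pU.
Qed.

Lemma continuous_val : continuous (fun s : S => \val s : 'rV[R]_d).
Proof. exact: initial_continuous. Qed.

End rational_box.

Arguments sub_box {R d} S p.

Section path_space.
Variables (R : realType) (d : nat) (S : set 'rV[R]_d).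

Lemma continuous_path (Y : path_space S) : continuous (Y : S -> R).
Proof. exact: (@cts_fun _ _ (Y : continuousType S R)). Qed.

Lemma pathP (Y Z : path_space S) : (forall s, Y s = Z s) -> Y = Z.
Proof. by move=> YZ; apply/continuousEP => s; exact: YZ. Qed.

Lemma nbhs_path (Y : path_space S) (U : set (path_space S)) :
  nbhs Y U <-> exists2 e : R, 0 < e &
    [set Z : path_space S | forall s, `|Y s - Z s| < e] `<=` U.
Proof.
split.
  rewrite nbhsE => -[V [[W oW WV] VY] VU].
  have YW : nbhs (path_eval Y : {uniform S -> R}) W.
    by apply: open_nbhs_nbhs; split => //; rewrite -WV in VY.
  have [E [/= entE EW]] := (uniform_nbhs _ _).1 YW.
  have [e /= e0 eE] : exists2 e : R, 0 < e & [set x | ball x.1 e x.2] `<=` E.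
    by move: entE; rewrite -entourage_ballE => -[e /= e0 eE]; exists e.
  exists e => // Z hZ; apply: VU; rewrite -WV; apply: EW => s _.
  by apply: eE; exact: hZ.
case=> e e0 eU.
pose W : set {uniform S -> R} := [set Z | forall s, ball (Y s) e (Z s)].
have : nbhs (Y : {uniform S -> R}) W.
  apply: (proj2 (uniform_nbhs _ _)); exists [set x | ball x.1 e x.2]; split.
    by rewrite -entourage_ballE; exists e.
  by move=> Z hZ s; exact: hZ.
rewrite nbhsE => -[V [oV VY] VW]; rewrite nbhsE.
exists ((fun f : path_space S => (f : continuousType S R) : {uniform S -> R}) @^-1` V).
  by split => //; exists V.
by move=> Z /VW hZ; apply: eU => s; exact: hZ.
Qed.

Lemma open_path_eval s (O : set R) : open O ->
  open [set Y : path_space S | O (Y s)].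
Proof.
move=> oO; rewrite openE => Y /= OY; apply/nbhs_path.
have /nbhs_ballP[e /= e0 eO] : nbhs (Y s) O by exact: open_nbhs_nbhs.
by exists e => // Z hZ; apply: eO; exact: hZ.
Qed.

Lemma measurable_path_eval s : measurable_fun setT (fun Y : path_space S => Y s).
Proof.
apply: (measurability _ (RGenOpens.measurableE R)).
move=> _ [_ [a [b ->]] <-]; rewrite setTI; apply: sub_sigma_algebra.
by apply: open_path_eval; exact: interval_open.
Qed.

(** A rational box may miss [S]. The points picked in the other boxes form a countable dense subset
    of [S]. *)
Definition sub_pick (p : 'rV[rat]_d * nat) : option S :=
  if pselect (exists s, sub_box S p s) is left h then Some (projT1 (cid h))
  else None.

Lemma sub_pickP p s : sub_box S p s -> exists2 t, sub_pick p = Some t & sub_box S p t.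
Proof.
rewrite /sub_pick; case: pselect => [h|h ps]; last by exfalso; apply: h; exists s.
by move=> _; exists (projT1 (cid h)) => //; case: (cid h).
Qed.

Section measurable.
Variables (d' : measure_display) (T : measurableType d').

Section evaluations.
Variable f : T -> path_space S.
Hypothesis mf : forall s, measurable_fun setT (fun x => f x s).

(** The uncountable quantifier is tested on the picked points only: if the path leaves [C] at [s],
    then by continuity it does so on a whole smaller box around [s], hence at the point picked
    there. *)
Lemma measurable_forall_box p (C : set R) : closed C ->
  measurable [set x | forall s, sub_box S p s -> C (f x s)].
Proof.
move=> cC; have mC : measurable C by exact: closed_measurable.
rewrite [X in measurable X](_ : _ = \bigcap_(q : 'rV[rat]_d * nat)
   (if sub_pick q is Some t then
      if `[< sub_box S p t >] then (fun x => f x t) @^-1` C else setT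
    else setT)).
  rewrite -[X in measurable X]setCK; apply: measurableC; rewrite setC_bigcap.
  apply: countable_bigcupT_measurable => // q; apply: measurableC.
  case: sub_pick => // t; case: ifP => // _.
  by rewrite -[X in measurable X]setTI; exact: mf.
apply/seteqP; split => x /=.
  by move=> h q _; case: sub_pick => // t; case: asboolP => // /h.
move=> h s ps; apply: contrapT => nC.
pose U := [set t : S | sub_box S p t /\ (~` C) (f x t)].
have [q [qs qU]] : exists q, sub_box S q s /\ sub_box S q `<=` U.
  apply: countable_base_sub_box; apply: filterI.
    have := @continuous_val R d S s (rat_box p); apply.
    by apply: open_nbhs_nbhs; split => //; exact: open_rat_box.
  have := @continuous_path (f x) s (~` C); apply.
  by apply: open_nbhs_nbhs; split => //; exact: closed_openC.
have [t qt /qU[pt nCt]] := sub_pickP qs.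
by have := h q I; rewrite qt; case: asboolP.
Qed.
End evaluations.

(** Evaluation of a random path at a random point: [f x (u x)] lies in an open interval exactly when
    [u x] has a rational box on which the path stays in a slightly smaller closed interval. *)
Lemma measurable_eval_joint (f : T -> path_space S) (u : T -> S) :
  (forall s, measurable_fun setT (fun x => f x s)) ->
  (forall p, measurable (u @^-1` sub_box S p)) ->
  measurable_fun setT (fun x => f x (u x)).
Proof.
move=> mf mu; apply: (measurability _ (RGenOpens.measurableE R)).
move=> _ [_ [a [b ->]] <-]; rewrite setTI.
(* Closed intervals exhausting []a, b[], since [measurable_forall_box] applies to closed sets. *)
pose C (k : nat) : set R := `[a + k.+1%:R^-1, b - k.+1%:R^-1]%classic.
rewrite [X in measurable X](_ : _ = \bigcup_(q : ('rV[rat]_d * nat) * nat)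
    (u @^-1` sub_box S q.1 `&`
     [set x | forall s, sub_box S q.1 s -> C q.2 (f x s)])).
  apply: countable_bigcupT_measurable => // q.
  apply: measurableI => //; apply: measurable_forall_box => //.
  exact: interval_closed.
apply/seteqP; split => x /=; last first.
  move=> [q _ [/= qu]] /(_ _ qu); rewrite /C/= !in_itv/= => /andP[h1 h2].
  have k0 : 0 < q.2.+1%:R^-1 :> R by rewrite invr_gt0.
  by rewrite (lt_le_trans _ h1) ?ltrDl//= (le_lt_trans h2)// gtrBl.
rewrite in_itv/= => /andP[h1 h2].
(* Half of this margin absorbs the oscillation of the path on the box, the other half the shrinking
   of the interval. *)
pose e : R := Num.min (f x (u x) - a) (b - f x (u x)).
have e0 : 0 < e by rewrite lt_min !subr_gt0 h1.
have [k ke] : exists k : nat, k.+1%:R^-1 < e / 2 by apply: natSV_lt; rewrite divr_gt0.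
have /countable_base_sub_box[q [qu qU]] : nbhs (u x) [set t | ball (f x (u x)) (e / 2) (f x t)].
  have := @continuous_path (f x) (u x); apply; apply: nbhsx_ballx.
  by rewrite divr_gt0.
exists (q, k) => //; split => //= s /qU /=; rewrite /ball/= ltr_distlC /C/= in_itv/=.
move=> /andP[h3 h4].
have : e <= f x (u x) - a by rewrite ge_min lexx.
have : e <= b - f x (u x) by rewrite ge_min lexx orbT.
clearbody e => H1 H2; apply/andP; split.
  by rewrite -lerBrDl (le_trans (ltW ke))//; lra.
by rewrite lerBrDr -lerBrDl (le_trans (ltW ke))//; lra.
Qed.
End measurable.

Section separable.
Hypothesis cS : compact S.

(** A step function with finitely many rational cubes and rational values, and a tolerance.
    Countability of these data expresses the separability of the space of continuous functions. The
    covering condition does not depend on [Y]. *)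
Definition path_box (p : seq ('rV[rat]_d * nat * rat) * nat) : set (path_space S) :=
  [set Y | (forall s, exists2 c, c \in p.1 & sub_box S c.1 s) /\
     forall c, c \in p.1 -> forall s, sub_box S c.1 s ->
       `|Y s - ratr c.2| <= p.2.+1%:R^-1].

Lemma countable_base_path_box : countable_base path_box.
Proof.
move=> Y U /nbhs_path[e e0 eU].
have [k ke] : exists k : nat, k.+1%:R^-1 < e / 2 by apply: natSV_lt; rewrite divr_gt0.
(* Two paths of the same box differ by at most [w + w], which is below [e]. *)
set w := k.+1%:R^-1 in ke; have w0 : 0 < w by rewrite invr_gt0.
pose D := [set c : 'rV[rat]_d * nat * rat | forall s, sub_box S c.1 s ->
  `|Y s - ratr c.2| <= w].
have : cover_compact S by rewrite -compact_cover.
move=> /(_ _ D (fun c => rat_box c.1))[].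
- by move=> c _; exact: open_rat_box.
- move=> x Sx; pose s : S := SigSub (mem_set Sx).
  have [q hq] := rat_approx (Y s) (divr_gt0 w0 (ltr0Sn R 1)).
  have /countable_base_sub_box[p [ps pU]] : nbhs s [set t | ball (Y s) (w / 2) (Y t)].
    have := @continuous_path Y s; apply; apply: nbhsx_ballx.
    by rewrite divr_gt0.
  exists (p, q); last exact: ps.
  move=> t /pU /= /ball_sym h; apply: ltW.
  by have := ball_triangle h hq; rewrite -splitr.
- move=> F FD SF; exists (enum_fset F, k); split.
    split => /= [s|c cF s]; last by have := FD _ cF; rewrite inE; exact.
    by have [c cF cs] := SF (\val s) (set_valP s); exists c.
  move=> Z [/= cov hZ]; apply: eU => s.
  have [c cF cs] := cov s; have h1 := hZ _ cF _ cs.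
  have h2 : `|Y s - ratr c.2| <= w by have := FD _ cF; rewrite inE; exact.
  rewrite -(subrKA (ratr c.2)); apply: (le_lt_trans (ler_normD _ _)).
  by rewrite distrC in h1; rewrite (splitr e) (le_lt_trans (lerD h2 h1))// ltrD.
Qed.

(** The evaluations generate the Borel sets: a [path_box] is either empty or a finite intersection
    of closed conditions on rational cubes, and [measurable_forall_box] treats each of them. *)
Lemma measurable_pathP (d' : measure_display) (T : measurableType d')
    (f : T -> path_space S) :
  (forall s, measurable_fun setT (fun x => f x s)) -> measurable_fun setT f.
Proof.
move=> mf; apply: (@measurability _ _ _ _ setT f open) => //.
move=> _ [U oU <-]; rewrite setTI.
apply: (measurable_preimage_open countable_base_path_box) => // -[L k].
have [cov|ncov] := pselect (forall s : S, exists2 c, c \in L & sub_box S c.1 s).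
  rewrite [X in measurable X](_ : _ = \bigcap_(c in [set` L])
      [set x | forall s, sub_box S c.1 s ->
        [set y : R | `|y - ratr c.2| <= k.+1%:R^-1] (f x s)]).
    apply: fin_bigcap_measurable; first exact: finite_seq.
    move=> c _; apply: measurable_forall_box => //.
    rewrite (_ : mkset _ = closed_ball_ Num.norm (ratr c.2) (k.+1%:R^-1 : R)).
      exact: closed_closed_ball_.
    by apply/seteqP; split => y /=; rewrite distrC.
  apply/seteqP; split => x /=; first by move=> [_ h] c cL s; exact: h.
  by move=> h; split => // c cL s; exact: (h c cL s).
rewrite [X in measurable X](_ : _ = set0)//.
by rewrite -subset0 => x [].
Qed.
End separable.

End path_space.

(** * Integration on R^n and normal densities *)

(* [pushforward] is a measure only given a proof that the map is measurable;
   carrying this proof makes the structures inferable. *)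
Definition image_measure d1 d2 (T1 : measurableType d1) (T2 : measurableType d2)
    (R : realType) (m : set T1 -> \bar R) (f : T1 -> T2)
    (mf : measurable_fun setT f) : set T2 -> \bar R := pushforward m f.

Section image_measure.
Variables (d1 d2 : measure_display) (T1 : measurableType d1).
Variables (T2 : measurableType d2) (R : realType) (f : T1 -> T2).
Hypothesis mf : measurable_fun setT f.

Section measure.
Variable m : {measure set T1 -> \bar R}.
Let image_measure0 : image_measure m mf set0 = 0%E.
Proof. by rewrite /image_measure /pushforward preimage_set0 measure0. Qed.
Let image_measure_ge0 A : (0 <= image_measure m mf A)%E.
Proof. exact: measure_ge0. Qed.
Let image_measure_semi_sigma_additive : semi_sigma_additive (image_measure m mf).
Proof. apply: measure_semi_sigma_additive; exact: mf. Qed.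
HB.instance Definition _ := isMeasure.Build _ _ _ (image_measure m mf)
  image_measure0 image_measure_ge0 image_measure_semi_sigma_additive.

Lemma ge0_integral_image_measure (h : T2 -> \bar R) :
  measurable_fun setT h -> (forall x, 0 <= h x)%E ->
  (\int[image_measure m mf]_x h x = \int[m]_x h (f x))%E.
Proof. by move=> mh h0; rewrite ge0_integral_pushforward. Qed.
End measure.

Section finite.
Variable m : {finite_measure set T1 -> \bar R}.
Let image_measure_finite : fin_num_fun (image_measure m mf).
Proof.
move=> A mA; apply: fin_num_measure.
by rewrite -[X in measurable X]setTI; exact: mf.
Qed.
HB.instance Definition _ :=
  Measure_isFinite.Build _ _ _ (image_measure m mf) image_measure_finite.
End finite.

Section probability.
Variable m : probability T1 R.
Let image_measure_setT : image_measure m mf setT = 1%E.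
Proof. by rewrite /image_measure /pushforward preimage_setT probability_setT. Qed.
Let image_measure_le1 : (image_measure m mf setT <= 1)%E.
Proof. by rewrite image_measure_setT. Qed.
HB.instance Definition _ :=
  isSubProbability.Build _ _ _ (image_measure m mf) image_measure_le1.
HB.instance Definition _ :=
  isProbability.Build _ _ _ (image_measure m mf) image_measure_setT.
End probability.
End image_measure.

Section lebesgue_rV.
Variable R : realType.
Local Notation mu := (@lebesgue_measure R).
Local Notation lam := (lebesgue_rV R).
Local Open Scope ereal_scope.

(** The image of Lebesgue measure under [x |-> a x + c], multiplied by [a], gives half-open
    intervals their length, so it is Lebesgue measure. *)
Lemma integral_affine (a c : R) (f : R -> \bar R) : (0 < a)%R ->
  measurable_fun setT f -> (forall x, 0 <= f x) ->
  \int[mu]_x f x = a%:E * \int[mu]_x f (a * x + c)%R.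
Proof.
move=> a0 mf f0.
pose h (x : measurableTypeR R) : measurableTypeR R := (a * x + c)%R.
have mh : measurable_fun setT h.
  by apply: measurable_funD => //; apply: measurable_funM.
pose m := mscale (NngNum (ltW a0)) (image_measure mu mh).
have muE A : measurable A -> mu A = m A.
  apply: lebesgue_measure_unique => //= _ [[x y]] _ <-.
  rewrite /m /mscale/= /image_measure /pushforward.
  rewrite (_ : h @^-1` _ = `](x - c) / a, (y - c) / a]%classic)%R; last first.
    apply/seteqP; split => u /=; rewrite !in_itv/= /h ltr_pdivrMr// ler_pdivlMr//;
    by rewrite ltrBlDr lerBrDr (mulrC u).
  rewrite !lebesgue_measure_itv/= !lte_fin ltr_pM2r ?invr_gt0// ltrD2r.
  case: ifPn => xy; last by rewrite mule0.
  by rewrite -!EFinB -EFinM; congr EFin; field; rewrite gt_eqF.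
rewrite (eq_measure_integral m); last by move=> A mA _; exact: muE.
rewrite ge0_integral_mscale//; congr *%E.
by rewrite ge0_integral_image_measure.
Qed.

Lemma integral_shift (c : R) (f : R -> \bar R) :
  measurable_fun setT f -> (forall x, 0 <= f x) ->
  \int[mu]_x f (x + c)%R = \int[mu]_x f x.
Proof.
move=> mf f0; rewrite [RHS](@integral_affine 1 c)// mul1e.
by under [RHS]eq_integral do rewrite mul1r.
Qed.

Lemma ge0_integral_lebesgue_rVS n (f : 'rV[R]_n.+1 -> \bar R) :
  measurable_fun setT f -> (forall y, 0 <= f y) ->
  \int[lam n.+1]_y f y = \int[mu]_x \int[lam n]_y f (cons_rV (x, y)).
Proof.
move=> mf f0; rewrite [LHS]ge0_integral_pushforward//=; last first.
  exact: measurable_cons_rV.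
have mfc : measurable_fun setT (fun p => f (cons_rV p)).
  by apply: measurableT_comp => //; exact: measurable_cons_rV.
exact: (@fubini_tonelli1 _ _ (measurableTypeR R) _ R (@lebesgue_measure R)
  (lam n) (fun p => f (cons_rV p)) mfc).
Qed.

Lemma ge0_integral_lebesgue_rV0 (f : 'rV[R]_0 -> \bar R) :
  measurable_fun setT f -> (forall y, 0 <= f y) ->
  \int[lam 0]_y f y = f 0%R.
Proof. by move=> mf f0; rewrite integral_dirac// diracT mul1e. Qed.

Lemma measurable_fun_row_mx d (T : measurableType d) n k
    (f : T -> 'rV[R]_n) (g : T -> 'rV[R]_k) :
  measurable_fun setT f -> measurable_fun setT g ->
  measurable_fun setT (fun x => row_mx (f x) (g x)).
Proof.
move=> mf mg; apply: measurable_mxP => i j.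
case: (split_ordP j) => l ->.
  under eq_fun do rewrite row_mxEl.
  exact: (measurableT_comp (measurable_mx_coord i l)).
under eq_fun do rewrite row_mxEr.
exact: (measurableT_comp (measurable_mx_coord i l)).
Qed.

Lemma measurable_fun_addmx d (T : measurableType d) n (f g : T -> 'rV[R]_n) :
  measurable_fun setT f -> measurable_fun setT g ->
  measurable_fun setT (fun x => f x + g x)%R.
Proof.
move=> mf mg; apply: measurable_mxP => i j; under eq_fun do rewrite mxE.
by apply: measurable_funD; exact: (measurableT_comp (measurable_mx_coord i j)).
Qed.

Lemma measurable_fun_mulmx d (T : measurableType d) n k (f : T -> 'rV[R]_n)
    (g : T -> 'M[R]_(n, k)) :
  measurable_fun setT f -> (forall i j, measurable_fun setT (fun x => g x i j)) ->
  measurable_fun setT (fun x => f x *m g x)%R.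
Proof.
move=> mf mg; apply: measurable_mxP => i j; under eq_fun do rewrite mxE.
apply: measurable_sum => l; apply: measurable_funM => //.
exact: (measurableT_comp (measurable_mx_coord i l)).
Qed.

Lemma row_mx_cons n k x (y : 'rV[R]_n) (z : 'rV[R]_k) :
  row_mx (cons_rV (x, y)) z = cons_rV (x, row_mx y z).
Proof.
rewrite /cons_rV/= row_mxA; apply/rowP => j.
rewrite castmxE/=; congr (row_mx _ _ _ _); first exact: val_inj.
by rewrite (_ : esym _ = erefl) ?cast_ord_id//; exact: eq_irrelevance.
Qed.

Lemma ge0_integral_row_mx n k (f : 'rV[R]_(n + k) -> \bar R) :
  measurable_fun setT f -> (forall y, 0 <= f y) ->
  \int[lam (n + k)]_y f y = \int[lam n]_y \int[lam k]_z f (row_mx y z).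
Proof.
elim: n f => [|n IH] f mf f0.
  rewrite (@ge0_integral_lebesgue_rV0 (fun y => \int[lam k]_z f (row_mx y z))).
  - apply: eq_integral => z _; congr f; apply/rowP => j; symmetry.
    rewrite mxE; case: splitP => [[]//|l jl]; congr (z _ _); exact/val_inj.
  - apply: (@measurable_fun_fubini_tonelli_F _ _ _ _ _ _
      (fun p => f (row_mx p.1 p.2))) => //.
    by apply: measurableT_comp => //; exact: measurable_fun_row_mx.
  - by move=> y; exact: integral_ge0.
rewrite [LHS](@ge0_integral_lebesgue_rVS (n + k))//.
rewrite [RHS](@ge0_integral_lebesgue_rVS n (fun y => \int[lam k]_z f (row_mx y z))).
- apply: eq_integral => x _; rewrite (IH (fun y => f (cons_rV (x, y)))).
  + by apply: eq_integral => y _; apply: eq_integral => z _; rewrite row_mx_cons.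
  + apply: measurableT_comp => //; apply: (measurableT_comp (@measurable_cons_rV R _)).
    exact: measurable_fun_pair.
  + by move=> y; exact: f0.
- apply: (@measurable_fun_fubini_tonelli_F _ _ _ _ _ _
      (fun p => f (row_mx p.1 p.2))) => //.
  by apply: measurableT_comp => //; exact: measurable_fun_row_mx.
- by move=> y; exact: integral_ge0.
Qed.

Lemma ge0_integral_rV_shift n (c : 'rV[R]_n) (f : 'rV[R]_n -> \bar R) :
  measurable_fun setT f -> (forall y, 0 <= f y) ->
  \int[lam n]_y f (y + c)%R = \int[lam n]_y f y.
Proof.
elim: n c f => [|n IH] c f mf f0.
  have mfc : measurable_fun setT (fun y : 'rV[R]_0 => f (y + c)%R).
    by apply: measurableT_comp => //; exact: measurable_fun_addmx.
  by rewrite !ge0_integral_lebesgue_rV0//; congr f; rewrite !thinmx0.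
have mfc : measurable_fun setT (fun y : 'rV[R]_n.+1 => f (y + c)%R).
  by apply: measurableT_comp => //; exact: measurable_fun_addmx.
rewrite (ge0_integral_lebesgue_rVS mfc (fun y => f0 (y + c)%R)).
rewrite (ge0_integral_lebesgue_rVS mf f0).
have -> : c = cons_rV (c 0 0, rsubmx (c : 'rV_(1 + n)))%R.
  rewrite /cons_rV/= -[LHS](@hsubmxK _ 1 1 n); congr (@row_mx _ 1 1 n _ _).
  by apply/rowP => j; rewrite !mxE ord1; congr (c _ _); exact/val_inj.
set a := c 0%R 0%R; set v := rsubmx _.
have mfx x : measurable_fun setT (fun y => f (cons_rV (x, y))).
  by apply: measurableT_comp => //; apply: (measurableT_comp (@measurable_cons_rV R _));
  exact: measurable_fun_pair.
transitivity (\int[mu]_x \int[lam n]_y f (cons_rV ((x + a)%R, y))).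
  apply: eq_integral => x _; rewrite -[RHS](IH v)//.
  apply: eq_integral => y _; congr f; rewrite /cons_rV/=.
  by rewrite (@add_row_mx _ 1 1 n); congr (@row_mx _ 1 1 n _ _); apply/rowP => j; rewrite !mxE.
rewrite (@integral_shift _ (fun x => \int[lam n]_y f (cons_rV (x, y))))//.
  apply: (@measurable_fun_fubini_tonelli_F _ _ _ _ _ _
      (fun p => f (cons_rV p))) => //.
  by apply: measurableT_comp => //; exact: measurable_cons_rV.
by move=> x; exact: integral_ge0.
Qed.

Lemma integral_indicE d (T : measurableType d) (m : {measure set T -> \bar R})
    (A : set T) (f : T -> R) : measurable A ->
  \int[m]_(x in A) (f x)%:E = \int[m]_x (\1_A x * f x)%:E.
Proof.
move=> mA; rewrite integral_mkcond; apply: eq_integral => x _.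
rewrite patchE indicE; case: ifPn => [_|/negbTE]; first by rewrite mul1r.
by move=> _; rewrite mul0r.
Qed.

End lebesgue_rV.

(** * Schur complements and factorization of normal densities *)

Section posdef.
Variable R : realType.
Implicit Types n k : nat.

Lemma posdef_unitmx n (A : 'M[R]_n) : posdef A -> A \in unitmx.
Proof.
move=> [_ pA]; rewrite -row_free_unit -kermx_eq0; apply/negPn/negP.
move=> /rowV0Pn[v /sub_kermxP vA /pA]; by rewrite vA mul0mx mxE ltxx.
Qed.

Lemma posdef_congr n (A Q : 'M[R]_n) : Q \in unitmx -> posdef A ->
  posdef (Q^T *m A *m Q).
Proof.
move=> uQ [sA pA]; split; first by rewrite !trmx_mul trmxK sA mulmxA.
move=> v v0; have := pA (v *m Q^T); rewrite trmx_mul trmxK !mulmxA; apply.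
apply: contra v0 => /eqP vQ0; rewrite -[v](@mulmxK _ _ _ Q^T) ?unitmx_tr//.
by rewrite vQ0 mul0mx.
Qed.

Section schur.
Variables (n k : nat) (A : 'M[R]_n) (B : 'M[R]_(n, k)) (D : 'M[R]_k).
Let C := block_mx A B B^T D.
Hypothesis pC : posdef C.

(** With row vectors, [u *m regression_mx] is the linear prediction of the second block from the
    first, and [schur_compl] is the covariance of the prediction error. *)
Definition regression_mx := invmx A *m B.
Definition schur_compl := D - B^T *m regression_mx.
Let shear := block_mx 1%:M regression_mx 0 1%:M : 'M[R]_(n + k).

Lemma posdef_ulsubmx : posdef A.
Proof.
case: pC => [+ p]; rewrite /C tr_block_mx => /eq_block_mx[sA _ _ _]; split => //.
move=> v v0; have := p (row_mx v 0); rewrite mul_row_block tr_row_mx mul_row_col.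
rewrite !mul0mx !addr0 trmx0 mulmx0 addr0; apply.
by apply: contra v0 => /eqP; rewrite -row_mx0 => /eq_row_mx[-> _].
Qed.

Lemma posdef_drsubmx_sym : D^T = D.
Proof. by case: pC => [+ p]; rewrite /C tr_block_mx => /eq_block_mx[_ _ _ ->]. Qed.

Let unitA : A \in unitmx := posdef_unitmx posdef_ulsubmx.
Let symA : A^T = A := posdef_ulsubmx.1.

Lemma shear_unitmx : shear \in unitmx.
Proof. by rewrite unitmxE det_ublock !det1 mulr1 unitr1. Qed.

(** Block elimination. Positivity of the Schur complement, the determinant of [C] and its inverse
    quadratic form are all read off from this product. *)
Lemma schur_decomp : C = shear^T *m block_mx A 0 0 schur_compl *m shear.
Proof.
rewrite tr_block_mx !trmx1 trmx0 !mulmx_block !mul1mx !mulmx1 !mul0mx !mulmx0.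
rewrite !addr0 !add0r /C; have WA : regression_mx^T *m A = B^T.
  by rewrite /regression_mx trmx_mul trmx_inv symA mulmxKV.
by rewrite WA; congr block_mx; rewrite /schur_compl ?mulmxA ?mulmxV ?mul1mx// addrC subrK.
Qed.

Lemma invmx_shear : invmx shear = block_mx 1%:M (- regression_mx) 0 1%:M.
Proof.
apply: (can_inj (mulKmx shear_unitmx)); rewrite mulmxV ?shear_unitmx//.
rewrite mulmx_block !mul1mx !mulmx1 !mul0mx !mulmx0 !addr0 !add0r addNr.
by rewrite -scalar_mx_block.
Qed.

Lemma posdef_schur_compl : posdef schur_compl.
Proof.
have E : block_mx A 0 0 schur_compl =
    (invmx shear)^T *m C *m invmx shear.
  rewrite schur_decomp !mulmxA trmx_inv mulVmx ?unitmx_tr ?shear_unitmx//.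
  by rewrite mul1mx mulmxK// shear_unitmx.
have [s p] : posdef (block_mx A 0 0 schur_compl).
  by rewrite E; apply: posdef_congr => //; rewrite unitmx_inv shear_unitmx.
split; first by move: s; rewrite tr_block_mx => /eq_block_mx[_ _ _ ->].
move=> v v0; have := p (row_mx 0 v); rewrite mul_row_block tr_row_mx mul_row_col.
rewrite !mul0mx !add0r trmx0 mulmx0 add0r; apply.
by apply: contra v0 => /eqP; rewrite -row_mx0 => /eq_row_mx[_ ->].
Qed.

Lemma det_schur : \det C = \det A * \det schur_compl.
Proof.
rewrite schur_decomp !det_mulmx det_tr /shear !det_ublock !det1.
by rewrite !mulr1 !mul1r.
Qed.

(** Completing the square: [invmx shear] replaces the second block by its prediction error. *)
Lemma quad_schur (u : 'rV[R]_n) (v : 'rV[R]_k) :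
  row_mx u v *m invmx C *m (row_mx u v)^T =
  u *m invmx A *m u^T +
  (v - u *m regression_mx) *m invmx schur_compl *m (v - u *m regression_mx)^T.
Proof.
have uS := posdef_unitmx posdef_schur_compl.
have uD : block_mx A 0 0 schur_compl \in unitmx.
  rewrite unitmxE det_ublock unitrM -!unitmxE.
  by apply/andP.
have iD : invmx (block_mx A 0 0 schur_compl) =
    block_mx (invmx A) 0 0 (invmx schur_compl).
  apply: (can_inj (mulKmx uD)); rewrite mulmxV//.
  rewrite mulmx_block !mul0mx !mulmx0 !addr0 !add0r !mulmxV//.
  by rewrite -scalar_mx_block.
have iC : invmx C = invmx shear *m invmx (block_mx A 0 0 schur_compl) *m (invmx shear)^T.
  have uC := posdef_unitmx pC.
  apply: (can_inj (mulKmx uC)); rewrite mulmxV// {1}schur_decomp !mulmxA.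
  rewrite -!mulmxA (mulKVmx shear_unitmx) (mulKVmx uD) trmx_inv mulmxV//.
  by rewrite unitmx_tr shear_unitmx.
set w := v - _.
have wE : row_mx u v *m invmx shear = row_mx u w.
  by rewrite invmx_shear mul_row_block !mulmx1 mulmx0 addr0 mulmxN (addrC _ v).
rewrite iC iD !mulmxA wE -mulmxA -trmx_mul wE.
by rewrite mul_row_block !mulmx0 addr0 add0r tr_row_mx mul_row_col.
Qed.
End schur.

(** Induction splitting off the first coordinate: the determinant is the positive corner entry times
    that of the Schur complement. *)
Lemma posdef_det n (A : 'M[R]_n) : posdef A -> 0 < \det A.
Proof.
elim: n A => [|n IH] A pA; first by rewrite det_mx00.
pose A' : 'M[R]_(1 + n) := A.
have E : A' = block_mx (ulsubmx A') (ursubmx A') (ursubmx A')^T (drsubmx A').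
  rewrite -[LHS]submxK; congr block_mx.
  by case: pA => sA _; rewrite trmx_ursub -[in RHS]/A' [A'^T]sA.
have pA' : posdef (block_mx (ulsubmx A') (ursubmx A') (ursubmx A')^T (drsubmx A')).
  by rewrite -E.
have -> : \det A = \det A' by [].
rewrite E det_schur// mulr_gt0//; last exact/IH/posdef_schur_compl.
have [_ p] := posdef_ulsubmx pA'; rewrite det_mx11.
have := p 1%:M; rewrite mul1mx trmx1 mulmx1; apply.
by apply/eqP => /matrixP/(_ 0 0); rewrite !mxE eqxx => /eqP; rewrite oner_eq0.
Qed.

Local Open Scope ring_scope.

(** Marginal density times conditional density. The second factor sees [(y, z)] only through the
    prediction error, which is the source of every independence statement below. *)
Lemma mvnormal_pdf_block n k (A : 'M[R]_n) (B : 'M[R]_(n, k)) (D : 'M[R]_k)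
    (m1 y : 'rV[R]_n) (m2 z : 'rV[R]_k) :
  posdef (block_mx A B B^T D) ->
  mvnormal_pdf (row_mx m1 m2) (block_mx A B B^T D) (row_mx y z) =
  mvnormal_pdf m1 A y *
  mvnormal_pdf 0 (schur_compl A B D)
    (z - m2 - (y - m1) *m regression_mx A B).
Proof.
move=> pC; rewrite /mvnormal_pdf det_schur// opp_row_mx add_row_mx quad_schur//.
rewrite subr0 mxE opprD mulrDl expRD exprD.
have p0 i : (0 : R) <= (pi *+ 2) ^+ i by rewrite exprn_ge0// mulrn_wge0// pi_ge0.
have dA := posdef_det (posdef_ulsubmx pC).
rewrite (mulrACA (_ ^+ n)) sqrtrM ?mulr_ge0// ?(ltW dA)// invfM mulrACA.
by rewrite !mxE.
Qed.

(** Linear change of variables; determinant one keeps the normalising constant. *)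
Lemma mvnormal_pdf_congr n (C Q : 'M[R]_n) (m y : 'rV[R]_n) :
  \det Q = 1 -> C \in unitmx ->
  mvnormal_pdf (m *m Q) (Q^T *m C *m Q) (y *m Q) = mvnormal_pdf m C y.
Proof.
move=> dQ uC; have uQ : Q \in unitmx by rewrite unitmxE dQ unitr1.
have iE : invmx (Q^T *m C *m Q) = invmx Q *m invmx C *m (invmx Q)^T.
  have uQCQ : Q^T *m C *m Q \in unitmx by rewrite !unitmx_mul unitmx_tr uQ uC.
  apply: (can_inj (mulKmx uQCQ)); rewrite mulmxV// -!mulmxA (mulKVmx uQ).
  by rewrite (mulKVmx uC) trmx_inv mulmxV// unitmx_tr.
have E : (y *m Q - m *m Q) *m invmx (Q^T *m C *m Q) *m (y *m Q - m *m Q)^T =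
    (y - m) *m invmx C *m (y - m)^T.
  rewrite iE -mulmxBl trmx_mul !mulmxA (mulmxK uQ); congr (_ *m _).
  by rewrite -[LHS]mulmxA -trmx_mul (mulmxV uQ) trmx1 mulmx1.
by rewrite /mvnormal_pdf E !det_mulmx det_tr dQ mul1r mulr1.
Qed.

End posdef.

Section mvnormal.
Variable R : realType.
Local Notation lam := (lebesgue_rV R).

Lemma measurable_mvnormal_pdf n (m : 'rV[R]_n) (C : 'M[R]_n) :
  measurable_fun setT (mvnormal_pdf m C).
Proof.
have mc : measurable_fun setT (fun y : 'rV[R]_n => y - m).
  exact: measurable_fun_addmx.
apply: measurable_funM => //; apply: measurableT_comp => //.
apply: measurable_funM => //; apply: measurableT_comp => //.
under eq_fun do rewrite mxE.
apply: measurable_sum => j; apply: measurable_funM.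
  apply: (measurableT_comp (measurable_mx_coord 0 j)).
  exact: measurable_fun_mulmx.
under eq_fun do rewrite mxE.
exact: (measurableT_comp (measurable_mx_coord 0 j)).
Qed.

Lemma mvnormal_pdf_ge0 n (m : 'rV[R]_n) (C : 'M[R]_n) y :
  0 <= mvnormal_pdf m C y.
Proof. by rewrite mulr_ge0 ?expR_ge0// invr_ge0 sqrtr_ge0. Qed.

(** Standardisation by [y = m + s u]. All one-dimensional normal laws become location-scale images
    of one law, the form in which their quantiles are compared. *)
Lemma integral_mvnormal_pdf1 (m : 'rV[R]_1) (C : 'M[R]_1) (B : set R) :
  posdef C -> measurable B ->
  (\int[lam 1]_y (\1_B (y 0 0)%R * mvnormal_pdf m C y)%:E =
   normal_prob 0 1 [set u : R | B (m 0 0 + Num.sqrt (C 0 0) * u)%R])%E.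
Proof.
move=> /posdef_det; rewrite det_mx11; set v := C 0 0 => v0 mB.
set s := Num.sqrt v; have s0 : 0 < s by rewrite sqrtr_gt0.
have vs : v = s ^+ 2 by rewrite sqr_sqrtr// ltW.
have m1 : measurable_fun setT (fun y : 'rV[R]_1 => \1_B (y 0 0) * mvnormal_pdf m C y).
  apply: measurable_funM; last exact: measurable_mvnormal_pdf.
  exact: (measurableT_comp (measurable_indic mB) (measurable_mx_coord 0 0)).
have g0 (y : 'rV[R]_1) : (0 <= (\1_B (y 0 0) * mvnormal_pdf m C y)%:E)%E.
  by rewrite lee_fin mulr_ge0// mvnormal_pdf_ge0.
rewrite ge0_integral_lebesgue_rVS//; last exact/measurable_EFinP.
have mx x : measurable_fun setT (fun y : 'rV[R]_0 =>
    (\1_B (cons_rV (x, y) 0 0) * mvnormal_pdf m C (cons_rV (x, y)))%:E).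
  apply/measurable_EFinP; apply: (measurableT_comp m1).
  by apply: (measurableT_comp (@measurable_cons_rV R 0)); exact: measurable_fun_pair.
have c00 x : cons_rV (x, 0 : 'rV[R]_0) 0 0 = x :> R.
  have /(congr1 fst) := @uncons_rVK R 0 (x, 0); exact.
pose g x := (\1_B x * ((Num.sqrt ((pi *+ 2) * v))^-1 *
  expR (- ((x - m 0 0) ^+ 2 / v) / 2)))%R.
transitivity (\int[lebesgue_measure]_x (g x)%:E)%E.
  apply: eq_integral => x _; rewrite (ge0_integral_lebesgue_rV0 (mx x))//.
  have uC : C \in unitmx by rewrite unitmxE det_mx11 unitfE gt_eqF.
  have iC : invmx C = v^-1%:M.
    apply: (can_inj (mulKmx uC)); rewrite mulmxV//.
    by rewrite [C]mx11_scalar -scalar_mxM divff// gt_eqF.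
  set y := cons_rV _; have y0 : y 0 0 = x by exact: c00.
  clearbody y.
  have E : ((y - m) *m invmx C *m (y - m)^T) 0 0 = (x - m 0 0) ^+ 2 / v.
    rewrite iC mul_mx_scalar mxE big_ord1 !mxE y0.
    by ring.
  by rewrite /mvnormal_pdf E y0 expr1 det_mx11.
have mg : measurable_fun setT g.
  apply: measurable_funM; first exact: measurable_indic.
  apply: measurable_funM => //; apply: measurableT_comp => //.
  apply: measurable_funM => //; apply: measurableT_comp => //.
  apply: measurable_funM => //; apply: measurable_funX.
  exact: measurable_funD.
rewrite (@integral_affine _ s (m 0 0))//; last 2 first.
- exact/measurable_EFinP.
- by move=> x; rewrite lee_fin /g !mulr_ge0// ?expR_ge0// invr_ge0 sqrtr_ge0.
set B' := [set u | _].
have mB' : measurable B'.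
  rewrite -[X in measurable X]setTI.
  have : measurable_fun setT (fun u : R => m 0 0 + s * u).
    by apply: measurable_funD => //; apply: measurable_funM.
  exact.
rewrite /normal_prob [RHS]integral_indicE//.
have mgs : measurable_fun setT (fun u : R => g (s * u + m 0 0)).
  apply: (measurableT_comp mg).
  by apply: measurable_funD => //; apply: measurable_funM.
rewrite -ge0_integralZl//; last 3 first.
- exact/measurable_EFinP.
- by move=> x _; rewrite lee_fin /g !mulr_ge0// ?expR_ge0// invr_ge0 sqrtr_ge0.
- by rewrite lee_fin ltW.
apply: eq_integral => u _; rewrite -EFinM; congr EFin.
rewrite /g /normal_pdf oner_eq0 addrK.
have -> : \1_B (s * u + m 0 0) = \1_B' u :> R.
  rewrite !indicE; congr ((nat_of_bool _)%:R); apply/idP/idP; rewrite !inE /B'/=;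
  by rewrite addrC.
rewrite /normal_peak /normal_fun expr1n mul1r subr0 mulrCA; congr (_ * _).
rewrite mulrA; congr (_ * _); last first.
  by congr expR; rewrite vs exprMn; field; rewrite gt_eqF.
have p0 : 0 <= pi *+ 2 :> R by rewrite mulrn_wge0// pi_ge0.
by rewrite (sqrtrM _ p0) -/s invfM mulrCA divff ?mulr1// gt_eqF.
Qed.

Lemma normal_prob_setT : @normal_prob R 0 1 setT = 1%E.
Proof. exact: probability_setT. Qed.

End mvnormal.

(** * Gaussian processes and kriging *)

Section gaussian_process.
Variables (R : realType) (d : nat) (S : set 'rV[R]_d).
Variables (m : S -> R) (Sigma : S -> S -> R) (G : probability (path_space S) R).
Hypothesis hG : gaussian_process m Sigma G.
Local Notation lam := (lebesgue_rV R).

Definition mean_rV n (s : 'rV[S]_n) : 'rV[R]_n := \row_i m (s 0 i).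

Definition cov_mx n k (s : 'rV[S]_n) (t : 'rV[S]_k) : 'M[R]_(n, k) :=
  \matrix_(i, j) Sigma (s 0 i) (t 0 j).

Lemma measurable_values n (s : 'rV[S]_n) :
  measurable_fun setT (fun Y : path_space S => values Y s).
Proof.
apply: measurable_mxP => i j; under eq_fun do rewrite mxE.
exact: measurable_path_eval.
Qed.

Lemma posdef_cov_mx n (s : 'rV[S]_n) : distinct s -> posdef (cov_mx s s).
Proof. by move=> /hG[]. Qed.

Lemma gaussian_law n (s : 'rV[S]_n) A : distinct s -> measurable A ->
  G [set Y | A (values Y s)] =
  (\int[lam n]_y (\1_A y * mvnormal_pdf (mean_rV s) (cov_mx s s) y)%:E)%E.
Proof. by move=> /hG[_ [_ _ h]] mA; rewrite h// integral_indicE. Qed.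

Lemma distinct_lsubmx n k (s : 'rV[S]_n) (t : 'rV[S]_k) :
  distinct (row_mx s t) -> distinct s.
Proof.
move=> ds i j ij; apply: (@lshift_inj n k); apply: ds.
by rewrite !row_mxEl.
Qed.

Lemma cov_sym n (s : 'rV[S]_n) i j : distinct s ->
  Sigma (s 0 i) (s 0 j) = Sigma (s 0 j) (s 0 i).
Proof. by move=> /posdef_cov_mx[/matrixP/(_ j i) + _]; rewrite !mxE. Qed.

Lemma cov_mx_row n k (s : 'rV[S]_n) (t : 'rV[S]_k) : distinct (row_mx s t) ->
  cov_mx (row_mx s t) (row_mx s t) =
  block_mx (cov_mx s s) (cov_mx s t) (cov_mx s t)^T (cov_mx t t).
Proof.
move=> dst; apply/matrixP => i j; rewrite [LHS]mxE.
case: (split_ordP i) => a ->; case: (split_ordP j) => b ->.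
- by rewrite block_mxEul !row_mxEl mxE.
- by rewrite block_mxEur row_mxEl row_mxEr mxE.
- by rewrite block_mxEdl cov_sym// row_mxEl row_mxEr mxE mxE.
- by rewrite block_mxEdr !row_mxEr mxE.
Qed.

Lemma values_row n k (s : 'rV[S]_n) (t : 'rV[S]_k) Y :
  values Y (row_mx s t) = row_mx (values Y s) (values Y t).
Proof.
apply/rowP => j; case: (split_ordP j) => a ->.
  by rewrite [LHS]mxE !row_mxEl mxE.
by rewrite [LHS]mxE !row_mxEr mxE.
Qed.

Lemma mean_row n k (s : 'rV[S]_n) (t : 'rV[S]_k) :
  mean_rV (row_mx s t) = row_mx (mean_rV s) (mean_rV t).
Proof.
apply/rowP => j; case: (split_ordP j) => a ->.
  by rewrite [LHS]mxE !row_mxEl mxE.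
by rewrite [LHS]mxE !row_mxEr mxE.
Qed.

(** After [mvnormal_pdf_block], translating the inner variable by [y *m W] removes [y] from the
    inner integral, and the double integral splits. *)
Lemma residual_independent n k (s : 'rV[S]_n) (t : 'rV[S]_k)
    (B : set 'rV[R]_n) (E : set 'rV[R]_k) :
  distinct (row_mx s t) -> measurable B -> measurable E ->
  let Z Y := values Y t - values Y s *m regression_mx (cov_mx s s) (cov_mx s t) in
  G [set Y | B (values Y s) /\ E (Z Y)] =
  (G [set Y | B (values Y s)] * G [set Y | E (Z Y)])%E.
Proof.
move=> dst mB mE Z; have ds := distinct_lsubmx dst.
set W := regression_mx _ _ in Z *.
pose D := schur_compl (cov_mx s s) (cov_mx s t) (cov_mx t t).
pose c E := (\int[lam k]_z (\1_E z * mvnormal_pdf 0 D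
  (z - mean_rV t + mean_rV s *m W))%:E)%E.
have c0 E' : (0 <= c E')%E.
  by apply: integral_ge0 => z _; rewrite lee_fin mulr_ge0// mvnormal_pdf_ge0.
(* The factor [c E] is the same for all [B']; the choice [B' = setT] identifies it as the
   probability that the residual lies in [E]. *)
suff key B' : measurable B' -> G [set Y | B' (values Y s) /\ E (Z Y)] =
    (G [set Y | B' (values Y s)] * c E)%E.
  rewrite key//; congr *%E; have := key setT measurableT.
  rewrite (_ : [set Y | setT (values Y s)] = setT); last by apply/seteqP; split.
  rewrite probability_setT mul1e => <-; congr (G _).
  by apply/seteqP; split => [Y []//|Y]; split.
move=> {B mB}mB.
pose A := [set x : 'rV[R]_(n + k) | B' (lsubmx x) /\ E (rsubmx x - lsubmx x *m W)].
have ml : measurable_fun setT (@lsubmx R 1 n k).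
  by apply: measurable_mxP => i j; under eq_fun do rewrite mxE; exact: measurable_mx_coord.
have mr : measurable_fun setT (@rsubmx R 1 n k).
  by apply: measurable_mxP => i j; under eq_fun do rewrite mxE; exact: measurable_mx_coord.
have msh (f : 'rV[R]_(n + k) -> 'rV[R]_n) (g : 'rV[R]_(n + k) -> 'rV[R]_k) :
    measurable_fun setT f -> measurable_fun setT g ->
    measurable_fun setT (fun x => g x - f x *m W).
  move=> mf mg; apply: measurable_fun_addmx => //.
  under eq_fun do rewrite -mulmxN.
  exact: measurable_fun_mulmx.
have mA : measurable A.
  apply: measurableI; rewrite -[X in measurable X]setTI; first exact: ml.
  exact: (msh _ _ ml mr).
rewrite (_ : [set Y | _ /\ _] = [set Y | A (values Y (row_mx s t))]); last first.
  by apply/seteqP; split => Y /=; rewrite /A/= values_row row_mxKl row_mxKr.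
rewrite gaussian_law// ge0_integral_row_mx; last 2 first.
- apply/measurable_EFinP; apply: measurable_funM; first exact: measurable_indic.
  exact: measurable_mvnormal_pdf.
- by move=> y; rewrite lee_fin mulr_ge0// mvnormal_pdf_ge0.
have pC : posdef (block_mx (cov_mx s s) (cov_mx s t) (cov_mx s t)^T (cov_mx t t)).
  by rewrite -cov_mx_row//; exact: posdef_cov_mx.
rewrite gaussian_law// -ge0_integralZr//; last 2 first.
- apply/measurable_EFinP; apply: measurable_funM; first exact: measurable_indic.
  exact: measurable_mvnormal_pdf.
- by move=> y _; rewrite lee_fin mulr_ge0// mvnormal_pdf_ge0.
apply: eq_integral => y _.
pose h (z : 'rV[R]_k) := (\1_E (z - y *m W) * mvnormal_pdf 0 D
    (z - mean_rV t - (y - mean_rV s) *m W))%R.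
have mh : measurable_fun setT h.
  apply: measurable_funM.
    apply: (measurableT_comp (measurable_indic mE)); exact: measurable_fun_addmx.
  apply: (measurableT_comp (measurable_mvnormal_pdf _ _)).
  apply: measurable_fun_addmx => //; exact: measurable_fun_addmx.
have h0 z : 0 <= h z by rewrite mulr_ge0// mvnormal_pdf_ge0.
have mhE : measurable_fun setT (EFin \o h) by exact/measurable_EFinP.
transitivity (\int[lam k]_z ((\1_B' y * mvnormal_pdf (mean_rV s) (cov_mx s s) y)%:E
   * (h z)%:E))%E.
  apply: eq_integral => z _; rewrite mean_row (cov_mx_row dst) (mvnormal_pdf_block _ _ _ _ pC).
  rewrite -EFinM; congr EFin.
  have -> : \1_A (row_mx y z) = \1_B' y * \1_E (z - y *m W) :> R.
    rewrite !indicE -natrM mulnb; congr (nat_of_bool _)%:R.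
    by apply/idP/andP; rewrite !inE /A/= row_mxKl row_mxKr.
  exact: mulrACA.
rewrite (@ge0_integralZl _ _ _ (lam k) setT measurableT (EFin \o h) mhE); last 2 first.
- by move=> z _; rewrite lee_fin.
- by rewrite lee_fin mulr_ge0// mvnormal_pdf_ge0.
have -> : (\int[lam k]_z (EFin \o h) z = c E)%E.
  have h0' z : (0 <= (EFin \o h) z)%E by rewrite lee_fin.
  rewrite -(ge0_integral_rV_shift (y *m W) mhE h0').
  apply: eq_integral => z _; rewrite /h/= addrK.
  have -> : z + y *m W - mean_rV t - (y - mean_rV s) *m W =
      z - mean_rV t + mean_rV s *m W.
    by rewrite mulmxBl; apply/rowP => j; rewrite !mxE; ring.
  by [].
reflexivity.
Qed.

End gaussian_process.

(** * Continuity of quantiles in a location-scale family *)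

Section location_scale.
Variables (R : realType) (d : measure_display) (T : measurableType d).
Variable P : probability T R.
Local Open Scope ereal_scope.

(* Quantiles are monotone in law: were the [nu]-quantile of order [a] to jump up
   along [e_ k --> e0], the events [W (e_ k) < quantile], all of probability
   [nu ]-oo, a[], would have a limit inferior of larger probability. *)
Lemma location_scale_usc (E : pseudoMetricType R) (nu : probability (measurableTypeR R) R)
    (W : T -> E -> R) (M V : E -> R) :
  (forall a b : R, (a < b)%R -> 0 < nu `[a, b[%classic) ->
  (forall e, (0 < V e)%R) ->
  (forall w, continuous (W w)) ->
  (forall e, measurable_fun setT (W ^~ e)) ->
  (forall e (B : set R), measurable B ->
    P [set w | B (W w e)] = nu [set u | B (M e + V e * u)%R]) ->
  forall (a : R) e0 (eps : R), (0 < eps)%R ->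
    \forall e \near e0, (M e + V e * a < M e0 + V e0 * a + eps)%R.
Proof.
move=> nu0 V0 cW mW law a e0 eps eps0.
pose q e := (M e + V e * a)%R.
have mlt e (c : R) : measurable [set w | W w e < c]%R.
  rewrite (_ : mkset _ = (W ^~ e) @^-1` `]-oo, c[%classic).
    by rewrite -[X in measurable X]setTI; exact: mW.
  by apply/seteqP; split => w /=; rewrite in_itv.
have lt_law e (c : R) : P [set w | W w e < M e + V e * c]%R = nu `]-oo, c[%classic.
  have := law e `]-oo, (M e + V e * c)%R[%classic.
  rewrite (_ : [set w | _ (W w e)] = [set w | W w e < M e + V e * c]%R); last first.
    by apply/seteqP; split => w /=; rewrite in_itv.
  move=> ->//; congr (nu _); apply/seteqP; split => u /=;
  by rewrite !in_itv/= ltrD2l ltr_pM2l.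
apply: contrapT => nnear.
have /choice[e_ he] : forall k : nat, exists e,
    ball e0 k.+1%:R^-1 e /\ (q e0 + eps <= q e)%R.
  move=> k; apply: contrapT => nk; apply: nnear.
  apply/nbhs_ballP; exists k.+1%:R^-1%R => //=.
  by move=> e bke; rewrite ltNge; apply/negP => h; apply: nk; exists e.
pose F K := \bigcap_(k >= K) [set w | W w (e_ k) < q (e_ k)]%R.
have mF K : measurable (F K).
  by apply: bigcap_measurable => [|k _]; [exists K => /=|exact: mlt].
have ndF : nondecreasing_seq F.
  move=> i j ij; apply/subsetPset => w hw k /= jk; apply: hw => /=.
  exact: leq_trans jk.
have PF K : P (F K) <= nu `]-oo, a[%classic.
  rewrite -(lt_law (e_ K)); apply: le_measure; rewrite ?inE//.
  by move=> w; apply => /=.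
have mUF : measurable (\bigcup_K F K) by exact: bigcup_measurable.
have PUF : P (\bigcup_K F K) <= nu `]-oo, a[%classic.
  have cvgF : P (F k) @[k --> \oo] --> P (\bigcup_K F K).
    exact: nondecreasing_cvg_mu.
  rewrite -(cvg_lim (@ereal_hausdorff R) cvgF).
  by apply: lime_le; [apply/cvg_ex; exists (P (\bigcup_K F K))|exact: nearW].
(* At [e0], the level [b] corresponds to the value [q e0 + eps]. The mass of [[a, b[] is the excess
   that contradicts the bound on the union of the [F K]. *)
pose b := (a + eps / V e0)%R.
have ab : (a < b)%R by rewrite ltrDl divr_gt0.
have qb : (M e0 + V e0 * b = q e0 + eps)%R.
  by rewrite /b /q mulrDr addrA mulrCA divff ?mulr1// gt_eqF.
have sub : [set w | W w e0 < M e0 + V e0 * b]%R `<=` \bigcup_K F K.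
  move=> w /=; rewrite qb => hw.
  have : nbhs (W w e0) [set x | x < q e0 + eps]%R.
    by apply: open_nbhs_nbhs; split => //; exact: open_lt.
  move=> /(cW w e0) /nbhs_ballP[r /= r0 hr].
  have [K hK] := natSV_lt r0; exists K => //= k Kk; have [hb hq] := he k.
  apply: (lt_le_trans _ hq); apply: hr; apply: le_ball hb.
  by rewrite (le_trans _ (ltW hK))// lef_pV2 ?posrE// ler_nat.
have : P [set w | W w e0 < M e0 + V e0 * b]%R <= P (\bigcup_K F K).
  by apply: le_measure; rewrite ?inE.
rewrite lt_law => h; have := le_trans h PUF.
have -> : `]-oo, b[%classic = `]-oo, a[%classic `|` `[a, b[%classic :> set R.
  apply/seteqP; split => x /=; rewrite !in_itv/=.
    by move=> ->; rewrite andbT; case: (ltP x a) => ?; [left|right].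
  by case=> [/lt_trans|/andP[]//]; apply.
rewrite measureU//; last first.
  apply/seteqP; split => // x /=; rewrite !in_itv/= => -[xa /andP[]].
  by rewrite leNgt xa.
have fa : nu `]-oo, a[%classic \is a fin_num by exact: fin_num_measure.
by rewrite -leeBrDl// subee// leNgt nu0.
Qed.

(** The lower bound is the upper bound for [- W], whose location is [- M], whose scale is still [V],
    whose reference law is the reflected [nu] and whose level is [- a]. Reflection swaps the closed
    end of [[x, y[], so positivity is assumed on open intervals. *)
Lemma location_scale_continuous (E : pseudoMetricType R) (nu : probability (measurableTypeR R) R)
    (W : T -> E -> R) (M V : E -> R) (a : R) :
  (forall a b : R, (a < b)%R -> 0 < nu `]a, b[%classic) ->
  (forall e, (0 < V e)%R) ->
  (forall w, continuous (W w)) ->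
  (forall e, measurable_fun setT (W ^~ e)) ->
  (forall e (B : set R), measurable B ->
    P [set w | B (W w e)] = nu [set u | B (M e + V e * u)%R]) ->
  continuous (fun e => M e + V e * a)%R.
Proof.
move=> nu0 V0 cW mW law e0; apply/cvgrPdist_lt => eps eps0.
have mopp : measurable_fun setT (-%R : measurableTypeR R -> measurableTypeR R) by [].
have mpre (B : set R) : measurable B -> measurable [set x | B (- x)%R].
  by move=> mB; rewrite -[X in measurable X]setTI; exact: mopp.
have nu1 (x y : R) : (x < y)%R -> 0 < nu `[x, y[%classic.
  move=> xy; apply: (lt_le_trans (nu0 _ _ xy)); apply: le_measure; rewrite ?inE//.
  by apply: subset_itvr; rewrite bnd_simp.
have := location_scale_usc nu1 V0 cW mW law a e0 eps0.
have nu2 (x y : R) : (x < y)%R -> 0 < image_measure nu mopp `[x, y[%classic.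
  move=> xy; rewrite -ltrN2 in xy; apply: (lt_le_trans (nu0 _ _ xy)).
  apply: le_measure; rewrite ?inE//; first exact: mpre.
  by move=> u /=; rewrite !in_itv/= => /andP[h1 h2]; rewrite lerNr ltrNl h1 ltW.
have cW' w : continuous (fun e => - W w e)%R by move=> e; apply: cvgN; exact: cW.
have mW' e : measurable_fun setT (fun w => - W w e)%R by exact: measurableT_comp.
have law' e (B : set R) : measurable B -> P [set w | B (- W w e)%R] =
    image_measure nu mopp [set u | B (- M e + V e * u)%R].
  move=> mB; rewrite (law e _ (mpre _ mB)) /image_measure /pushforward.
  congr (nu _); apply/seteqP; split => u /=; by rewrite mulrN -opprD.
have := location_scale_usc nu2 V0 cW' mW' law' (- a)%R e0 eps0.
move=> h1 h2; near=> e.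
have : (- M e + V e * - a < - M e0 + V e0 * - a + eps)%R by near: e.
have : (M e + V e * a < M e0 + V e0 * a + eps)%R by near: e.
rewrite !mulrN ltr_norml => ? ?; apply/andP; split; lra.
Unshelve. all: by end_near. Qed.

Lemma normal_prob_itv_gt0 (a b : R) : (a < b)%R ->
  0 < normal_prob 0 1 `]a, b[%classic.
Proof.
(* A lower bound of the normal density on []a, b[], where [x ^+ 2 <= a ^+ 2 + b ^+ 2] whatever the
   signs of [a] and [b]. *)
move=> ab; pose c := (@normal_peak R 1 * expR (- (a ^+ 2 + b ^+ 2) / 2))%R.
have c0 : (0 < c)%R by rewrite mulr_gt0 ?expR_gt0// normal_peak_gt0 ?oner_eq0.
apply: (@lt_le_trans _ _ (\int[lebesgue_measure]_(x in `]a, b[%classic) c%:E)).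
  rewrite integral_cst//= lebesgue_measure_itv/= lte_fin ab -EFinB -EFinM lte_fin.
  by rewrite mulr_gt0// subr_gt0.
apply: ge0_le_integral => //=.
- by move=> x xab; rewrite lee_fin ltW.
- apply/measurable_EFinP; apply: measurable_funTS; exact: measurable_normal_pdf.
move=> x; rewrite in_itv/= => /andP[ax xb].
rewrite lee_fin /normal_pdf oner_eq0 ler_wpM2l ?normal_peak_ge0//.
rewrite /normal_fun ler_expR subr0 expr1n.
have : (x ^+ 2 <= a ^+ 2 + b ^+ 2)%R by case: (leP 0 x)%R => x0; nra.
by rewrite !mulNr lerN2 ler_pM2r// invr_gt0.
Qed.

End location_scale.

(** * Continuity of the covariance function *)

Section covariance_continuous.
Variables (R : realType) (d : nat) (S : set 'rV[R]_d).
Variables (m : S -> R) (Sigma : S -> S -> R) (G : probability (path_space S) R).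
Hypothesis hG : gaussian_process m Sigma G.
Local Notation lam := (lebesgue_rV R).

(** The variance of [Y p.1 + Y p.2]. The sum, unlike the difference, stays nondegenerate on the
    diagonal, so its scale is positive everywhere. *)
Let var2 (p : S * S) := Sigma p.1 p.1 + Sigma p.1 p.2 + Sigma p.1 p.2 + Sigma p.2 p.2.

Let dirac1_distinct (s : S) : distinct (const_mx s : 'rV[S]_1).
Proof. by move=> i j _; rewrite !ord1. Qed.

Lemma variance_gt0 s : 0 < Sigma s s.
Proof.
have := posdef_det (posdef_cov_mx hG (@dirac1_distinct s)).
by rewrite det_mx11 !mxE.
Qed.

Lemma pair_distinct (s t : S) : s <> t ->
  distinct (row_mx (const_mx s : 'rV[S]_1) (const_mx t : 'rV[S]_1)).
Proof.
move=> st i j; case: (split_ordP i) => a ->; case: (split_ordP j) => b ->;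
  rewrite ?(row_mxEl, row_mxEr) !mxE ?ord1// => ts.
by exfalso; apply: st.
Qed.

Let var2_gt0 p : 0 < var2 p.
Proof.
case: p => s t; rewrite /var2/=; have [->|/eqP st] := eqVneq s t.
  by rewrite !addr_gt0// variance_gt0.
have [_ /(_ (const_mx 1))] := posdef_cov_mx hG (pair_distinct st).
rewrite (cov_mx_row hG (pair_distinct st)) -[const_mx _]row_mx_const.
rewrite mul_row_block tr_row_mx mul_row_col.
rewrite !mxE !big_ord1 !mxE !big_ord1 !mxE !mul1r !mulr1 addrA; apply.
by rewrite row_mx_const; apply/eqP => /matrixP/(_ 0 0); rewrite !mxE => /eqP; rewrite oner_eq0.
Qed.

Let single_law (s : S) (B : set R) : measurable B ->
  G [set Y | B (Y s)] = normal_prob 0 1 [set u | B (m s + Num.sqrt (Sigma s s) * u)].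
Proof.
move=> mB; have ds := @dirac1_distinct s.
have := integral_mvnormal_pdf1 (mean_rV m (const_mx s)) (posdef_cov_mx hG ds) mB.
rewrite !mxE => <-.
have mA : measurable [set y : 'rV[R]_1 | B (y 0 0)].
  by rewrite -[X in measurable X]setTI; exact: measurable_mx_coord.
transitivity (G [set Y : path_space S |
    [set y : 'rV[R]_1 | B (y 0 0)] (values Y (const_mx s))]).
  congr (G _); by apply/seteqP; split => Y /=; rewrite !mxE.
rewrite (gaussian_law hG ds mA); apply: eq_integral => y _.
by rewrite !indicE; congr ((nat_of_bool _)%:R * _)%:E; apply/idP/idP; rewrite !inE.
Qed.

(** The matrix [Q] maps [(a, b)] to [(a + b, b)] with determinant one. The joint density of the new
    pair is again normal, and [mvnormal_pdf_block] allows its second variable to be integrated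
    out. *)
Let sum_law_distinct (s t : S) (B : set R) : s <> t -> measurable B ->
  G [set Y | B (Y s + Y t)] =
  normal_prob 0 1 [set u | B (m s + m t + Num.sqrt (var2 (s, t)) * u)].
Proof.
move=> /pair_distinct; set s1 := const_mx s; set t1 := const_mx t => dst mB.
pose C := cov_mx Sigma s1 s1; pose K := cov_mx Sigma s1 t1.
pose D := cov_mx Sigma t1 t1.
pose Q : 'M[R]_(1 + 1) := block_mx 1%:M 0 1%:M 1%:M.
have pC := posdef_cov_mx hG dst; rewrite (cov_mx_row hG dst) -/C -/K -/D in pC.
have dQ : \det Q = 1 by rewrite det_lblock !det1 mulr1.
have uQ : Q \in unitmx by rewrite unitmxE dQ unitr1.
have DT : D^T = D := posdef_drsubmx_sym pC.
pose A' := C + K + K^T + D.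
have QCQ : Q^T *m block_mx C K K^T D *m Q = block_mx A' (K + D) (K + D)^T D.
  rewrite tr_block_mx !trmx1 trmx0 !mulmx_block !mul1mx !mulmx1 !mul0mx !mulmx0.
  rewrite !add0r linearD/= DT /A'; congr block_mx.
  by rewrite -!addrA; congr (_ + _); rewrite addrCA.
have pC' : posdef (block_mx A' (K + D) (K + D)^T D).
  by rewrite -QCQ; exact: posdef_congr.
pose M1 := mean_rV m s1 + mean_rV m t1.
have rowQ (a b : 'rV[R]_1) : row_mx a b *m Q = row_mx (a + b) b.
  by rewrite mul_row_block !mulmx1 mulmx0 add0r.
pose p (a b : 'rV[R]_1) := mvnormal_pdf (row_mx M1 (mean_rV m t1))
  (block_mx A' (K + D) (K + D)^T D) (row_mx a b).
have pE a b : mvnormal_pdf (mean_rV m (row_mx s1 t1))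
    (cov_mx Sigma (row_mx s1 t1) (row_mx s1 t1)) (row_mx a b) = p (a + b) b.
  rewrite mean_row (cov_mx_row hG dst) /p -rowQ -/C -/K -/D -QCQ -rowQ.
  by rewrite mvnormal_pdf_congr//; exact: posdef_unitmx.
pose g (x : 'rV[R]_1 * 'rV[R]_1) : \bar R := (\1_B (x.1 0 0) * p x.1 x.2)%:E.
have mp : measurable_fun setT g.
  apply/measurable_EFinP; apply: measurable_funM.
    apply: (measurableT_comp (measurable_indic mB)).
    by apply: (measurableT_comp (measurable_mx_coord 0 0)).
  by apply: (measurableT_comp (measurable_mvnormal_pdf _ _)); exact: measurable_fun_row_mx.
have g0 x : (0 <= g x)%E by rewrite lee_fin mulr_ge0// mvnormal_pdf_ge0.
have msum : measurable_fun setT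
    (fun x : 'rV[R]_1 * 'rV[R]_1 => (x.1 + x.2, x.2)).
  by apply: measurable_fun_pair => //; exact: measurable_fun_addmx.
have mA : measurable [set x : 'rV[R]_(1 + 1) | B (lsubmx x 0 0 + rsubmx x 0 0)].
  rewrite -[X in measurable X]setTI.
  have : measurable_fun setT (fun x : 'rV[R]_(1 + 1) => lsubmx x 0 0 + rsubmx x 0 0).
    apply: measurable_funD; under eq_fun do rewrite mxE; exact: measurable_mx_coord.
  exact.
transitivity (G [set Y : path_space S |
    [set x : 'rV[R]_(1 + 1) | B (lsubmx x 0 0 + rsubmx x 0 0)]
      (values Y (row_mx s1 t1))]).
  congr (G _); by apply/seteqP; split => Y /=; rewrite values_row row_mxKl row_mxKr !mxE.
rewrite (gaussian_law hG dst mA) ge0_integral_row_mx; last 2 first.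
- apply/measurable_EFinP; apply: measurable_funM; first exact: measurable_indic.
  exact: measurable_mvnormal_pdf.
- by move=> y; rewrite lee_fin mulr_ge0// mvnormal_pdf_ge0.
transitivity (\int[lam 1]_y \int[lam 1]_z g ((y + z)%R, z))%E.
  apply: eq_integral => y _; apply: eq_integral => z _.
  rewrite pE /g/= !indicE; congr ((nat_of_bool _)%:R * _)%:E.
  by apply/idP/idP; rewrite !inE /= row_mxKl row_mxKr mxE.
(* The translation by [z] acts on [y] at fixed [z], hence the exchange of integrals; they are
   exchanged back afterwards to integrate [z] out. *)
rewrite (fubini_tonelli (fun x : 'rV[R]_1 * 'rV[R]_1 => g (x.1 + x.2, x.2))); last 2 first.
- exact: (measurableT_comp mp msum).
- by move=> x; exact: g0.
transitivity (\int[lam 1]_z \int[lam 1]_y g (y, z))%E.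
  apply: eq_integral => z _ /=.
  have mgz : measurable_fun setT (fun y => g (y, z)).
    by apply: (measurableT_comp mp); exact: measurable_fun_pair.
  exact: (ge0_integral_rV_shift z mgz (fun y => g0 (y, z))).
rewrite -(fubini_tonelli g mp g0).
have pA := posdef_ulsubmx pC'; have pS := posdef_schur_compl pC'.
transitivity (\int[lam 1]_y (\1_B (y 0 0)%R * mvnormal_pdf M1 A' y)%:E)%E.
  apply: eq_integral => y _.
  pose c : 'rV[R]_1 := - mean_rV m t1 - (y - M1) *m regression_mx A' (K + D).
  (* The trivial indicator puts the conditional density in the form of [integral_mvnormal_pdf1],
     which then gives total mass one. *)
  pose h (z : 'rV[R]_1) := (\1_setT (z 0 0) * mvnormal_pdf 0 (schur_compl A' (K + D) D) z)%R.
  have mh : measurable_fun setT (EFin \o h).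
    apply/measurable_EFinP; apply: measurable_funM; last exact: measurable_mvnormal_pdf.
    by apply: (measurableT_comp (measurable_indic measurableT)); exact: measurable_mx_coord.
  have h0 z : (0 <= (EFin \o h) z)%E by rewrite lee_fin mulr_ge0// mvnormal_pdf_ge0.
  have mhc : measurable_fun setT (fun z : 'rV[R]_1 => (EFin \o h) (z + c)).
    by apply: (measurableT_comp mh); exact: measurable_fun_addmx.
  transitivity (\int[lam 1]_z ((\1_B (y 0 0)%R * mvnormal_pdf M1 A' y)%:E *
      (EFin \o h) (z + c)%R))%E.
    apply: eq_integral => z _; rewrite /g/= -EFinM; congr EFin.
    rewrite /p (mvnormal_pdf_block _ _ _ _ pC') /h indicT mul1r mulrA.
    by rewrite /c addrA.
  rewrite (ge0_integralZl _ measurableT mhc); last 2 first.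
  - by move=> z _; exact: h0.
  - by rewrite lee_fin mulr_ge0// mvnormal_pdf_ge0.
  rewrite (ge0_integral_rV_shift c mh h0).
  have -> : (\int[lam 1]_z (EFin \o h) z = 1)%E.
    rewrite (integral_mvnormal_pdf1 _ pS measurableT).
    by rewrite (_ : [set u | _] = setT) ?normal_prob_setT//; apply/seteqP; split.
  exact: mule1.
rewrite (integral_mvnormal_pdf1 _ pA mB) !mxE.
reflexivity.
Qed.

Let sum_law p (B : set R) : measurable B ->
  G [set Y | B (Y p.1 + Y p.2)] =
  normal_prob 0 1 [set u | B (m p.1 + m p.2 + Num.sqrt (var2 p) * u)].
Proof.
case: p => s t mB /=; have [<-|/eqP st] := eqVneq s t; last exact: sum_law_distinct.
have mB2 : measurable [set x : R | B (x + x)].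
  rewrite -[X in measurable X]setTI.
  have : measurable_fun setT (fun x : R => x + x) by exact: measurable_funD.
  exact.
rewrite (@single_law s _ mB2); congr (normal_prob 0 1 _).
have -> : Num.sqrt (var2 (s, s)) = 2 * Num.sqrt (Sigma s s).
  rewrite /var2/= (_ : _ + _ = 2 ^+ 2 * Sigma s s); last by ring.
  by rewrite sqrtrM ?sqr_ge0// sqrtr_sqr ger0_norm.
apply/seteqP; split => u /=; congr B; ring.
Qed.

Lemma covariance_continuous : continuous (fun p : S * S => Sigma p.1 p.2).
Proof.
have cW (Y : path_space S) : continuous (fun p : S * S => Y p.1 + Y p.2).
  move=> p; apply: cvgD.
    by apply: (@continuous_comp _ _ _ fst); [exact: cvg_fst|exact: continuous_path].
  by apply: (@continuous_comp _ _ _ snd); [exact: cvg_snd|exact: continuous_path].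
have mW (p : S * S) : measurable_fun setT (fun Y : path_space S => Y p.1 + Y p.2).
  by apply: measurable_funD; exact: measurable_path_eval.
have V0 p : 0 < Num.sqrt (var2 p) by rewrite sqrtr_gt0.
have cq a := @location_scale_continuous _ _ _ G _
  (normal_prob 0 1 : probability (measurableTypeR R) R)
  (fun Y p => Y p.1 + Y p.2) (fun p => m p.1 + m p.2) (fun p => Num.sqrt (var2 p)) a
  (@normal_prob_itv_gt0 R) V0 cW mW sum_law.
have cv : continuous var2.
  (* The difference of the quantiles at levels 1 and 0 is the standard deviation; the means
     cancel. *)
  pose X p := m p.1 + m p.2 + Num.sqrt (var2 p) * 1 -
    (m p.1 + m p.2 + Num.sqrt (var2 p) * 0).
  have cX : continuous X by move=> p; apply: cvgB; exact: cq.
  have -> : var2 = (fun p => X p * X p).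
    apply/funext => p; rewrite /X mulr1 mulr0 addr0 addrAC subrr add0r -expr2.
    by rewrite sqr_sqrtr// ltW.
  by move=> p; apply: cvgM; exact: cX.
(* Polarization, with [var2 (s, s) = 4 * Sigma s s]. *)
have -> : (fun p : S * S => Sigma p.1 p.2) = (fun p =>
    (var2 p - var2 (p.1, p.1) / 4 - var2 (p.2, p.2) / 4) / 2).
  by apply/funext => p; rewrite /var2/=; field.
move=> p; apply: cvgM; last exact: cvg_cst.
apply: cvgB; [apply: cvgB; first exact: cv|].
- apply: cvgM; last exact: cvg_cst.
  apply: (@continuous_comp _ _ _ (fun p : S * S => (p.1, p.1)) var2); last exact: cv.
  exact: (@cvg_pair _ _ _ (nbhs p) (nbhs p.1) (nbhs p.1) _ _ _ fst fst cvg_fst cvg_fst).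
- apply: cvgM; last exact: cvg_cst.
  apply: (@continuous_comp _ _ _ (fun p : S * S => (p.2, p.2)) var2); last exact: cv.
  exact: (@cvg_pair _ _ _ (nbhs p) (nbhs p.2) (nbhs p.2) _ _ _ snd snd cvg_snd cvg_snd).
Qed.

End covariance_continuous.

(** * Measurability of the inverse matrix *)

Section measurable_matrix.
Variables (R : realType) (d : measure_display) (T : measurableType d).

(** Writing [1 / x] as [x] times the power -1 of [x * x] reduces inversion to real powers of
    nonnegative numbers; both sides vanish at 0. *)
Lemma measurable_funV (f : T -> R) :
  measurable_fun setT f -> measurable_fun setT (fun x => (f x)^-1).
Proof.
move=> mf; rewrite (_ : (fun _ => _) = (fun x => f x * (f x * f x) `^ (-1))).
  apply: measurable_funM => //.
  apply: (measurableT_comp (measurable_powR (-1))); exact: measurable_funM.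
apply/funext => x; rewrite powR_inv1 -?expr2 ?sqr_ge0//.
have [->|f0] := eqVneq (f x) 0; first by rewrite invr0 mul0r.
by rewrite expr2 invfM mulVKf.
Qed.

Lemma measurable_det n (f : T -> 'M[R]_n) :
  (forall i j, measurable_fun setT (fun x => f x i j)) ->
  measurable_fun setT (fun x => \det (f x)).
Proof.
move=> mf; apply: measurable_sum => s; apply: measurable_funM => //.
exact: measurable_prod.
Qed.

Lemma measurable_invmx n (f : T -> 'M[R]_n) :
  (forall i j, measurable_fun setT (fun x => f x i j)) ->
  forall i j, measurable_fun setT (fun x => invmx (f x) i j).
Proof.
move=> mf i j; have mdet := measurable_det mf.
(* Cramer's formula; on singular matrices [invmx] is the identity map. *)
rewrite (_ : (fun _ => _) = (fun x => if \det (f x) == 0 then f x i j else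
    (\det (f x))^-1 * cofactor (f x) j i)); last first.
  apply/funext => x; rewrite /invmx unitmxE unitfE; case: eqP => //= _.
  by rewrite !mxE.
apply: measurable_fun_if => //.
- apply: (measurable_fun_bool true).
  rewrite (_ : _ @^-1` _ = (fun x => \det (f x)) @^-1` [set 0]).
    exact: (mdet measurableT _ (measurable_set1 0)).
  by apply/seteqP; split => x /= /eqP.
- by apply: measurable_funTS; exact: mf.
- apply: measurable_funTS; apply: measurable_funM; first exact: measurable_funV.
  apply: measurable_funM => //; apply: measurable_det => k l.
  by under eq_fun do rewrite !mxE; exact: mf.
Qed.
End measurable_matrix.

(** * Kriging and its measurability *)

Section kriging.
Variables (R : realType) (d : nat) (S : set 'rV[R]_d).
Variables (Sigma : S -> S -> R).
Hypothesis cSigma : continuous (fun p : S * S => Sigma p.1 p.2).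

Section path.
Variables (n : nat) (s : 'rV[S]_n) (y : 'rV[R]_n) (Y : path_space S).

(** The formula makes sense for every [s]: when the covariance matrix is singular, [invmx] is a
    default value and the result is still a continuous path, measurable in all its arguments. *)
Definition krige_fun (t : S) : R := Y t +
  \sum_j ((y - values Y s) *m invmx (cov_mx Sigma s s)) 0 j * Sigma (s 0 j) t.

Lemma continuous_krige_fun : continuous krige_fun.
Proof.
move=> t; have cY := @continuous_path R d S Y t.
apply: (@cvgD _ _ _ (nbhs t) (nbhs_filter t) Y _ (Y t)) => //.
have := @cvg_big R 'I_n +%R 0 xpredT (@add_continuous R) S (nbhs t)
  (index_enum 'I_n) _ _ (nbhs_filter t); apply => j _.
apply: (@cvgM _ _ (nbhs t) (nbhs_filter t)); first exact: cvg_cst.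
apply: (@continuous_comp _ _ _ (fun t => (s 0 j, t))
  (fun p : S * S => Sigma p.1 p.2)); last exact: cSigma.
exact: (@cvg_pair _ _ _ (nbhs t) (nbhs (s 0 j)) (nbhs t) _ _ _ (cst (s 0 j)) id
  (cvg_cst _) cvg_id).
Qed.

Definition krige : path_space S := mkcts continuous_krige_fun : continuousType S R.

Lemma krigeE t : krige t = Y t +
  \sum_j ((y - values Y s) *m invmx (cov_mx Sigma s s)) 0 j * Sigma (s 0 j) t.
Proof. by []. Qed.

End path.

Lemma krige_values n (s : 'rV[S]_n) y Y : cov_mx Sigma s s \in unitmx ->
  values (krige s y Y) s = y.
Proof.
move=> uC; apply/rowP => i; rewrite mxE krigeE.
have -> : \sum_j ((y - values Y s) *m invmx (cov_mx Sigma s s)) 0 j *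
    Sigma (s 0 j) (s 0 i) = (y - values Y s) 0 i.
  rewrite -[in RHS](mulmxKV uC (y - values Y s)) [RHS]mxE.
  by apply: eq_bigr => j _; congr (_ * _); rewrite mxE.
by rewrite !mxE subrKC.
Qed.

Lemma krige_split n (s : 'rV[S]_n) y Y t :
  krige s y Y t = krige s 0 Y t +
    \sum_j (y *m invmx (cov_mx Sigma s s)) 0 j * Sigma (s 0 j) t.
Proof.
rewrite !krigeE -addrA; congr (_ + _); rewrite -big_split/=.
by apply: eq_bigr => j _; rewrite -mulrDl sub0r mulmxBl mulNmx !mxE addrC.
Qed.

Lemma krige_id n (s : 'rV[S]_n) Y : krige s (values Y s) Y = Y.
Proof.
apply: pathP => t; rewrite krigeE subrr mul0mx big1 ?addr0// => j _.
by rewrite mxE mul0r.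
Qed.

Lemma residualE n k (s : 'rV[S]_n) (t : 'rV[S]_k) Y :
  values (krige s 0 Y) t =
  values Y t - values Y s *m regression_mx (cov_mx Sigma s s) (cov_mx Sigma s t).
Proof.
apply/rowP => i; rewrite mxE krigeE [RHS]mxE [X in _ = X + _]mxE; congr (_ + _).
rewrite sub0r mulNmx /regression_mx mulmxA [RHS]mxE [X in _ = - X]mxE -sumrN.
by apply: eq_bigr => j _; rewrite mxE mulNr; congr (- (_ * _)); rewrite mxE.
Qed.

Hypothesis cS : compact S.

(** Measurability of the moving locations is expressed by preimages of the countable base of [S].
    Values at them are handled by [measurable_eval_joint], covariances by the continuity of
    [Sigma]. *)
Lemma measurable_krige d' (T : measurableType d') n (s : T -> 'rV[S]_n)
    (y : T -> 'rV[R]_n) (Y : T -> path_space S) :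
  (forall i p, measurable [set x | sub_box S p (s x 0 i)]) ->
  measurable_fun setT y -> measurable_fun setT Y ->
  measurable_fun setT (fun x => krige (s x) (y x) (Y x)).
Proof.
move=> ms my mY; apply: measurable_pathP => // t.
have mYe u : measurable_fun setT (fun x => Y x u).
  exact: (measurableT_comp (measurable_path_eval u)).
have mSigma (u v : T -> S) : (forall p, measurable [set x | sub_box S p (u x)]) ->
    (forall p, measurable [set x | sub_box S p (v x)]) ->
    measurable_fun setT (fun x => Sigma (u x) (v x)).
  move=> mu mv; apply: (measurable_comp_continuous (f := fun x => (u x, v x))
    (countable_base_prod (@countable_base_sub_box R d S)
      (@countable_base_sub_box R d S)) _ cSigma) => p.
  exact: (measurableI _ _ (mu p.1) (mv p.2)).
have mcst (u : S) p : measurable [set x : T | sub_box S p u].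
  have [h|h] := pselect (sub_box S p u).
    by rewrite (_ : mkset _ = setT)//; apply/seteqP; split.
  by rewrite (_ : mkset _ = set0)//; apply/seteqP; split.
apply: measurable_funD; first exact: mYe.
apply: measurable_sum => j; apply: measurable_funM; last exact: mSigma.
apply: (measurableT_comp (measurable_mx_coord 0 j)).
apply: measurable_fun_mulmx.
  apply: measurable_fun_addmx => //; apply: measurable_mxP => i k.
  under eq_fun do rewrite mxE mxE.
  apply: measurable_funN; apply: (measurable_eval_joint (u := fun x => s x 0 k)) => //.
  exact: ms.
apply: measurable_invmx => i k; under eq_fun do rewrite mxE.
exact: mSigma.
Qed.

Lemma measurable_krige_path n (s : 'rV[S]_n) y :
  measurable_fun setT (krige s y).
Proof.
apply: (measurable_krige (s := cst s) (y := cst y) (Y := id)) => // i p.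
have [h|h] := pselect (sub_box S p (s 0 i)).
  by rewrite (_ : mkset _ = setT)//; apply/seteqP; split.
by rewrite (_ : mkset _ = set0)//; apply/seteqP; split.
Qed.

End kriging.

(** * Finite-dimensional distributions determine laws on the path space *)

Section cylinders.
Variables (R : realType) (d : nat) (S : set 'rV[R]_d).

Definition cylinder (U : seq S) (E : S -> set R) : set (path_space S) :=
  [set Y | forall t, t \in U -> E t (Y t)].

Definition cylinders : set (set (path_space S)) :=
  [set A | exists U E, (forall t, measurable (E t)) /\ A = cylinder U E].

Lemma measurable_cylinder U E : (forall t, measurable (E t)) ->
  measurable (cylinder U E).
Proof.
move=> mE; rewrite (_ : cylinder U E = \bigcap_(t in [set` U])
      (fun Y : path_space S => Y t) @^-1` E t).
  apply: fin_bigcap_measurable => [|t _]; first exact: finite_seq.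
  by rewrite -[X in measurable X]setTI; exact: measurable_path_eval.
by apply/seteqP; split.
Qed.

Lemma setI_closed_cylinders : setI_closed cylinders.
Proof.
move=> _ _ [U1 [E1 [mE1 ->]]] [U2 [E2 [mE2 ->]]].
exists (U1 ++ U2), (fun t => (if t \in U1 then E1 t else setT) `&`
  (if t \in U2 then E2 t else setT)); split.
  by move=> t; apply: measurableI; case: ifP.
apply/seteqP; split => Y /=.
  by move=> [h1 h2] t _; split; case: ifPn => // ?; [exact: h1|exact: h2].
move=> h; split => t tU; have := h t; rewrite mem_cat tU ?orbT => /(_ isT)[].
  by [].
by [].
Qed.

(** By [measurable_pathP], the identity from the sigma-algebra of cylinders to the Borel one is
    measurable. *)
Lemma measurable_cylindersE : compact S ->
  @measurable _ (path_space S) = <<s cylinders >>.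
Proof.
move=> cS; apply/seteqP; split => A; last first.
  apply: smallest_sub; first exact: sigma_algebra_measurable.
  by move=> _ [U [E [mE ->]]]; exact: measurable_cylinder.
have mid : measurable_fun setT
    (fun Y : g_sigma_algebraType cylinders => (Y : path_space S)).
  apply: measurable_pathP => // s _ B mB; rewrite setTI.
  apply: sub_sigma_algebra; exists [:: s], (fun=> B); split => //.
  apply/seteqP; split => Y /=; first by move=> YB t; rewrite inE => /eqP ->.
  by apply; rewrite inE.
by move=> mA; have := mid measurableT A mA; rewrite setTI.
Qed.

Lemma path_measure_unique (m1 m2 : {finite_measure set (path_space S) -> \bar R}) :
  compact S ->
  (forall U E, (forall t, measurable (E t)) ->
     m1 (cylinder U E) = m2 (cylinder U E)) ->
  forall A, measurable A -> m1 A = m2 A.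
Proof.
move=> cS m12 A mA; apply: (measure_unique cylinders (fun=> setT)) => //.
- exact: measurable_cylindersE.
- exact: setI_closed_cylinders.
- move=> _; exists [::], (fun=> setT); split => //.
  by apply/seteqP; split => Y //= _ t; rewrite inE.
- by rewrite bigcup_const.
- by move=> _ [U [E [mE ->]]]; exact: m12.
- by move=> _; rewrite ltey_eq fin_num_measure.
Qed.

End cylinders.

(** * The conditional Gaussian law *)

Section gaussian_conditional.
Variables (R : realType) (d : nat) (S : set 'rV[R]_d).
Variables (m : S -> R) (Sigma : S -> S -> R) (G : probability (path_space S) R).
Hypothesis hG : gaussian_process m Sigma G.
Hypothesis cS : compact S.
Hypothesis cSigma : continuous (fun p : S * S => Sigma p.1 p.2).
Local Notation krige := (krige cSigma).
Variables (n : nat) (s : 'rV[S]_n).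
Hypothesis ds : distinct s.
Local Open Scope ereal_scope.

Let mres : measurable_fun setT (krige s 0) := measurable_krige_path cSigma cS s 0.

(** For fixed [B], both sides are finite measures in [A], so cylinders suffice; there the claim is
    [residual_independent], once the locations are made distinct. *)
Lemma krige_independent (B : set 'rV[R]_n) (A : set (path_space S)) :
  measurable B -> measurable A ->
  G [set Y | B (values Y s) /\ A (krige s 0 Y)] =
  G [set Y | B (values Y s)] * G [set Y | A (krige s 0 Y)].
Proof.
move=> mB mA; pose B' := [set Y : path_space S | B (values Y s)].
have mB' : measurable B'.
  by rewrite -[X in measurable X]setTI; exact: measurable_values.
have GB0 : (0 <= fine (G B'))%R by rewrite fine_ge0.
pose m1 := image_measure (mrestr G mB') mres.
pose m2 := mscale (NngNum GB0) (image_measure G mres).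
suff m12 : m1 A = m2 A.
  transitivity (m1 A); first by congr (G _); rewrite setIC.
  rewrite m12; congr (_ * _); exact/fineK/fin_num_measure.
apply: path_measure_unique => // U E mE {A mA}.
(* Locations of the cylinder that belong to [s] are set apart, as the residual vanishes there;
   repetitions are removed because Gaussianity speaks of distinct locations. *)
pose V := undup [seq t <- U | t \notin codom (s 0%R)].
pose t1 : 'rV[S]_(size V) := (\row_i tnth (in_tuple V) i)%R.
have tV i : t1 0%R i \in V by rewrite mxE mem_tnth.
have dst : distinct (row_mx s t1).
  move=> i j; case: (split_ordP i) => a ->; case: (split_ordP j) => b ->;
    rewrite ?(row_mxEl, row_mxEr).
  - by move/ds => ->.
  - move=> ab; have := tV b; rewrite -ab mem_undup mem_filter.
    by rewrite codom_f.
  - move=> ab; have := tV a; rewrite ab mem_undup mem_filter.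
    by rewrite codom_f.
  - have /tuple_uniqP tinj : uniq (in_tuple V) by exact: undup_uniq.
    by rewrite !mxE => /tinj ->.
have uC := posdef_unitmx (posdef_cov_mx hG ds).
pose F := [set z : 'rV[R]_(size V) | forall i, E (t1 0%R i) (z 0%R i)].
have mF : measurable F.
  rewrite (_ : F = \bigcap_(i in [set: 'I_(size V)])
      (fun z : 'rV[R]_(size V) => z 0%R i) @^-1` E (t1 0%R i)).
    apply: fin_bigcap_measurable => [|i _]; first exact: finite_finset.
    by rewrite -[X in measurable X]setTI; exact: measurable_mx_coord.
  apply/seteqP; split => z /=; first by move=> h i _; exact: h.
  by move=> h i; exact: (h i I).
(* The part of the cylinder condition at locations of [s]: a proposition independent of the path,
   either true or making the event empty. *)
pose Q := forall i, s 0%R i \in U -> E (s 0%R i) 0%R.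
have cylE Y : cylinder U E (krige s 0 Y) <-> Q /\ F (values (krige s 0 Y) t1).
  have Z0 i : krige s 0 Y (s 0%R i) = 0%R.
    by have /rowP/(_ i) := krige_values cSigma 0 Y uC; rewrite !mxE.
  split.
    move=> h; have {}h t : t \in U -> E t (krige s 0 Y t) := h t.
    split => i; first by move=> /h; rewrite Z0.
    have -> : values (krige s 0 Y) t1 0%R i = krige s 0 Y (t1 0%R i) by rewrite mxE.
    apply: h; have := tV i.
    by rewrite mem_undup mem_filter => /andP[].
  move=> [q f] t tU; have [/codomP[i ti]|tn] := boolP (t \in codom (s 0%R)).
    by rewrite ti Z0; apply: q; rewrite -ti.
  have tV' : t \in V by rewrite mem_undup mem_filter tn.
  have /tnthP[i ti] : t \in in_tuple V by [].
  by have := f i; rewrite !mxE -ti.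
change (G (krige s 0 @^-1` cylinder U E `&` B') =
  (fine (G B'))%:E * G (krige s 0 @^-1` cylinder U E)).
have [q|nq] := pselect Q; last first.
  have e : krige s 0 @^-1` cylinder U E = set0.
    by rewrite -subset0 => Y /cylE[].
  by rewrite e set0I measure0 mule0.
have e : krige s 0 @^-1` cylinder U E =
    [set Y | F (values Y t1 - values Y s *m
       regression_mx (cov_mx Sigma s s) (cov_mx Sigma s t1))%R].
  apply/seteqP; split => Y /=; first by move=> /cylE[_]; rewrite residualE.
  by move=> h; apply/cylE; split => //; rewrite residualE.
have := residual_independent hG dst mB mF.
rewrite e fineK; last exact: fin_num_measure.
by rewrite setIC.
Qed.

(** Expresses [krige s y Y] through [y] and the residual path alone. Adding the values of the
    residual at [s] to the target makes the identity hold for singular covariance matrices too. *)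
Lemma krige_shift y Y :
  krige s (y + values (krige s 0 Y) s)%R (krige s 0 Y) = krige s y Y.
Proof.
by apply: pathP => t; rewrite [LHS]krigeE addrK [RHS]krige_split.
Qed.

(** By independence, the pair formed by the values and the residual has a product law. The path is
    the function [psi] of this pair, so integrating over the residual first leaves the law of
    [krige s y Z] at [y] the observed values. *)
Lemma krige_conditional (A : set (path_space S)) (B : set 'rV[R]_n) :
  measurable A -> measurable B ->
  G [set Y | A Y /\ B (values Y s)] =
  \int[G]_(Y in [set Y | B (values Y s)])
    G [set Z | A (krige s (values Y s) Z)].
Proof.
move=> mA mB; have mv := measurable_values s.
have mphi : measurable_fun setT (fun Y : path_space S => (values Y s, krige s 0 Y)).
  exact: measurable_fun_pair.
pose J := image_measure G mphi.
pose N1 := image_measure G mv; pose N2 := image_measure G mres.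
have JE : forall X, measurable X -> (N1 \x N2) X = J X.
  by apply: product_measure_unique => D E mD mE; exact: krige_independent.
pose psi (x : 'rV[R]_n * path_space S) := krige s (x.1 + values x.2 s)%R x.2.
have mpsi : measurable_fun setT psi.
  apply: measurable_krige => //.
    move=> i p; have [h|h] := pselect (sub_box S p (s 0%R i)).
      by rewrite (_ : mkset _ = setT)//; apply/seteqP; split.
    by rewrite (_ : mkset _ = set0)//; apply/seteqP; split.
  apply: measurable_fun_addmx => //; exact: (measurableT_comp mv).
pose X := [set x | B x.1 /\ A (psi x)].
have mX : measurable X.
  apply: measurableI; rewrite -[X in measurable X]setTI; last exact: mpsi.
  exact: measurable_fst.
transitivity (J X).
  congr (G _); apply/seteqP; split => Y /=.
    by move=> [AY BY]; split => //=; rewrite /psi/= krige_shift krige_id.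
  by move=> [/= BY]; rewrite /psi/= krige_shift krige_id.
rewrite -JE// /product_measure1/= ge0_integral_image_measure; last 2 first.
- exact: measurable_fun_xsection.
- by move=> y; exact: measure_ge0.
rewrite [RHS]integral_mkcond; apply: eq_integral => Y _; rewrite patchE.
rewrite /N2 /image_measure /pushforward/=.
case: ifPn => [|] BY.
  congr (G _); apply/seteqP; split => Z /=.
    by rewrite xsectionE/= => -[_]; rewrite /psi/= krige_shift.
  rewrite inE/= in BY.
  by move=> h; rewrite xsectionE/=; split => //=; rewrite /psi/= krige_shift.
rewrite (_ : _ @^-1` _ = set0) ?measure0// -subset0 => Z /=.
by rewrite xsectionE/= => -[/= ? _]; move/negP: BY; apply; rewrite inE.
Qed.

End gaussian_conditional.

(** * Configurations and their labelling *)

(** Finiteness is asked pointwise and not uniformly, since the number of points of a configuration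
    is unbounded. *)
Lemma measurable_kernel_xsection d d' (X : measurableType d)
    (Y : measurableType d') (R : realType) (k : R.-ker X ~> Y) (A : set (X * Y)) :
  (forall x, k x setT < +oo)%E -> measurable A ->
  measurable_fun setT (fun x => k x (xsection A x)).
Proof.
move=> kfin mA; rewrite (_ : (fun _ => _) =
    (fun x => mrestr (k x) measurableT (xsection A x))); last first.
  by apply/funext => x; rewrite /mrestr setIT.
have [] // := @measurable_prod_subset_xsection_kernel _ _ X Y R k setT measurableT _ A mA.
move=> x; have kx : k x setT \is a fin_num by rewrite ge0_fin_numE.
exists (fine (k x setT) + 1) => B mB; rewrite /mrestr setIT EFinD fineK//.
apply: (@le_lt_trans _ _ (k x setT)); first by apply: le_measure; rewrite ?inE.
by rewrite lteDl// lte01.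
Qed.

Section points.
Variables (R : realType) (d : nat) (S : set 'rV[R]_d).
Hypothesis cS : compact S.

Lemma measurable_state_space : measurable S.
Proof.
rewrite -[S]setCK; apply: measurableC; apply: sub_sigma_algebra.
by apply: closed_openC; apply: compact_closed => //; exact: norm_hausdorff.
Qed.

Lemma card_inE (B : set 'rV[R]_d) (N : conf_space S) :
  card_in B N = count (fun s : S => \val s \in B) (enum_fset N).
Proof.
rewrite /card_in -size_filter; apply: perm_size; apply: uniq_perm.
- exact: fset_uniq.
- by rewrite filter_uniq// fset_uniq.
- by move=> s; rewrite mem_filter !inE andbC.
Qed.

Lemma card_inT (N : conf_space S) : card_in S N = #|` N|.
Proof.
rewrite card_inE; apply/eqP; rewrite -all_count; apply/allP => s _.
by rewrite inE; exact: set_valP.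
Qed.

Lemma measurable_card_in (B : set 'rV[R]_d) (A : set nat) : measurable B ->
  measurable (card_in B @^-1` A : set (conf_space S)).
Proof.
move=> mB; rewrite (_ : _ @^-1` _ = \bigcup_(k in A) (card_in (B `&` S) @^-1` [set k])).
  apply: bigcup_measurable => k _; apply: sub_sigma_algebra.
  exists (B `&` S), k; split => //; apply: measurableI => //.
  exact: measurable_state_space.
have E (N : conf_space S) : card_in B N = card_in (B `&` S) N.
  rewrite !card_inE; apply: eq_count => s; apply/idP/idP; rewrite !inE/=.
    by move=> h; split => //; exact: set_valP.
  by case.
apply/seteqP; split => N /=; rewrite E; first by move=> h; exists (card_in (B `&` S) N).
by move=> [k Ak /= ->].
Qed.

Lemma measurable_cardfs (A : set nat) :
  measurable [set N : conf_space S | A #|` N|].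
Proof.
rewrite (_ : mkset _ = card_in S @^-1` A).
  exact: measurable_card_in measurable_state_space.
by apply/seteqP; split => N /=; rewrite card_inT.
Qed.

(* Seen as a kernel, [points] makes the number of points [x] of [N] such that
   [(N, x)] lies in a measurable set a measurable function of [N]. *)
Definition points (N : conf_space S) : {measure set 'rV[R]_d -> \bar R} :=
  msum (fun i => \d_(nth 0 [seq \val s | s <- enum_fset N] i)) #|` N|.

Lemma pointsE N B : points N B = (card_in B N)%:R%:E.
Proof.
pose r := [seq \val s | s <- enum_fset N].
transitivity (\sum_(0 <= i < size r) (\d_(nth 0%R r i) B : \bar R))%E.
  by rewrite big_mkord size_map.
rewrite -(big_nth 0%R xpredT (fun x : 'rV[R]_d => \d_x B : \bar R)) big_map card_inE.
rewrite -sum1_count natr_sum -sumEFin [RHS]big_mkcond/=.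
by apply: eq_bigr => s _; rewrite diracE; case: (_ \in _).
Qed.

Let measurable_points B : measurable B -> measurable_fun setT (points ^~ B).
Proof.
move=> mB _ A mA; rewrite setTI.
rewrite (_ : _ @^-1` _ = card_in B @^-1` [set k | A (k%:R : R)%:E]).
  exact: measurable_card_in.
by apply/seteqP; split => N; rewrite /preimage/= pointsE.
Qed.

HB.instance Definition _ := isKernel.Build _ _ _ _ R points measurable_points.

Definition points_fst T (x : conf_space S * T) := points x.1.

Let measurable_points_fst d' (T : measurableType d') B : measurable B ->
  measurable_fun setT (fun x : conf_space S * T => points_fst x B).
Proof.
by move=> mB; apply: (measurableT_comp (measurable_points mB)).
Qed.

HB.instance Definition _ d' (T : measurableType d') :=
  isKernel.Build _ _ _ _ R (@points_fst T) (@measurable_points_fst d' T).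

Lemma measurable_points_xsection d' (T : measurableType d')
    (A : set ((conf_space S * T) * 'rV[R]_d)) : measurable A ->
  measurable_fun setT (fun x : conf_space S * T => points x.1 (xsection A x)).
Proof.
move=> mA; apply: (measurable_kernel_xsection (k := @points_fst T)) => // x.
by rewrite /points_fst pointsE ltry.
Qed.

Lemma measurable_exists_point (A : set (conf_space S * 'rV[R]_d)) :
  measurable A ->
  measurable [set N : conf_space S | exists2 s, s \in N & A (N, \val s)].
Proof.
move=> mA; rewrite (_ : mkset _ =
    (fun N => points N (xsection A N)) @^-1` [set~ 0%E]).
  rewrite -[X in measurable X]setTI; apply: measurable_kernel_xsection => //.
    by move=> N; rewrite pointsE ltry.
  exact: measurableC.
apply/seteqP; split => N /=; rewrite pointsE card_inE.
  move=> [s sN As] [] /eqP; rewrite pnatr_eq0 -leqn0 leqNgt -has_count.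
  by move/negP; apply; apply/hasP; exists s => //; rewrite inE xsectionE.
move=> h; have : (0 < count (fun s : S => \val s \in xsection A N) (enum_fset N))%N.
  by rewrite lt0n; apply/eqP => e; apply: h; rewrite e.
by rewrite -has_count => /hasP[s sN]; rewrite inE xsectionE; exists s.
Qed.

Definition lex_key (v : 'rV[R]_d) : seqlexi R := [seq v 0 i | i <- enum 'I_d].

Lemma lex_key_inj : injective lex_key.
Proof.
move=> u v /eq_in_map uv; apply/rowP => i; apply: uv.
by rewrite mem_enum.
Qed.

Lemma measurable_lex_lt d' (T : measurableType d') (f g : T -> 'rV[R]_d) :
  measurable_fun setT f -> measurable_fun setT g ->
  measurable [set x | (lex_key (f x) < lex_key (g x))%O].
Proof.
move=> mf mg; rewrite /lex_key; elim: (enum 'I_d) => [|i r IH].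
  by rewrite (_ : mkset _ = set0)// -subset0 => x /=.
have mfi : measurable_fun setT (fun x => f x 0 i).
  exact: (measurableT_comp (measurable_mx_coord 0 i)).
have mgi : measurable_fun setT (fun x => g x 0 i).
  exact: (measurableT_comp (measurable_mx_coord 0 i)).
rewrite (_ : mkset _ = [set x | f x 0 i <= g x 0 i] `&`
    (~` [set x | g x 0 i <= f x 0 i] `|`
     [set x | ([seq f x 0 i | i <- r] : seqlexi R) < [seq g x 0 i | i <- r]]%O)).
  apply: measurableI; first by rewrite -[X in measurable X]setTI; exact: measurable_fun_le.
  apply: measurableU => //; apply: measurableC.
  by rewrite -[X in measurable X]setTI; exact: measurable_fun_le.
apply/seteqP; split => x /=.
  rewrite ltxi_cons => /andP[fg /implyP h]; split => //.
  by case: (boolP (g x 0 i <= f x 0 i)) => [/h|/negP]; [right|left].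
move=> [fg h]; rewrite ltxi_cons fg/=; apply/implyP => gf.
by case: h.
Qed.

Lemma locsE (N : conf_space S) (i : 'I_#|` N|) :
  exists2 j : 'I_(size (sort (@lex_le R d S) (enum_fset N))), i = j :> nat &
    locs N 0 i = tnth (in_tuple (sort (@lex_le R d S) (enum_fset N))) j.
Proof.
have e : size (sort (@lex_le R d S) (enum_fset N)) = #|` N| by rewrite size_sort.
exists (cast_ord (esym e) i) => //; rewrite mxE (tnth_nth (locs N 0 i)).
by rewrite (tnth_nth (locs N 0 i)).
Qed.

Lemma mem_locs (N : conf_space S) i : locs N 0 i \in N.
Proof.
have [j _ ->] := locsE i; have := mem_tnth j (in_tuple (sort (@lex_le R d S) (enum_fset N))).
by rewrite mem_sort.
Qed.

Lemma locs_distinct (N : conf_space S) : distinct (locs N).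
Proof.
move=> i j; rewrite !mxE.
have /tuple_uniqP h : uniq [tuple of sort (@lex_le R d S) (in_tuple (enum_fset N))].
  by rewrite sort_uniq fset_uniq.
exact: h.
Qed.

Definition lex_rank (N : conf_space S) (x : 'rV[R]_d) : nat :=
  card_in [set y | (lex_key y < lex_key x)%O] N.

(** Distinct points have distinct keys, so the sorted keys increase strictly and exactly [i] of them
    precede the one at index [i]. *)
Lemma lex_rank_locs (N : conf_space S) i : lex_rank N (\val (locs N 0 i)) = i.
Proof.
have [j ij ->] := locsE i; rewrite ij /lex_rank card_inE.
set r := sort _ _ in j ij *; pose key (s : S) := lex_key (\val s).
have skey : sorted <%O [seq key s | s <- r].
  rewrite lt_sorted_uniq_le map_inj_uniq; last first.
    by move=> s t /lex_key_inj; exact: val_inj.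
  rewrite sort_uniq fset_uniq/= sorted_map; apply: sort_sorted.
  by move=> s t; exact: le_total.
have := @count_lt_nth _ _ ([::] : seqlexi R) _ j skey; rewrite size_map => /(_ (ltn_ord j)) <-.
rewrite count_map (_ : nth ([::] : seqlexi R) _ j = key (tnth (in_tuple r) j)); last first.
  by rewrite (tnth_nth (tnth (in_tuple r) j)) (nth_map (tnth (in_tuple r) j)).
rewrite -(permP (permEl (perm_sort (@lex_le R d S) (enum_fset N)))).
by apply: eq_count => s; apply/idP/idP; rewrite inE.
Qed.

(** Eliminates the labelling: a condition on the location of index [i] becomes one on some point of
    [N] of rank [i], hence on counts. *)
Lemma locs_existsP (N : conf_space S) (B : set 'rV[R]_d) i :
  B (\val (locs N 0 i)) <->
  exists2 s, s \in N & B (\val s) /\ lex_rank N (\val s) = i.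
Proof.
split => [h|[s sN [Bs si]]].
  by exists (locs N 0 i); [exact: mem_locs|rewrite lex_rank_locs].
have sr : s \in sort (@lex_le R d S) (enum_fset N) by rewrite mem_sort.
have e : size (sort (@lex_le R d S) (enum_fset N)) = #|` N| by rewrite size_sort.
have /tnthP[j sj] : s \in in_tuple (sort (@lex_le R d S) (enum_fset N)) by [].
have sl : s = locs N 0 (cast_ord e j).
  rewrite mxE sj (tnth_nth s) (tnth_nth s); by [].
suff <- : cast_ord e j = i by rewrite -sl.
by apply: val_inj; rewrite -[LHS]lex_rank_locs -sl.
Qed.

Section locations.
Variables (n : nat) (s0 : 'rV[S]_n).

(* [locs N] lives in a type depending on [N]; here it is cast to the fixed length
   [n], with a junk value on the configurations of any other size. *)
Definition locs_or (N : conf_space S) : 'rV[S]_n :=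
  if #|` N| =P n is ReflectT e then castmx (erefl, e) (locs N) else s0.

Lemma locs_orE N : forall e : #|` N| = n, locs_or N = castmx (erefl, e) (locs N).
Proof.
move=> e; rewrite /locs_or; case: eqP => // e'.
by rewrite (eq_irrelevance e e').
Qed.

Lemma locs_or_junk N : #|` N| <> n -> locs_or N = s0.
Proof. by move=> ne; rewrite /locs_or; case: eqP. Qed.

Lemma measurable_locs_or i (B : set 'rV[R]_d) : measurable B ->
  measurable [set N | B (\val (locs_or N 0 i))].
Proof.
move=> mB.
(* The pairs [(N, x)] with [x] in [B] preceded by exactly [i] points of [N]. *)
pose A := [set x : conf_space S * 'rV[R]_d | B x.2 /\
  points x.1 (xsection [set p : (conf_space S * 'rV[R]_d) * 'rV[R]_d |
    (lex_key p.2 < lex_key p.1.2)%O] x) = i%:R%:E].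
have mA : measurable A.
  apply: measurableI; first by rewrite -[X in measurable X]setTI; exact: measurable_snd.
  pose L := [set p : (conf_space S * 'rV[R]_d) * 'rV[R]_d |
    (lex_key p.2 < lex_key p.1.2)%O].
  have mL : measurable L.
    apply: measurable_lex_lt; first exact: measurable_snd.
    exact: (measurableT_comp measurable_snd measurable_fst).
  have := measurable_points_xsection mL.
  move=> /(_ measurableT [set i%:R%:E] (emeasurable_set1 _)); rewrite setTI.
  by [].
rewrite (_ : mkset _ =
  ([set N : conf_space S | [set n] #|` N|] `&`
    [set N : conf_space S | exists2 s, s \in N & A (N, \val s)]) `|`
  ([set N : conf_space S | (~` [set n]) #|` N|] `&`
    [set N | B (\val (s0 0 i))])).
  apply: measurableU; apply: measurableI.
  - exact: measurable_cardfs.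
  - exact: measurable_exists_point.
  - exact: measurable_cardfs.
  have [h|h] := pselect (B (\val (s0 0 i))).
    by rewrite (_ : mkset _ = setT)//; apply/seteqP; split.
  by rewrite (_ : mkset _ = set0)//; apply/seteqP; split.
have AE (N : conf_space S) s : A (N, \val s) <->
    B (\val s) /\ lex_rank N (\val s) = i.
  rewrite /A/= pointsE (_ : xsection _ _ = [set y | (lex_key y < lex_key (\val s))%O]).
    split=> -[Bs h]; split => //; last by rewrite -h.
    by case: h => /eqP; rewrite eqr_nat => /eqP.
  by apply/seteqP; split => y; rewrite xsectionE.
have key (N : conf_space S) (e : #|` N| = n) : B (\val (locs_or N 0 i)) <->
    exists2 s, s \in N & A (N, \val s).
  have -> : locs_or N 0 i = locs N 0 (cast_ord (esym e) i).
    by rewrite (locs_orE e) castmxE/= cast_ord_id.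
  rewrite (locs_existsP B (cast_ord (esym e) i)).
  by split => -[s sN h]; exists s => //; apply/AE.
apply/seteqP; split => N /=.
  have [e|ne] := pselect (#|` N| = n).
    by move=> h; left; split => //; apply/(key N e).
  by rewrite locs_or_junk//; right.
move=> [[e h]|[ne h]]; first by apply/(key N e).
by rewrite locs_or_junk.
Qed.

End locations.

End points.

(** * The Poisson process *)

Section density_measure.
Variables (d : measure_display) (T : measurableType d) (R : realType).
Variables (mu : {measure set T -> \bar R}) (f : T -> R).
Hypotheses (mf : measurable_fun setT f) (f0 : forall x, 0 <= f x).
Local Open Scope ereal_scope.

(** As for [image_measure], the proofs are carried as arguments so that the measure structure can be
    inferred. *)
Definition density_measure (_ : measurable_fun setT f)
  (_ : forall x, (0 <= f x)%R) (A : set T) := \int[mu]_(x in A) (f x)%:E.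
Local Notation dm := (density_measure mf f0).

Let density_measure0 : dm set0 = 0.
Proof. exact: integral_set0. Qed.
Let density_measure_ge0 A : 0 <= dm A.
Proof. by apply: integral_ge0 => x _; rewrite lee_fin. Qed.
Let density_measure_semi_sigma_additive : semi_sigma_additive dm.
Proof.
move=> F mF tF mUF; rewrite /density_measure ge0_integral_bigcup//.
- apply: is_cvg_ereal_nneg_natsum_cond => n _ _.
  by apply: integral_ge0 => x _; rewrite lee_fin.
- by apply/measurable_EFinP; exact: measurable_funTS.
- by move=> x _; rewrite lee_fin.
Qed.
HB.instance Definition _ := isMeasure.Build _ _ _ dm
  density_measure0 density_measure_ge0 density_measure_semi_sigma_additive.
End density_measure.

Section nat_measure.
Variables (d : measure_display) (T : measurableType d) (R : realType).
Variable mu : {measure set T -> \bar R}.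
Local Open Scope ereal_scope.

Lemma le_measure_null (A B N : set T) : measurable A -> measurable B ->
  measurable N -> mu N = 0 -> A `<=` B `|` N -> mu A <= mu B.
Proof.
move=> mA mB mN N0 AB; apply: (@le_trans _ _ (mu (B `|` N))).
  by apply: le_measure; rewrite ?inE//; exact: measurableU.
have h : mu (B `|` N) <= mu B + mu N := measureU2 mu mB mN.
by rewrite N0 adde0 in h.
Qed.

Lemma measure_bigcup_finType (I : finType) (F : I -> set T) :
  trivIset setT F -> (forall i, measurable (F i)) ->
  mu (\bigcup_i F i) = \sum_i mu (F i).
Proof.
move=> tF mF; rewrite measure_fin_bigcup//; last exact: finite_finset.
rewrite -[RHS]big_enum/= [RHS]fsbig_seq ?enum_uniq//.
rewrite (_ : [set` enum I] = setT)//.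
by apply/seteqP; split => i //= _; rewrite mem_enum.
Qed.

Lemma measure_preimage_nat (f : T -> nat) (E : set T) (A : set nat) :
  (forall k, measurable (E `&` f @^-1` [set k])) ->
  mu (E `&` f @^-1` A) = \sum_(k <oo | k \in A) mu (E `&` f @^-1` [set k]).
Proof.
move=> mf; rewrite -measure_bigcup//.
  congr (mu _); apply/seteqP; split => x /=; first by move=> [Ex Ax]; exists (f x).
  by move=> [k Ak [Ex /= ->]].
by move=> i j _ _ [x [[_ /= <-] [_ /= <-]]].
Qed.

End nat_measure.

Section poisson_prob.
Variable R : realType.
Local Open Scope ereal_scope.

(** At [v = 0] the law is the Dirac mass at 0, and the formula agrees because [0 ^+ 0 = 1]. *)
Lemma poisson_prob1 (v : R) k : (0 <= v)%R ->
  poisson_prob v 0 [set k] = (v ^+ k / k`!%:R * expR (- v))%:E.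
Proof.
rewrite le_eqVlt => /predU1P[<-|v0]; rewrite /poisson_prob.
  rewrite ltxx diracE oppr0 expR0 mulr1; case: k => [|k].
    by rewrite mem_set// expr0 divr1.
  by rewrite memNset// expr0n mul0r.
by rewrite v0 esum_set1 /poisson_pmf ?v0// lee_fin mulr_ge0 ?expR_ge0// divr_ge0// exprn_ge0// ltW.
Qed.

Lemma poisson_prob_sum (v : R) (A : set nat) :
  poisson_prob v 0 A = \sum_(k <oo | k \in A) poisson_prob v 0 [set k].
Proof.
have := @measure_preimage_nat _ _ R (poisson_prob v 0) id setT A.
by rewrite setTI => ->//; apply: eq_eseriesr => k _; rewrite setTI.
Qed.

Lemma poisson_prob_setT (v : R) : poisson_prob v 0 setT = 1.
Proof. exact: probability_setT. Qed.

End poisson_prob.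

Section poisson_law.
Variables (R : realType) (d : nat) (S : set 'rV[R]_d).
Hypothesis cS : compact S.
Local Open Scope ereal_scope.

(** The new point is drawn in the whole of [R^d], where the intensity measure lives; a draw outside
    [S] has probability zero and is ignored. *)
Definition insert (p : conf_space S * 'rV[R]_d) : conf_space S :=
  if pselect (S p.2) is left h then (SigSub (mem_set h) |` p.1)%fset else p.1.

Definition mem_conf (p : conf_space S * 'rV[R]_d) : Prop :=
  exists2 s, s \in p.1 & \val s = p.2.

Lemma measurable_mem_conf : measurable [set p | mem_conf p].
Proof.
pose D := [set q : (conf_space S * 'rV[R]_d) * 'rV[R]_d | q.2 = q.1.2].
have mD : measurable D.
  (* The lexicographic order is total, so the diagonal is the complement of two strict
     comparisons. *)
  rewrite (_ : D = ~` ([set q | (lex_key q.2 < lex_key q.1.2)%O] `|`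
     [set q | (lex_key q.1.2 < lex_key q.2)%O])).
    apply: measurableC; apply: measurableU; apply: measurable_lex_lt => //.
    - exact: (measurableT_comp measurable_snd measurable_fst).
    - exact: (measurableT_comp measurable_snd measurable_fst).
  apply/seteqP; split => -[[N x] y]; rewrite /D/=.
    by move=> ->; case; rewrite ltxx.
  move=> /not_orP[/negP h1 /negP h2]; apply: lex_key_inj; apply/eqP.
  by rewrite eq_le !leNgt h1 h2.
rewrite (_ : mkset _ = (fun p => points p.1 (xsection D p)) @^-1` [set~ 0]).
  rewrite -[X in measurable X]setTI; apply: (measurable_points_xsection cS mD) => //.
  exact: measurableC.
apply/seteqP; split => -[N x] /=; rewrite pointsE card_inE.
  move=> [s sN /= sx] [] /eqP; rewrite pnatr_eq0 -leqn0 leqNgt -has_count.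
  by move/negP; apply; apply/hasP; exists s => //; rewrite inE xsectionE.
move=> h; have : (0 < count (fun s : S => \val s \in xsection D (N, x)) (enum_fset N))%N.
  by rewrite lt0n; apply/eqP => e; apply: h; rewrite e.
by rewrite -has_count => /hasP[s sN]; rewrite inE xsectionE => sx; exists s.
Qed.

Lemma card_in_insert (B : set 'rV[R]_d) N x : ~ mem_conf (N, x) -> S x ->
  card_in B (insert (N, x)) = (card_in B N + (x \in B))%N.
Proof.
move=> xN Sx; rewrite /insert/=; case: pselect => // Sx'.
set s := SigSub _; have sN : s \notin N.
  by apply/negP => sN; apply: xN; exists s.
rewrite !card_inE (_ : count _ _ = count (fun s : S => \val s \in B) (s :: enum_fset N)).
  by rewrite /= addnC.
apply/permP; apply: uniq_perm; rewrite /= ?fset_uniq ?andbT//.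
by move=> t; rewrite in_cons; exact: in_fset1U.
Qed.

Lemma card_in_insert_mem (B : set 'rV[R]_d) N x : mem_conf (N, x) \/ ~ S x ->
  card_in B (insert (N, x)) = card_in B N.
Proof.
rewrite /insert/=; case: pselect => // Sx' [[s sN /= sx]|//].
rewrite (_ : (_ |` N)%fset = N)//; apply/fsetP => t; rewrite !inE.
have -> : SigSub (mem_set Sx') = s by apply: val_inj.
by case: eqP => // ->; rewrite sN.
Qed.

Lemma measurable_insert : measurable_fun setT insert.
Proof.
apply: (@measurability _ _ _ _ setT insert (@counting_sets R d S)) => //.
move=> _ [_ [B [k [mB BS ->]]] <-]; rewrite setTI.
(* On [Z] the configuration is unchanged; off [Z] the count in [B] grows by one exactly when the new
   point is in [B]. *)
pose Z := [set p : conf_space S * 'rV[R]_d | mem_conf p] `|` [set p | ~ S p.2].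
have mS := measurable_state_space cS.
have m2 (D : set 'rV[R]_d) : measurable D ->
    measurable [set p : conf_space S * 'rV[R]_d | D p.2].
  by move=> mD; rewrite -[X in measurable X]setTI; exact: measurable_snd.
have mZ : measurable Z.
  apply: measurableU; first exact: measurable_mem_conf.
  exact: (m2 _ (measurableC mS)).
have mc j : measurable [set p : conf_space S * 'rV[R]_d | card_in B p.1 = j].
  have h := measurable_card_in cS [set j] mB.
  by have := @measurable_fst _ _ (conf_space S) 'rV[R]_d measurableT _ h; rewrite setTI.
rewrite (_ : _ @^-1` _ = (Z `&` [set p | card_in B p.1 = k]) `|`
  (~` Z `&` ([set p | B p.2] `&` [set p | (card_in B p.1).+1 = k] `|`
     ~` [set p | B p.2] `&` [set p | card_in B p.1 = k]))).
  apply: measurableU; apply: measurableI => //; first exact: measurableC.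
  apply: measurableU; apply: measurableI => //; [exact: m2| |apply: measurableC; exact: m2].
  case: k => [|k]; first by rewrite (_ : mkset _ = set0)// -subset0 => p.
  rewrite (_ : mkset _ = [set p | card_in B p.1 = k])//.
  by apply/seteqP; split => p /=; [case|move=> ->].
apply/seteqP; split => -[N x] /=.
  have [z|nz] := pselect (Z (N, x)).
    by rewrite card_in_insert_mem => [<-|]; [left|].
  have [/= xN Sx] : ~ mem_conf (N, x) /\ S x.
    by split; [move=> h; apply: nz; left|apply: contrapT => h; apply: nz; right].
  rewrite card_in_insert// => <-; right; split => //.
  have [xB|xB] := pselect (B x); first by left; rewrite mem_set// addn1.
  by right; rewrite memNset// addn0.
move=> [[z <-]|[nz h]]; first by rewrite card_in_insert_mem.
have [/= xN Sx] : ~ mem_conf (N, x) /\ S x.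
  by split; [move=> h'; apply: nz; left|apply: contrapT => h'; apply: nz; right].
rewrite card_in_insert//; case: h => -[xB <-].
  by rewrite mem_set// addn1.
by rewrite memNset// addn0.
Qed.

End poisson_law.

(** * Adding independent points and multinomial counts *)

Section superposition.
Variables (R : realType) (d : nat) (S : set 'rV[R]_d).
Hypothesis cS : compact S.
Variable nu : {finite_measure set 'rV[R]_d -> \bar R}.
Hypothesis nuS : nu (~` S) = 0%E.
Hypothesis nu1 : forall x, nu [set x] = 0%E.
Local Open Scope ereal_scope.

Section step.
Variable mu : {finite_measure set (conf_space S) -> \bar R}.

Definition add_point := image_measure (mu \x nu) (measurable_insert cS).

HB.instance Definition _ := Measure.on add_point.

Let add_point_finite : fin_num_fun add_point.
Proof.
move=> A mA; have mA' := measurable_insert cS measurableT mA; rewrite setTI in mA'.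
rewrite ge0_fin_numE ?measure_ge0//.
have h : (mu \x nu) (@insert R d S @^-1` A) <= (mu \x nu) setT.
  by apply: le_measure; rewrite ?inE.
apply: (le_lt_trans h).
by rewrite -setXTT product_measure1E// lte_mul_pinfty// ?ltey_eq ?fin_num_measure.
Qed.

HB.instance Definition _ :=
  Measure_isFinite.Build _ _ _ add_point add_point_finite.

Lemma add_pointE A : measurable A -> add_point A = (mu \x nu) (@insert R d S @^-1` A).
Proof. by []. Qed.

(* [insert] fails to increase the counts on this set, which is null. *)
Let bad := [set p : conf_space S * 'rV[R]_d | mem_conf p \/ ~ S p.2].

Let measurable_bad : measurable bad.
Proof.
apply: measurableU; first exact: measurable_mem_conf.
have h := measurableC (measurable_state_space cS).
by have := @measurable_snd _ _ (conf_space S) 'rV[R]_d measurableT _ h; rewrite setTI.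
Qed.

Let measurable_point (x : 'rV[R]_d) : measurable [set x].
Proof.
rewrite -[[set x]]setCK; apply: measurableC; apply: sub_sigma_algebra.
apply: closed_openC; apply: accessible_closed_set1; apply: hausdorff_accessible.
exact: norm_hausdorff.
Qed.

Let set_mem_cons (x : 'rV[R]_d) r : [set` x :: r] = [set x] `|` [set` r].
Proof.
apply/seteqP; split => y /=; rewrite inE.
  by case/predU1P => [->|]; [left|right].
by case=> [->|->]; rewrite ?eqxx ?orbT.
Qed.

Let measurable_points (r : seq 'rV[R]_d) : measurable [set` r].
Proof.
elim: r => [|x r IH]; first by rewrite set_nil.
by rewrite set_mem_cons; exact: measurableU.
Qed.

Let nu_points (r : seq 'rV[R]_d) : nu [set` r] = 0.
Proof.
elim: r => [|x r IH]; first by rewrite set_nil measure0.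
apply/eqP; rewrite eq_le measure_ge0 andbT set_mem_cons.
have h : nu ([set x] `|` [set` r]) <= nu [set x] + nu [set` r].
  exact: measureU2.
by rewrite nu1 IH adde0 in h.
Qed.

(** For fixed [N], a bad point is one of the finitely many points of [N], null since [nu] has no
    atoms, or lies outside [S]. *)
Let bad0 : (mu \x nu) bad = 0.
Proof.
rewrite /product_measure1 (eq_integral (cst 0)) ?integral_cst ?mul0e// => N _ /=.
apply/eqP; rewrite eq_le measure_ge0 andbT.
pose r : seq 'rV[R]_d := [seq \val s | s <- enum_fset N].
have mS := measurableC (measurable_state_space cS).
have h : nu ([set` r] `|` ~` S) <= nu [set` r] + nu (~` S) by exact: measureU2.
rewrite nu_points nuS adde0 in h; apply: le_trans h.
apply: le_measure; rewrite ?inE; [exact: measurable_xsection|exact: measurableU|].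
move=> x; rewrite xsectionE/= => -[[s sN /= <-]|]; [left|by right].
by rewrite /=; apply/mapP; exists s.
Qed.

Variables (C : finType) (c : 'rV[R]_d -> C).
Hypothesis mc : forall t, measurable (c @^-1` [set t]).

(** A finite measurable partition is encoded as a colouring [c], whose cells are the preimages of
    the colours. *)
Definition colour_counts (a : {ffun C -> nat}) : set (conf_space S) :=
  [set N | forall t, card_in (c @^-1` [set t]) N = a t].

Lemma measurable_colour_counts a : measurable (colour_counts a).
Proof.
rewrite (_ : colour_counts a =
    \bigcap_(t in [set: C]) card_in (c @^-1` [set t]) @^-1` [set a t]).
  apply: fin_bigcap_measurable => [|t _]; first exact: finite_finset.
  exact: measurable_card_in.
by apply/seteqP; split => N /= h t; [move=> _|]; exact: h.
Qed.

Definition decr (a : {ffun C -> nat}) t := [ffun u => (a u - (u == t))%N].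

(** Up to the null set [bad], the new configuration has counts [a] exactly when, for the colour [t]
    of the new point, [a t] is positive and the old counts are [decr a t]. These cases are disjoint
    over [t]. *)
Lemma add_point_colour_counts a :
  add_point (colour_counts a) =
  \sum_t (if (0 < a t)%N then mu (colour_counts (decr a t)) * nu (c @^-1` [set t])
          else 0).
Proof.
rewrite add_pointE; last exact: measurable_colour_counts.
pose F t : set (conf_space S * 'rV[R]_d) := if (0 < a t)%N then
  colour_counts (decr a t) `*` (c @^-1` [set t]) else set0.
have mF t : measurable (F t).
  rewrite /F; case: ifP => // _; apply: measurableX => //.
  exact: measurable_colour_counts.
have tF : trivIset setT F.
  move=> t u _ _ [[N x] [Ft Fu]]; move: Ft Fu; rewrite /F.
  by case: ifP => // _ [_ <-]; case: ifP => // _ [_ <-].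
have mins : measurable (@insert R d S @^-1` colour_counts a).
  have := measurable_insert cS measurableT (measurable_colour_counts a).
  by rewrite setTI.
have mUF : measurable (\bigcup_t F t).
  by apply: fin_bigcup_measurable => //; exact: finite_finset.
have good (N0 : conf_space S) x0 : ~ bad (N0, x0) ->
    (colour_counts a (insert (N0, x0)) <-> (\bigcup_t F t) (N0, x0)).
  move: N0 x0 => N x nb; have [xN Sx] : ~ mem_conf (N, x) /\ S x.
    by split; [move=> h; apply: nb; left|apply: contrapT => h; apply: nb; right].
  have ci t : card_in (c @^-1` [set t]) (insert (N, x)) =
      (card_in (c @^-1` [set t]) N + (t == c x))%N.
    rewrite card_in_insert//; congr (_ + nat_of_bool _)%N.
    by apply/idP/eqP; rewrite inE.
  split.
    move=> h; exists (c x) => //; rewrite /F.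
    have := h (c x); rewrite ci eqxx addn1 => ax; rewrite -ax/=; split => //= t.
    by rewrite /= ffunE -(h t) ci addnK.
  move=> [t _]; rewrite /F; case: ifP => // at0 [/= hN cx] u.
  rewrite ci (hN u) ffunE cx; case: eqP => [->|_]; last by rewrite subn0 addn0.
  by rewrite subnK.
transitivity ((mu \x nu) (\bigcup_t F t)).
  apply/eqP; rewrite eq_le; apply/andP; split.
    apply: (le_measure_null mins mUF measurable_bad bad0) => -[N x] h.
    by have [b|/good nb] := pselect (bad (N, x)); [right|left; apply/nb].
  apply: (le_measure_null mUF mins measurable_bad bad0) => -[N x] h.
  by have [b|/good nb] := pselect (bad (N, x)); [right|left; apply/nb].
rewrite measure_bigcup_finType//; apply: eq_bigr => t _; rewrite /F.
case: ifP => _; last by rewrite measure0.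
by apply: product_measure1E => //; exact: measurable_colour_counts.
Qed.

End step.

(** Points are added with the unnormalised [nu], so the total mass is the [n]-th power of that of
    [nu]. A zero intensity is thereby covered without division by its mass. *)
Fixpoint superposition n : {finite_measure set (conf_space S) -> \bar R} :=
  if n is n'.+1 then add_point (superposition n') else \d_(fset0 : conf_space S).

Section colour.
Variables (C : finType) (c : 'rV[R]_d -> C).
Hypothesis mc : forall t, measurable (c @^-1` [set t]).
Let v t : R := fine (nu (c @^-1` [set t])).

Lemma superposition_colour_counts n a :
  superposition n (colour_counts c a) =
  (if (\sum_t a t == n)%N then n`!%:R * \prod_t (v t ^+ a t / (a t)`!%:R) else 0)%:E.
Proof.
elim: n a => [|n IH] a /=.
  rewrite diracE fact0 mul1r; case: eqP => [/eqP|] a0.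
    have {}a0 t : a t = 0%N.
      by move: a0; rewrite sum_nat_eq0 => /forallP/(_ t)/eqP.
    rewrite mem_set; last by move=> t; rewrite card_inE a0.
    by rewrite big1// => t _; rewrite a0 expr0 divr1.
  rewrite memNset// => h; apply: a0; rewrite big1// => t _.
  by rewrite -(h t) card_inE.
rewrite add_point_colour_counts//.
(* The colour [t] of the last point contributes the target product times [n!] and [a t]. The [a t]
   add up to [n + 1], which turns [n!] into the next factorial. *)
transitivity (\sum_t (if (\sum_t a t == n.+1)%N then
    n`!%:R * (a t)%:R * \prod_u (v u ^+ a u / (a u)`!%:R) else 0)%:E)%E.
  apply: eq_bigr => t _; case: ifPn => [at0|]; last first.
    by rewrite -eqn0Ngt => /eqP ->; case: ifP => // _; rewrite mulr0 mul0r.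
  rewrite IH -(fineK (fin_num_measure nu _ (mc t))) -/(v t) -EFinM; congr EFin.
  have -> : (\sum_u decr a t u == n)%N = (\sum_u a u == n.+1)%N.
    rewrite (bigD1 t)//= [in RHS](bigD1 t)//= ffunE eqxx.
    rewrite (eq_bigr a) => [|u /negbTE ut]; last by rewrite ffunE ut subn0.
    by rewrite -[in RHS](subnK at0) addn1 addSn eqSS.
  case: ifP => _; last by rewrite mul0r.
  rewrite -!mulrA; congr (_ * _)%R.
  rewrite (bigD1 t)//= [in RHS](bigD1 t)//= ffunE eqxx.
  rewrite (eq_bigr (fun u => v u ^+ a u / (a u)`!%:R)%R); last first.
    by move=> u /negbTE ut; rewrite ffunE ut subn0.
  rewrite mulrAC !mulrA; congr (_ * _)%R; case: (a t) at0 => // k _.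
  rewrite subn1/= factS natrM exprS invfM; field.
  by rewrite pnatr_eq0 -lt0n fact_gt0/= addrC natr1 pnatr_eq0.
rewrite sumEFin; congr EFin; case: eqP => [an|_]; last by rewrite big1.
rewrite -big_distrl/= -big_distrr/= factS natrM -an natr_sum.
by rewrite [in RHS](mulrC _ n`!%:R).
Qed.

End colour.
End superposition.

(** * The Poisson mixture and its independent counts *)

Section poisson_configuration.
Variables (R : realType) (d : nat) (S : set 'rV[R]_d).
Hypothesis cS : compact S.
Variable nu : {finite_measure set 'rV[R]_d -> \bar R}.
Hypothesis nuS : nu (~` S) = 0%E.
Hypothesis nu1 : forall x, nu [set x] = 0%E.
Local Open Scope ereal_scope.

(** The Poisson weight without its power of the total mass, which is already the mass of
    [superposition n]. *)
Let weight n : {nonneg R} :=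
  NngNum (divr_ge0 (expR_ge0 (- fine (nu setT))) (ler0n R n`!)).

Definition poisson_conf : set (conf_space S) -> \bar R :=
  mseries (fun n => mscale (weight n) (superposition cS nu n)) 0.

HB.instance Definition _ := Measure.on poisson_conf.

Let poisson_prob_fin (r : R) (A : set nat) : poisson_prob r 0 A \is a fin_num.
Proof. by apply: (@fin_num_measure _ _ _ (poisson_prob r 0)). Qed.

Section colour.
Variables (C : finType) (c : 'rV[R]_d -> C).
Hypothesis mc : forall t, measurable (c @^-1` [set t]).
Let v t : R := fine (nu (c @^-1` [set t])).
Let v0 t : (0 <= v t)%R. Proof. exact: fine_ge0. Qed.

Let sum_v : (\sum_t v t)%R = fine (nu setT).
Proof.
have -> : setT = \bigcup_t c @^-1` [set t].
  by apply/seteqP; split => x //= _; exists (c x).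
rewrite measure_bigcup_finType//; last first.
  by move=> t u _ _ [x [/= <- <-]].
by rewrite sum_fine// => t _; exact: fin_num_measure.
Qed.

(** Only the term with [n] the total count survives. Its factorial cancels that of the weight, and
    the exponential splits over the colours because the cell masses add up to the total mass. *)
Lemma poisson_conf_colour_counts a :
  poisson_conf (colour_counts c a) = \prod_t poisson_prob (v t) 0 [set a t].
Proof.
rewrite /poisson_conf /mseries (nneseriesD1 (n := (\sum_t a t)%N))//.
rewrite eseries0 ?adde0; last first.
  move=> n _ /= na; rewrite /mscale/= superposition_colour_counts//.
  by rewrite eq_sym (negbTE na) mule0.
set n := (\sum_t a t)%N.
transitivity ((weight n)%:num%:E * superposition cS nu n (colour_counts c a)) => //.
rewrite superposition_colour_counts// eqxx.
under [RHS] eq_bigr do rewrite poisson_prob1//.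
rewrite prodEFin -EFinM; congr EFin.
rewrite [RHS]big_split/= -expR_sum sumrN sum_v [RHS]mulrC mulrA; congr (_ * _)%R.
by rewrite divfK// pnatr_eq0 -lt0n fact_gt0.
Qed.

Lemma poisson_conf_counts (A : C -> set nat) :
  poisson_conf [set N | forall t, A t (card_in (c @^-1` [set t]) N)] =
  \prod_t poisson_prob (v t) 0 (A t).
Proof.
pose cnt t (N : conf_space S) := card_in (c @^-1` [set t]) N.
(* Exact counts are released one colour at a time: colours in [r] are constrained by [A], the others
   still by [a]. Each release sums over the values of one count. *)
pose U (r : seq C) (a : {ffun C -> nat}) t := if t \in r then A t else [set a t].
have mcnt t (D : set nat) : measurable (cnt t @^-1` D) by exact: measurable_card_in.
suff key (r : seq C) : uniq r -> forall a,
    poisson_conf [set N | forall t, U r a t (cnt t N)] =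
    \prod_t poisson_prob (v t) 0 (U r a t).
  have := key (enum C) (enum_uniq _) [ffun=> 0%N].
  rewrite (eq_bigr (fun t => poisson_prob (v t) 0 (A t))).
    move=> <-; congr (poisson_conf _); apply/seteqP; split => N /= h t; have := h t;
    by rewrite /U mem_enum.
  by move=> t _; rewrite /U mem_enum.
elim: r => [_ a|t0 r IH /= /andP[t0r ur] a].
  exact: poisson_conf_colour_counts.
pose E := [set N : conf_space S | forall t, t != t0 -> U r a t (cnt t N)].
pose up k : {ffun C -> nat} := [ffun t => if t == t0 then k else a t].
have Uup k t : t != t0 -> U r (up k) t = U r a t.
  by rewrite /U /up ffunE => /negbTE ->.
have Uup0 k : U r (up k) t0 = [set k].
  by rewrite /U (negbTE t0r) ffunE eqxx.
have Ek k : E `&` cnt t0 @^-1` [set k] = [set N | forall t, U r (up k) t (cnt t N)].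
  apply/seteqP; split => N /=.
    move=> [EN Nk] t; have [->|tt0] := eqVneq t t0; first by rewrite Uup0.
    by rewrite Uup//; exact: EN.
  move=> h; split; last by have := h t0; rewrite Uup0.
  by move=> t tt0; have := h t; rewrite Uup.
have mU r' a' : measurable [set N : conf_space S | forall t, U r' a' t (cnt t N)].
  rewrite (_ : mkset _ = \bigcap_(t in [set: C]) cnt t @^-1` (U r' a' t)).
    by apply: fin_bigcap_measurable => //; exact: finite_finset.
  by apply/seteqP; split => N /= h t; [move=> _|]; exact: h.
have -> : [set N | forall t, U (t0 :: r) a t (cnt t N)] = E `&` cnt t0 @^-1` (A t0).
  apply/seteqP; split => N /=.
    move=> h; split; last by have := h t0; rewrite /U inE eqxx.
    by move=> t tt0; have := h t; rewrite /U inE (negbTE tt0).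
  move=> [EN N0] t; rewrite /U inE; have [->//|tt0] := eqVneq t t0.
  exact: EN.
rewrite measure_preimage_nat; last by move=> k; rewrite Ek.
pose K := (\prod_(t | t != t0) fine (poisson_prob (v t) 0 (U r a t)))%R.
rewrite (eq_eseriesr (g := fun k => K%:E * poisson_prob (v t0) 0 [set k])); last first.
  move=> k _; rewrite Ek; apply: (eq_trans (IH ur (up k))).
  rewrite (bigD1 t0)//= Uup0 muleC; congr (_ * _).
  rewrite /K -prodEFin; apply: eq_bigr => t tt0.
  by rewrite Uup// fineK.
rewrite nneseriesZl -?poisson_prob_sum; last by move=> k _; exact: measure_ge0.
rewrite [RHS](bigD1 t0)//= /U inE eqxx/= muleC; congr (_ * _).
rewrite /K -prodEFin; apply: eq_bigr => t tt0.
by rewrite inE (negbTE tt0)/= fineK.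
Qed.

End colour.

Let poisson_conf_setT : poisson_conf setT = 1.
Proof.
have := @poisson_conf_counts unit (fun=> tt) _ (fun=> setT).
rewrite (_ : [set N | _] = setT); last by apply/seteqP; split.
rewrite (eq_bigr (fun=> 1)) => [|t _]; last exact: poisson_prob_setT.
rewrite big1// => -> // -[].
by rewrite (_ : _ @^-1` _ = setT)//; apply/seteqP; split.
Qed.

HB.instance Definition _ :=
  Measure_isProbability.Build _ _ _ poisson_conf poisson_conf_setT.

Definition poisson_conf_prob : probability (conf_space S) R := poisson_conf.

Lemma poisson_conf_card_in (B : set 'rV[R]_d) (A : set nat) : measurable B ->
  poisson_conf_prob [set N | A (card_in B N)] = poisson_prob (fine (nu B)) 0 A.
Proof.
move=> mB; pose c (x : 'rV[R]_d) : bool := x \in B.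
have cB : c @^-1` [set true] = B.
  by apply/seteqP; split => x /=; rewrite /c; [move/set_mem|move/mem_set].
have cB' : c @^-1` [set false] = ~` B.
  by apply/seteqP; split => x /=; rewrite /c; [move/negbT; rewrite notin_setE|exact: memNset].
have mc t : measurable (c @^-1` [set t]).
  by case: t; rewrite ?cB ?cB'//; exact: measurableC.
have := poisson_conf_counts mc (fun b => if b then A else setT).
rewrite big_bool/= cB poisson_prob_setT mule1 => <-; congr (poisson_conf _).
apply/seteqP; split => N /=; first by move=> h [|]//; rewrite cB.
by move=> /(_ true); rewrite cB.
Qed.

Lemma poisson_conf_independent k (B : 'I_k -> set 'rV[R]_d) (A : 'I_k -> set nat) :
  (forall i, measurable (B i)) -> trivIset setT B ->
  poisson_conf_prob [set N | forall i, A i (card_in (B i) N)] =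
  \prod_i poisson_prob (fine (nu (B i))) 0 (A i).
Proof.
(* The colour [None] marks the complement of all the [B i], on which no condition is put. *)
move=> mB tB; pose c (x : 'rV[R]_d) : option 'I_k := [pick i | x \in B i].
have cB i : c @^-1` [set Some i] = B i.
  apply/seteqP; split => x /=; rewrite /c; case: pickP => //.
  - by move=> j; rewrite inE => Bj [<-].
  - move=> j; rewrite inE => Bj Bi; congr Some.
    by apply: (tB _ _ I I); exists x.
  - by move=> h Bi; have := h i; rewrite mem_set.
have mc t : measurable (c @^-1` [set t]).
  case: t => [i|]; first by rewrite cB.
  rewrite (_ : _ @^-1` _ = ~` \bigcup_i B i).
    by apply: measurableC; apply: fin_bigcup_measurable => //; exact: finite_finset.
  apply/seteqP; split => x /=; rewrite /c; case: pickP => //.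
  - by move=> h _ [i _ Bi]; have := h i; rewrite mem_set.
  - by move=> i; rewrite inE => Bi h; exfalso; apply: h; exists i.
have := poisson_conf_counts mc (fun t => if t is Some i then A i else setT).
rewrite (bigD1 None)//= poisson_prob_setT mul1e (reindex_omap Some id)/=; last by case.
rewrite (eq_bigl xpredT); last by move=> i; rewrite eqxx.
under eq_bigr do rewrite cB.
move=> <-; congr (poisson_conf _); apply/seteqP; split => N /=.
  by move=> h [i|]//; rewrite cB.
by move=> h i; have := h (Some i); rewrite cB.
Qed.

End poisson_configuration.

(** * The hierarchical law *)

Section const_kernel.
Variables (d d' : measure_display) (X : measurableType d) (Y : measurableType d').
Variables (R : realType) (m : probability Y R).

Definition const_kernel (_ : X) : {measure set Y -> \bar R} := m.

Let measurable_const_kernel U : measurable U ->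
  measurable_fun setT (const_kernel ^~ U).
Proof. by move=> mU; exact: measurable_cst. Qed.
HB.instance Definition _ :=
  isKernel.Build _ _ _ _ R const_kernel measurable_const_kernel.

Let const_kernel_setT x : const_kernel x setT = 1%E.
Proof. exact: probability_setT. Qed.
HB.instance Definition _ :=
  Kernel_isProbability.Build _ _ _ _ R const_kernel const_kernel_setT.
End const_kernel.

Section snd_kernel.
Variables (d d' d'' : measure_display) (W : measurableType d'').
Variables (X : measurableType d) (Y : measurableType d') (R : realType).
Variable k : R.-pker X ~> Y.

Definition snd_kernel (p : W * X) : {measure set Y -> \bar R} := k p.2.

Let measurable_snd_kernel U : measurable U ->
  measurable_fun setT (snd_kernel ^~ U).
Proof.
by move=> mU; exact: (measurableT_comp (measurable_kernel k U mU) measurable_snd).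
Qed.
HB.instance Definition _ :=
  isKernel.Build _ _ _ _ R snd_kernel measurable_snd_kernel.

Let snd_kernel_setT x : snd_kernel x setT = 1%E.
Proof. exact: prob_kernel. Qed.
HB.instance Definition _ :=
  Kernel_isProbability.Build _ _ _ _ R snd_kernel snd_kernel_setT.
End snd_kernel.

Section mixture.
Variables (d d' : measure_display) (X : measurableType d) (Y : measurableType d').
Variables (R : realType) (m : probability X R) (k : R.-pker X ~> Y).
Local Open Scope ereal_scope.

(* [kcomp] composes kernels, the second one depending on both previous stages; a
   one-point initial space makes it the mixture of [k] under [m]. *)
Definition mixture : set Y -> \bar R :=
  kcomp (const_kernel (X := unit) m) (snd_kernel (W := unit) k) tt.

HB.instance Definition _ := Measure.on mixture.

Lemma mixtureE U : mixture U = \int[m]_x k x U.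
Proof. by []. Qed.

Let mixture_setT : mixture setT = 1.
Proof.
rewrite mixtureE (eq_integral (cst 1)) => [|x _]; last exact: prob_kernel.
by rewrite integral_cst// mul1e; exact: probability_setT.
Qed.
HB.instance Definition _ := Measure_isProbability.Build _ _ _ mixture mixture_setT.

Lemma ge0_integral_mixture (h : Y -> \bar R) : (forall y, 0 <= h y) ->
  measurable_fun setT h -> \int[mixture]_y h y = \int[m]_x \int[k x]_y h y.
Proof.
by move=> h0 mh; exact: (integral_kcomp (const_kernel m) (snd_kernel k) tt h0 mh).
Qed.
End mixture.

(** * The intensity as a finite measure without atoms *)

Section intensity_measure.
Variables (R : realType) (d : nat) (S : set 'rV[R]_d) (lam : 'rV[R]_d -> R).
Hypotheses (d0 : (0 < d)%N) (cS : compact S) (hlam : intensity S lam).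
Local Open Scope ereal_scope.

(** The point lies in a slab over its first coordinate, of measure zero even if the other factor is
    infinite. For [n = 0] the measure is a Dirac mass. *)
Lemma lebesgue_rV_set1 n (x : 'rV[R]_n) : (0 < n)%N -> lebesgue_rV R n [set x] = 0.
Proof.
case: n x => // n x _; apply/eqP; rewrite eq_le measure_ge0 andbT.
have E : (@cons_rV R n) @^-1` [set x] `<=` [set x 0%R 0%R] `*` setT.
  by move=> p /= px; split => //=; rewrite -px -[LHS]/(p.1) -{1}(uncons_rVK p).
have mx : measurable ((@cons_rV R n) @^-1` [set x]).
  rewrite -[X in measurable X]setTI; apply: measurable_cons_rV => //.
  rewrite -[[set x]]setCK; apply: measurableC; apply: sub_sigma_algebra.
  apply: closed_openC; apply: accessible_closed_set1; apply: hausdorff_accessible.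
  exact: norm_hausdorff.
have h : (@lebesgue_measure R \x lebesgue_rV R n) ((@cons_rV R n) @^-1` [set x]) <=
    (@lebesgue_measure R \x lebesgue_rV R n) ([set x 0%R 0%R] `*` setT).
  by apply: le_measure; rewrite ?inE//; exact: measurableX.
apply: (le_trans h); rewrite product_measure1E//.
have l0 : lebesgue_measure [set x 0%R 0%R] = 0 by exact: lebesgue_measure_set1.
by rewrite [X in X * _]l0 mul0e.
Qed.

(** [lam] is measurable and nonnegative on [S] only; extended by zero it is so everywhere, and gives
    no mass to the complement. *)
Let lamS := (lam \_ S)%R.

Let mlamS : measurable_fun setT lamS.
Proof.
apply/(measurable_restrictT _ (measurable_state_space cS)).
exact: intensity_measurable hlam.
Qed.

Let lamS_ge0 x : (0 <= lamS x)%R.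
Proof.
rewrite /lamS patchE; case: ifPn => // xS; apply: (intensity_ge0 hlam).
by rewrite inE in xS.
Qed.

Definition intensity_measure : set 'rV[R]_d -> \bar R :=
  density_measure (lebesgue_rV R d) mlamS lamS_ge0.

HB.instance Definition _ := Measure.on intensity_measure.

Lemma intensity_measureE (B : set 'rV[R]_d) : B `<=` S ->
  intensity_measure B = \int[lebesgue_rV R d]_(s in B) (lam s)%:E.
Proof.
move=> BS; apply: eq_integral => x; rewrite inE => Bx.
by rewrite /lamS patchE mem_set//; exact: BS.
Qed.

Lemma intensity_measureC : intensity_measure (~` S) = 0.
Proof.
rewrite /intensity_measure /density_measure (eq_integral (cst 0)) ?integral0//.
by move=> x; rewrite inE => Sx; rewrite /lamS patchE memNset.
Qed.

Lemma intensity_measure_set1 x : intensity_measure [set x] = 0.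
Proof.
apply: null_set_integral; last exact: lebesgue_rV_set1.
  rewrite -[[set x]]setCK; apply: measurableC; apply: sub_sigma_algebra.
  apply: closed_openC; apply: accessible_closed_set1; apply: hausdorff_accessible.
  exact: norm_hausdorff.
by apply/measurable_EFinP; exact: measurable_funTS.
Qed.

Let intensity_measure_finite : fin_num_fun intensity_measure.
Proof.
move=> A mA; have mS := measurable_state_space cS.
rewrite ge0_fin_numE ?measure_ge0//.
have h1 : intensity_measure A <= intensity_measure setT.
  by apply: le_measure; rewrite ?inE.
have h2 : intensity_measure (S `|` ~` S) <=
    intensity_measure S + intensity_measure (~` S).
  by apply: measureU2 => //; exact: measurableC.
rewrite intensity_measureC adde0 setUv in h2.
apply: (le_lt_trans (le_trans h1 h2)).
by rewrite intensity_measureE//; exact: intensity_finite hlam.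
Qed.

HB.instance Definition _ :=
  Measure_isFinite.Build _ _ _ intensity_measure intensity_measure_finite.

End intensity_measure.

(** * Measurability on each cardinality *)

Section by_card.
Variables (R : realType) (d : nat) (S : set 'rV[R]_d).
Hypothesis cS : compact S.
Variables (d' : measure_display) (T : measurableType d').
Variables (c : T -> conf_space S).
Hypothesis mc : measurable_fun setT c.

Let measurable_card n : measurable [set x | #|` c x| = n].
Proof.
have := mc measurableT (measurable_cardfs cS [set n]).
by rewrite setTI.
Qed.

(** The cardinalities cut [T] into countably many measurable pieces. On the piece of size [n],
    vectors whose length depends on the configuration can be replaced by vectors of length [n]. *)
Lemma measurable_by_card (U : set T) :
  (forall n, exists2 V, measurable V & forall x, #|` c x| = n -> U x <-> V x) ->
  measurable U.
Proof.
move=> h; rewrite (_ : U = \bigcup_n ([set x | #|` c x| = n] `&` U)).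
  apply: bigcupT_measurable => n; have [V mV UV] := h n.
  rewrite (_ : _ `&` U = [set x | #|` c x| = n] `&` V); first exact: measurableI.
  by apply/seteqP; split => x /= [xn] /(UV _ xn).
by apply/seteqP; split => x /=; [exists #|` c x|%fset|move=> [n _ []]].
Qed.

Lemma measurable_fun_by_card d2 (Z : measurableType d2) (g : T -> Z) :
  (forall n, exists2 h, measurable_fun setT h &
    forall x, #|` c x| = n -> g x = h x) ->
  measurable_fun setT g.
Proof.
move=> hg _ A mA; rewrite setTI; apply: measurable_by_card => n.
have [h mh gh] := hg n; exists (h @^-1` A) => [|x /gh]; last by rewrite /preimage/= => ->.
by have := mh measurableT A mA; rewrite setTI.
Qed.

End by_card.

(** * Kernels at a fixed number of locations *)

Section pogamp_existence.
Variables (R : realType) (d : nat) (S : set 'rV[R]_d).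
Variables (X : set R) (f : forall n, 'rV[S]_n -> probability 'rV[R]_n R).
Variables (dens : forall n, 'rV[S]_n -> 'rV[R]_n -> R).
Variables (m : S -> R) (Sigma : S -> S -> R) (G : probability (path_space S) R).
Hypothesis cS : compact S.
Hypothesis hf : distribution_class X f dens.
Hypothesis hG : gaussian_process m Sigma G.
Let cSigma : continuous (fun p : S * S => Sigma p.1 p.2) := covariance_continuous hG.
Local Notation krige := (krige cSigma).
Local Notation omega := (path_space S * conf_space S)%type.
Local Open Scope ereal_scope.

Section fixed_size.
Variables (n : nat) (s0 : 'rV[S]_n).
Local Notation locs_or := (locs_or s0).

Let measurable_locs_or_box i p :
  measurable [set N : conf_space S | sub_box S p (locs_or N 0%R i)].
Proof. exact: (measurable_locs_or cS s0 i (measurable_rat_box p)). Qed.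

Lemma measurable_krige_locs d' (T : measurableType d') (N : T -> conf_space S)
    (y : T -> 'rV[R]_n) (Y : T -> path_space S) :
  measurable_fun setT N -> measurable_fun setT y -> measurable_fun setT Y ->
  measurable_fun setT (fun x => krige (locs_or (N x)) (y x) (Y x)).
Proof.
move=> mN my mY; apply: measurable_krige => // i p.
by have := mN measurableT _ (measurable_locs_or_box i p); rewrite setTI.
Qed.

Lemma measurable_values_locs :
  measurable_fun setT (fun w : omega => values w.1 (locs_or w.2)).
Proof.
apply: measurable_mxP => i j; under eq_fun do rewrite mxE.
apply: (measurable_eval_joint (f := fst) (u := fun w => locs_or w.2 0%R j)) => p.
  exact: (measurableT_comp (measurable_path_eval p) measurable_fst).
have := @measurable_snd _ _ (path_space S) (conf_space S) measurableT _
  (measurable_locs_or_box j p).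
by rewrite setTI.
Qed.

Definition krige_kernel (x : conf_space S * 'rV[R]_n) :
    {measure set (path_space S) -> \bar R} :=
  image_measure G (measurable_krige_path cSigma cS (locs_or x.1) x.2).

Let measurable_krige_kernel U : measurable U ->
  measurable_fun setT (krige_kernel ^~ U).
Proof.
move=> mU; pose W := (fun q : (conf_space S * 'rV[R]_n) * path_space S =>
  krige (locs_or q.1.1) q.1.2 q.2) @^-1` U.
have mW : measurable W.
  rewrite -[X in measurable X]setTI; apply: measurable_krige_locs => //.
  - exact: (measurableT_comp measurable_fst measurable_fst).
  - exact: (measurableT_comp measurable_snd measurable_fst).
rewrite (_ : (fun _ => _) = G \o xsection W); first exact: measurable_fun_xsection.
apply/funext => x; rewrite /krige_kernel /image_measure /pushforward/=.
by congr (G _); apply/seteqP; split => Y /=; rewrite xsectionE.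
Qed.

HB.instance Definition _ :=
  isKernel.Build _ _ _ _ R krige_kernel measurable_krige_kernel.

Let krige_kernel_setT x : krige_kernel x setT = 1.
Proof. exact: (@probability_setT _ _ _ (image_measure G _)). Qed.

HB.instance Definition _ :=
  Kernel_isProbability.Build _ _ _ _ R krige_kernel krige_kernel_setT.

(** The density is cut down to the region where [class_continuous] gives measurability; for
    configurations of size [n] this changes nothing, by [class_density0]. *)
Let dens_locs (p : conf_space S * 'rV[R]_n) : R :=
  ((fun p => dens (locs_or p.1) p.2) \_
    [set p | #|` p.1| = n /\ @power_set R n X p.2])%R p.

Lemma measurable_power_set : measurable (@power_set R n X).
Proof.
rewrite (_ : @power_set R n X = \bigcap_(i in [set: 'I_n])
    (fun y : 'rV[R]_n => y 0%R i) @^-1` X).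
  apply: fin_bigcap_measurable => [|i _]; first exact: finite_finset.
  rewrite -[X in measurable X]setTI; apply: measurable_mx_coord => //.
  exact: class_measurable hf.
by apply/seteqP; split => y /= h i; [move=> _|]; exact: h.
Qed.

Lemma distinct_locs_or N : #|` N| = n -> distinct (locs_or N).
Proof.
move=> e; rewrite (locs_orE s0 e); case: n / e s0 => _.
by rewrite castmx_id; exact: locs_distinct.
Qed.

Let measurable_dens_locs : measurable_fun setT dens_locs.
Proof.
have mX := measurable_power_set.
have mc (A : set nat) (B : set 'rV[R]_n) : measurable B ->
    measurable [set p : conf_space S * 'rV[R]_n | A #|` p.1| /\ B p.2].
  move=> mB; exact: (measurableX (measurable_cardfs cS A) mB).
pose M := [set p : conf_space S * 'rV[R]_n | #|` p.1| = n /\ @power_set R n X p.2].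
have mM : measurable M by exact: (mc [set n]).
apply/(measurable_restrictT _ mM).
pose D := [set p : 'rV[S]_n * 'rV[R]_n | distinct p.1 /\ @power_set R n X p.2].
pose xi (p : conf_space S * 'rV[R]_n) := (locs_or p.1, p.2).
have mD : measurable (xi @^-1` D).
  (* Configurations of another size are sent to [s0], so the preimage of [D] contains them or not
     according to whether [s0] has distinct entries. *)
  have [ds|nds] := pselect (distinct s0).
    rewrite (_ : _ @^-1` _ = [set p | setT #|` p.1| /\ @power_set R n X p.2]).
      exact: mc.
    apply/seteqP; split => -[N y] /=; first by case.
    move=> [_ Xy]; split => //; have [e|ne] := pselect (#|` N| = n).
      exact: distinct_locs_or.
    by rewrite /= (locs_or_junk s0 ne).
  rewrite (_ : _ @^-1` _ = M)//.
  apply/seteqP; split => -[N y] [/= h Xy]; split => //=.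
    by apply: contrapT => ne; apply: nds; rewrite -(locs_or_junk s0 ne).
  exact: distinct_locs_or.
have base := countable_base_prod
  (@countable_base_rV _ _ _ n (@countable_base_sub_box R d S))
  (@countable_base_rat_box R n).
have mxi (i : {ffun 'I_n -> 'rV[rat]_d * nat} * ('rV[rat]_n * nat)) :
    measurable (xi @^-1` ([set s : 'rV[S]_n |
        forall j, sub_box S (i.1 j) (s 0%R j)] `*` rat_box i.2 :
      set ('rV[S]_n * 'rV[R]_n))).
  rewrite (_ : _ @^-1` _ = [set N : conf_space S | forall j,
      sub_box S (i.1 j) (locs_or N 0%R j)] `*` rat_box i.2)//.
  apply: measurableX; last exact: measurable_rat_box.
  rewrite (_ : mkset _ = \bigcap_(j in [set: 'I_n])
      [set N : conf_space S | sub_box S (i.1 j) (locs_or N 0%R j)]).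
    by apply: fin_bigcap_measurable => //; exact: finite_finset.
  by apply/seteqP; split => N /= h j; [move=> _|]; exact: h.
have := measurable_comp_within base mxi mD (@class_continuous _ _ _ _ _ _ hf n).
apply: measurable_funS => //.
by move=> -[N y] [/= e Xy]; split => //=; exact: distinct_locs_or.
Qed.

(** Zero on the other sizes, where [locs_or] is the junk vector [s0], possibly with repeated entries
    and so without a density. This leaves a finite kernel instead of a probability kernel. *)
Definition value_kernel (N : conf_space S) : {measure set 'rV[R]_n -> \bar R} :=
  if #|` N| == n then (f (locs_or N) : {measure set 'rV[R]_n -> \bar R})
  else (mzero : {measure set 'rV[R]_n -> \bar R}).

Let measurable_value_kernel U : measurable U ->
  measurable_fun setT (value_kernel ^~ U).
Proof.
move=> mU.
pose h (p : conf_space S * 'rV[R]_n) := (\1_U p.2 * dens_locs p)%:E.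
have mh : measurable_fun setT h.
  apply/measurable_EFinP; apply: measurable_funM => //.
  exact: (measurableT_comp (measurable_indic mU) measurable_snd).
have dens0 N (y : 'rV[R]_n) : #|` N| = n -> dens_locs (N, y) = dens (locs_or N) y.
  move=> e; rewrite /dens_locs patchE; case: ifPn => // /negP h'.
  rewrite (class_density0 hf)//; first exact: distinct_locs_or.
  by move=> Xy; apply: h'; rewrite inE.
have h0 p : 0 <= h p.
  rewrite lee_fin mulr_ge0//; case: p => N y; have [e|ne] := pselect (#|` N| = n).
    rewrite dens0//; have [_ + _] := class_density hf (distinct_locs_or e).
    exact.
  by rewrite /dens_locs patchE memNset//= => -[].
rewrite (_ : (fun _ => _) = (fun N => \int[lebesgue_rV R n]_y h (N, y))).
  exact: measurable_fun_fubini_tonelli_F.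
apply/funext => N; rewrite /value_kernel; case: eqP => e.
  have [_ _ fE] := class_density hf (distinct_locs_or e).
  transitivity (f (locs_or N) U) => //; rewrite fE//.
  rewrite integral_indicE//; apply: eq_integral => y _.
  by rewrite /h dens0.
rewrite (eq_integral (cst 0)) ?integral0// => y _.
by rewrite /h /dens_locs patchE memNset ?mulr0// => -[].
Qed.

HB.instance Definition _ :=
  isKernel.Build _ _ _ _ R value_kernel measurable_value_kernel.

Let value_kernel_finite : measure_fam_uub value_kernel.
Proof.
(* The uniform bound has to be strict, and the masses reach 1. *)
exists 2%R => N; rewrite /value_kernel; case: ifP => _; last by rewrite lte_fin.
by rewrite [X in X < _]probability_setT lte_fin ltr1n.
Qed.

HB.instance Definition _ :=
  Kernel_isFinite.Build _ _ _ _ R value_kernel value_kernel_finite.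

Definition krige_pker : R.-pker (conf_space S * 'rV[R]_n) ~> path_space S :=
  krige_kernel.

Definition value_fker : R.-fker conf_space S ~> 'rV[R]_n := value_kernel.

End fixed_size.

End pogamp_existence.

(** * The law of the pair and its conditional laws *)

Section pogamp_law.
Variables (R : realType) (d : nat) (S : set 'rV[R]_d).
Variables (X : set R) (f : forall n, 'rV[S]_n -> probability 'rV[R]_n R).
Variables (dens : forall n, 'rV[S]_n -> 'rV[R]_n -> R).
Variables (m : S -> R) (Sigma : S -> S -> R) (G : probability (path_space S) R).
Hypothesis cS : compact S.
Hypothesis hf : distribution_class X f dens.
Hypothesis hG : gaussian_process m Sigma G.
Let cSigma : continuous (fun p : S * S => Sigma p.1 p.2) := covariance_continuous hG.
Local Notation krige := (krige cSigma).
Local Notation omega := (path_space S * conf_space S)%type.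
Local Open Scope ereal_scope.

Let locs_orT N (s0 : 'rV[S]_#|` N|) : locs_or s0 N = locs N.
Proof. by rewrite (locs_orE s0 erefl) castmx_id. Qed.

Lemma krige_locs (N : conf_space S) y Y : values (krige (locs N) y Y) (locs N) = y.
Proof.
apply: krige_values; apply: posdef_unitmx; apply: (posdef_cov_mx hG).
exact: locs_distinct.
Qed.

Definition path_locs (N : conf_space S) (p : 'rV[R]_#|` N| * path_space S) : omega :=
  (krige (locs N) p.1 p.2, N).

Lemma measurable_path_locs N : measurable_fun setT (@path_locs N).
Proof.
apply: measurable_fun_pair => //.
apply: (measurable_krige cSigma cS (s := cst (locs N))) => // i p.
have [h|h] := pselect (sub_box S p (locs N 0%R i)).
  by rewrite (_ : mkset _ = setT)//; apply/seteqP; split.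
by rewrite (_ : mkset _ = set0)//; apply/seteqP; split.
Qed.

Lemma obs_path_locs N p : obs (@path_locs N p) = p.1.
Proof. by case: p => y Y; exact: krige_locs. Qed.

Definition path_kernel (N : conf_space S) : {measure set omega -> \bar R} :=
  image_measure (f (locs N) \x G) (@measurable_path_locs N).

Lemma path_kernelE N (U : set omega) : path_kernel N U =
  \int[f (locs N)]_y G [set Y | U (path_locs (y, Y))].
Proof.
rewrite /path_kernel /image_measure /pushforward /product_measure1.
apply: eq_integral => y _ /=; congr (G _).
by apply/seteqP; split => Y /=; rewrite xsectionE.
Qed.

Let measurable_path_kernel U : measurable U ->
  measurable_fun setT (path_kernel ^~ U).
Proof.
move=> mU; apply: (measurable_fun_by_card cS (c := id)) => // n.
(* There is a junk vector [s0] unless [S] is empty and [n] positive, in which case no configuration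
   has size [n]: its locations would be such a vector. *)
have [[s0 _]|ns] := pselect (exists s0 : 'rV[S]_n, True); last first.
  exists (cst 0) => // N e; exfalso; apply: ns.
  by exists (castmx (erefl, e) (locs N)).
pose W := (fun q : (conf_space S * 'rV[R]_n) * path_space S =>
  (krige (locs_or s0 q.1.1) q.1.2 q.2, q.1.1)) @^-1` U.
have mW : measurable W.
  rewrite -[X in measurable X]setTI.
  have m1 : measurable_fun setT (fun q : (conf_space S * 'rV[R]_n) * path_space S => q.1.1).
    exact: (measurableT_comp measurable_fst measurable_fst).
  have m2 : measurable_fun setT (fun q : (conf_space S * 'rV[R]_n) * path_space S => q.1.2).
    exact: (measurableT_comp measurable_snd measurable_fst).
  have := measurable_fun_pair (measurable_krige_locs cS hG s0 m1 m2 measurable_snd) m1.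
  exact.
have mphi : measurable_fun setT (G \o xsection W) by exact: measurable_fun_xsection.
exists (fun N => \int[value_kernel f s0 N]_y (G \o xsection W) (N, y)).
  exact: (measurable_fun_integral_finite_kernel (G \o xsection W) (value_fker cS hf s0)).
move=> N e; rewrite /W {W mW mphi}; case: n / e s0 => s0.
rewrite path_kernelE /value_kernel eqxx locs_orT.
apply: eq_integral => y _ /=; congr (G _).
by apply/seteqP; split => Y /=; rewrite xsectionE/= locs_orT.
Qed.

HB.instance Definition _ :=
  isKernel.Build _ _ _ _ R path_kernel measurable_path_kernel.

Let path_kernel_setT N : path_kernel N setT = 1.
Proof. exact: (@probability_setT _ _ _ (image_measure (f (locs N) \x G) _)). Qed.

HB.instance Definition _ :=
  Kernel_isProbability.Build _ _ _ _ R path_kernel path_kernel_setT.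

(** Hides the choice of [s0], so that there is a kernel for every [n], including those for which no
    vector of [n] locations exists. *)
Lemma exists_krige_kernel n : exists k : R.-pker (conf_space S * 'rV[R]_n) ~> path_space S,
  forall N (e : #|` N| = n) y A,
    k (N, y) A = G [set Y | A (krige (castmx (erefl, e) (locs N)) y Y)].
Proof.
have [[s0 _]|ns] := pselect (exists s0 : 'rV[S]_n, True); last first.
  exists (const_kernel G) => N e; exfalso; apply: ns.
  by exists (castmx (erefl, e) (locs N)).
exists (krige_pker cS hG s0) => N e y A.
by rewrite -(locs_orE s0).
Qed.

Definition conditional_kernel n : R.-pker (conf_space S * 'rV[R]_n) ~> path_space S :=
  projT1 (cid (exists_krige_kernel n)).

Lemma conditional_kernelE N y A :
  conditional_kernel #|` N| (N, y) A = G [set Y | A (krige (locs N) y Y)].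
Proof.
rewrite /conditional_kernel; case: cid => k /= kE.
by rewrite (kE N erefl) castmx_id.
Qed.

Lemma gaussian_conditional_kernel : gaussian_conditional G conditional_kernel.
Proof.
move=> N A B mA mB.
rewrite (krige_conditional hG cS cSigma (@locs_distinct _ _ _ N) mA mB).
by apply: eq_integral => Y _; rewrite conditional_kernelE.
Qed.

Lemma measurable_obs_event (D : forall n, set (conf_space S * 'rV[R]_n)) :
  (forall n, measurable (D n)) ->
  measurable [set w : omega | D _ (w.2, obs w)].
Proof.
move=> mD; apply: (measurable_by_card cS (c := snd)) => // n.
have [[s0 _]|ns] := pselect (exists s0 : 'rV[S]_n, True); last first.
  exists set0 => // w e; exfalso; apply: ns.
  by exists (castmx (erefl, e) (locs w.2)).
exists [set w : omega | D n (w.2, values w.1 (locs_or s0 w.2))].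
  rewrite -[X in measurable X]setTI.
  have := measurable_fun_pair (@measurable_snd _ _ (path_space S) (conf_space S))
    (measurable_values_locs cS s0).
  by move=> /(_ measurableT _ (mD n)).
move=> [Y N] /= e; case: n / e s0 => s0.
by rewrite /obs/= locs_orT.
Qed.

Lemma measurable_conditional_kernel (A : set (path_space S)) : measurable A ->
  measurable_fun setT (fun w : omega => conditional_kernel _ (w.2, obs w) A).
Proof.
move=> mA; apply: (measurable_fun_by_card cS (c := snd)) => // n.
have [[s0 _]|ns] := pselect (exists s0 : 'rV[S]_n, True); last first.
  exists (cst 0) => // w e; exfalso; apply: ns.
  by exists (castmx (erefl, e) (locs w.2)).
exists (fun w : omega => conditional_kernel n (w.2, values w.1 (locs_or s0 w.2)) A).
  apply: (measurableT_comp (measurable_kernel (conditional_kernel n) A mA)).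
  exact: (measurable_fun_pair measurable_snd (measurable_values_locs cS s0)).
move=> [Y N] /= e; case: n / e s0 => s0.
by rewrite /obs/= locs_orT.
Qed.

Variable Pi : probability (conf_space S) R.

Definition pogamp_prob : probability omega R := mixture Pi path_kernel.

Lemma pogamp_probE A : pogamp_prob A = \int[Pi]_N path_kernel N A.
Proof. exact: mixtureE. Qed.

Lemma ge0_integral_pogamp_prob (h : omega -> \bar R) : (forall w, 0 <= h w) ->
  measurable_fun setT h ->
  \int[pogamp_prob]_w h w =
  \int[Pi]_N \int[f (locs N)]_y \int[G]_Y h (path_locs (y, Y)).
Proof.
move=> h0 mh; rewrite ge0_integral_mixture//; apply: eq_integral => N _.
rewrite ge0_integral_image_measure// (fubini_tonelli1 (h \o @path_locs N))//.
  by apply: measurableT_comp => //; exact: measurable_path_locs.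
by move=> x; exact: h0.
Qed.

Lemma pogamp_prob_conf (C : set (conf_space S)) : measurable C ->
  pogamp_prob [set w | C w.2] = Pi C.
Proof.
move=> mC; rewrite pogamp_probE.
rewrite (eq_integral (fun N => (\1_C N)%:E)); last first.
  move=> N _; rewrite path_kernelE indicE; case: (boolP (N \in C)) => NC.
    rewrite inE in NC; rewrite (eq_integral (cst 1)).
      by rewrite integral_cst// mul1e; exact: probability_setT.
    move=> y _; rewrite (_ : [set Y | _] = setT) ?probability_setT//.
    by apply/seteqP; split.
  rewrite notin_setE in NC; rewrite (eq_integral (cst 0)) ?integral0//.
  move=> y _; rewrite (_ : [set Y | _] = set0) ?measure0//.
  by rewrite -subset0.
by rewrite integral_indic// setIT.
Qed.

(** Kriging interpolates: the values observed at [locs N] are the drawn [y] itself, so given [N] the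
    event has probability [f (locs N)] of [B]. *)
Lemma pogamp_prob_values : values_given_locations dens pogamp_prob.
Proof.
move=> C B mC mB.
pose psi (N : conf_space S) := f (locs N) (B #|` N|).
have psiE N : \int[lebesgue_rV R _]_(y in B #|` N|) (dens (locs N) y)%:E = psi N.
  by have [_ _ fE] := class_density hf (@locs_distinct _ _ _ N); exact/esym/fE.
have mpsi : measurable_fun setT psi.
  apply: (measurable_fun_by_card cS (c := id)) => // n.
  have [[s0 _]|ns] := pselect (exists s0 : 'rV[S]_n, True); last first.
    exists (cst 0) => // N e; exfalso; apply: ns.
    by exists (castmx (erefl, e) (locs N)).
  exists (fun N => value_kernel f s0 N (B n)).
    exact: (measurable_kernel (value_fker cS hf s0)).
  move=> N e; case: n / e s0 => s0.
  by rewrite /psi /value_kernel eqxx locs_orT.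
rewrite pogamp_probE [RHS]integral_mkcond.
rewrite [RHS](eq_integral (fun w : omega => (\1_C w.2)%:E * psi w.2)); last first.
  move=> w _; rewrite patchE indicE psiE.
  have -> : (w \in [set w | C w.2]) = (w.2 \in C).
    by apply/idP/idP; rewrite !inE.
  by case: ifP => _; rewrite ?mul1e ?mul0e.
have mh : measurable_fun setT (fun w : omega => (\1_C w.2)%:E * psi w.2).
  apply: emeasurable_funM; last exact: measurableT_comp.
  by apply/measurable_EFinP; apply: measurableT_comp => //; exact: measurable_indic.
have h0 w : 0 <= (\1_C (w : omega).2)%:E * psi w.2 by rewrite mule_ge0// lee_fin.
rewrite (ge0_integral_pogamp_prob h0 mh).
apply: eq_integral => N _; rewrite path_kernelE/=.
under [RHS]eq_integral do rewrite integral_cst// [X in _ * X]probability_setT mule1.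
rewrite integral_cst// [X in _ = _ * X]probability_setT mule1 indicE.
case: (boolP (N \in C)) => NC.
  rewrite mul1e inE in NC *.
  rewrite (eq_integral (fun y => (\1_(B #|` N|) y)%:E)).
    by rewrite integral_indic// setIT.
  move=> y _; rewrite indicE; case: (boolP (y \in B #|` N|)) => yB.
    rewrite (_ : [set Y | _] = setT) ?probability_setT//.
    by apply/seteqP; split => // Y _ /=; split => //; rewrite obs_path_locs; rewrite inE in yB.
  rewrite (_ : [set Y | _] = set0) ?measure0// -subset0 => Y /= [_].
  by rewrite obs_path_locs; rewrite notin_setE in yB.
rewrite mul0e; rewrite notin_setE in NC; rewrite (eq_integral (cst 0)) ?integral0//.
by move=> y _; rewrite (_ : [set Y | _] = set0) ?measure0// -subset0 => Y /= [].
Qed.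

(** Once [N] and [y] are drawn, the observation is [(N, y)] for every path [Y] drawn from [G]. The
    integrand on the right is then constant in [Y], and equals the probability under [G] appearing
    on the left. *)
Lemma pogamp_prob_path : path_given_values conditional_kernel pogamp_prob.
Proof.
move=> A D mA mD; rewrite pogamp_probE [RHS]integral_mkcond.
have mE := measurable_obs_event mD.
pose E := [set w : omega | D _ (w.2, obs w)].
rewrite [RHS](eq_integral (fun w : omega => (\1_E w)%:E *
    conditional_kernel _ (w.2, obs w) A)); last first.
  move=> w _; rewrite patchE indicE -/E.
  by case: ifP => _; rewrite ?mul1e ?mul0e.
have mh : measurable_fun setT (fun w : omega => (\1_E w)%:E *
    conditional_kernel _ (w.2, obs w) A).
  apply: emeasurable_funM; last exact: measurable_conditional_kernel.
  by apply/measurable_EFinP; exact: measurable_indic.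
have h0 w : 0 <= (\1_E w)%:E * conditional_kernel _ (w.2, obs w) A.
  by rewrite mule_ge0// lee_fin.
rewrite (ge0_integral_pogamp_prob h0 mh).
apply: eq_integral => N _; rewrite path_kernelE; apply: eq_integral => y _.
rewrite (eq_integral (cst ((\1_(D #|` N|) (N, y))%:E *
    conditional_kernel _ (N, y) A))); last first.
  move=> Y _ /=; rewrite obs_path_locs; congr ((nat_of_bool _)%:R%:E * _).
  by apply/idP/idP; rewrite !inE /E/= obs_path_locs.
rewrite integral_cst// [X in _ = _ * X]probability_setT mule1 conditional_kernelE.
rewrite indicE; case: (boolP (_ \in _)) => yD.
  rewrite mul1e; congr (G _); rewrite inE in yD.
  by apply/seteqP; split => Y /=; rewrite obs_path_locs; [case|].
rewrite mul0e (_ : [set Y | _] = set0) ?measure0// -subset0 => Y /= [_].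
by rewrite obs_path_locs; rewrite notin_setE in yD.
Qed.

End pogamp_law.

Theorem theorem1 (R : realType) (d : nat) (S : set 'rV[R]_d)
    (lam : 'rV[R]_d -> R) (X : set R)
    (f : forall n, 'rV[S]_n -> probability 'rV[R]_n R)
    (dens : forall n, 'rV[S]_n -> 'rV[R]_n -> R)
    (m : S -> R) (Sigma : S -> S -> R) (G : probability (path_space S) R) :
  (0 < d)%N -> compact S ->
  intensity S lam ->
  distribution_class X f dens ->
  gaussian_process m Sigma G ->
  exists P : probability (path_space S * conf_space S)%type R,
    pogamp lam dens G P /\
    forall s : S, measurable_fun setT
      (fun w : path_space S * conf_space S => w.1 s).
Proof.
move=> d0 cS hlam hf hG.
pose Pi := poisson_conf_prob cS (intensity_measureC cS hlam)
  (intensity_measure_set1 d0 cS hlam).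
pose P := pogamp_prob cS hf hG Pi.
have PiE B : measurable B -> B `<=` S -> forall A : set nat,
    Pi [set N | A (card_in B N)] = poisson_prob (mean_measure lam B) 0%N A.
  move=> mB BS A; rewrite /mean_measure -(intensity_measureE cS hlam BS).
  exact: poisson_conf_card_in.
have PE B : measurable B -> B `<=` S -> forall A : set nat,
    P [set w | A (card_in B w.2)] = poisson_prob (mean_measure lam B) 0%N A.
  move=> mB BS A; rewrite -PiE//.
  exact: (pogamp_prob_conf cS hf hG Pi (measurable_card_in cS A mB)).
exists P; split; last first.
  by move=> s; exact: (measurableT_comp (measurable_path_eval s) measurable_fst).
split; last 1 first.
- exists (conditional_kernel cS hG); split; first exact: gaussian_conditional_kernel.
  exact: pogamp_prob_path.
- split=> [//|k B mB BS tB A].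
  (* The events concern [N] alone, whose marginal law is [Pi], so independence is that of the
     Poisson configuration. *)
  transitivity (Pi [set N | forall i, A i (card_in (B i) N)]).
    apply: (pogamp_prob_conf cS hf hG Pi
      (C := [set N : conf_space S | forall i, A i (card_in (B i) N)])).
    rewrite (_ : mkset _ = \bigcap_(i in [set: 'I_k]) (card_in (B i) @^-1` A i)).
      apply: fin_bigcap_measurable => [|i _]; first exact: finite_finset.
      exact: measurable_card_in.
    by apply/seteqP; split => N /= h i; [move=> _|]; exact: h.
  transitivity (\prod_i poisson_prob
      (fine (intensity_measure cS hlam (B i))) 0 (A i))%E.
    exact: poisson_conf_independent.
  apply: eq_bigr => i _; rewrite (PE _ (mB i) (BS i)) /mean_measure.
  by rewrite -(intensity_measureE cS hlam (BS i)).
- exact: pogamp_prob_values.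
Qed.
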